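(* For every $n\in\mathbb{N}$ let $Q_n^{(1)}(x)$ and $Q_n^{(2)}(x)$ be real polynomials (not identically zero) of degree at most $n$, with nonnegative roots. Suppose that, as $n\to\infty$, $$[\![Q_n^{(1)}]\!]_n\to\nu_1,\qquad[\![Q_n^{(2)}]\!]_n\to\nu_2\qquad\text{weakly on }[0,+\infty],$$ where $\nu_1$ and $\nu_2$ are probability measures on $[0,+\infty]$. Also suppose that the intervals $(\nu_1(\{0\}),1-\nu_1(\{+\infty\}))$ and $(\nu_2(\{0\}),1-\nu_2(\{+\infty\}))$ have a nonempty intersection. Then $$[\![Q_n^{(1)}\boxtimes_nQ_n^{(2)}]\!]_n\to\nu\qquad\text{weakly on }[0,+\infty],$$ for some probability measure $\nu$ on $[0,+\infty]$. If $\nu_1(\{+\infty\})=\nu_2(\{+\infty\})=0$, then $\nu=\nu_1\boxtimes\nu_2$ is the classical free multiplicative convolution of $\nu_1$ and $\nu_2$.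
   Context: Empirical zero distribution: for a polynomial $Q\not\equiv0$ with $\deg Q\le n$, $$[\![Q]\!]_n:=\frac1n\sum_{z\in\mathbb{C}:Q(z)=0}\delta_z+\frac{n-\deg Q}{n}\delta_\infty,$$ zeros counted with multiplicity; for nonnegative roots $\infty$ is identified with $+\infty$, so $[\![Q]\!]_n$ is a probability measure on $[0,+\infty]$. Finite free multiplicative convolution: $$\sum_{k=0}^na_{k:n}^{(1)}x^k\boxtimes_n\sum_{k=0}^na_{k:n}^{(2)}x^k=\sum_{k=0}^n(-1)^{n-k}\frac{a_{k:n}^{(1)}a_{k:n}^{(2)}}{\binom nk}x^k.$$ (Under the assumptions it is not identically zero for large $n$; the convergence concerns large $n$.) Classical free multiplicative convolution $\boxtimes$: the Voiculescu/Bercovici–Voiculescu convolution of probability measures on $[0,\infty)$. For $\nu_1,\nu_2\neq\delta_0$ it is characterized by $S_{\nu_1\boxtimes\nu_2}(t)=S_{\nu_1}(t)S_{\nu_2}(t)$ on the common domain, where, for a probability measure $\nu\ne\delta_0$ on $[0,\infty)$, $\psi_\nu(t)=\int_{[0,\infty)}\frac{zt}{1-zt}\nu(dz)$ for $t<0$ (a strictly increasing bijection of $(-\infty,0)$ onto $(\nu(\{0\})-1,0)$) and $S_\nu(t)=\frac{t+1}{t}\psi_\nu^{\leftarrow}(t)$ for $t\in(\nu(\{0\})-1,0)$, with $\psi_\nu^{\leftarrow}$ the inverse function. *)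

(* Defs.v *)
From HB Require Import structures.
From mathcomp Require Import all_boot all_order all_algebra.
From mathcomp Require Import all_classical all_reals all_analysis.
(* [measurable_realfun] provides the Borel sigma-algebra on [\bar R]; it is not
   exported by [all_analysis]. *)
From mathcomp Require Import measurable_realfun.
From mathcomp Require Import complex.

Set Implicit Arguments.
Unset Strict Implicit.
Unset Printing Implicit Defensive.

Import Order.TTheory GRing.Theory Num.Theory.
Import numFieldNormedType.Exports.

Local Open Scope classical_set_scope.
Local Open Scope ring_scope.

Section Defs.
Context {R : realType}.

(* On [R[i]], [0 <= z] means that [z] is real and nonnegative. *)
Definition nonneg_rooted (Q : {poly R}) : Prop :=
  forall z : R[i], root (map_poly (real_complex R) Q) z -> 0 <= z.

(* Complex zeros listed with multiplicity; arbitrary if [Q = 0]. *)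
Definition complex_zeros (Q : {poly R}) : seq R[i] :=
  sval (closed_field_poly_normal (map_poly (real_complex R) Q)).

(* The compact half-line [0, +oo] is a subset of [\bar R]: its probability
   measures are the probability measures on [\bar R] giving it mass 1. A zero
   [z] is placed at [Re z], which is [z] itself if [Q] is nonneg_rooted. *)
Definition empirical_zeros (n : nat) (Q : {poly R}) :
    {measure set (\bar R) -> \bar R} :=
  mscale (n%:R^-1)%:nng
    (measure_add
       (msum (fun i => \d_((complex.Re (nth 0 (complex_zeros Q) i))%:E))
             (size (complex_zeros Q)))
       (mscale ((n - (size Q).-1)%N%:R)%:nng \d_(+oo%E))).

Definition weak_cvg (mu_ : nat -> {measure set (\bar R) -> \bar R})
    (mu : {measure set (\bar R) -> \bar R}) : Prop :=
  forall f : \bar R -> R, {within `[0%E, +oo%E]%classic, continuous f} ->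
    (fun n => \int[mu_ n]_(x in `[0%E, +oo%E]%classic) (f x)%:E)%E @ \oo -->
    (\int[mu]_(x in `[0%E, +oo%E]%classic) (f x)%:E)%E.

Definition finite_free_mul (n : nat) (P Q : {poly R}) : {poly R} :=
  \poly_(k < n.+1) ((-1) ^+ (n - k) * (P`_k * Q`_k / 'C(n, k)%:R)).

Implicit Types nu : probability (\bar R) R.

Definition psi_transform nu (t : R) : R :=
  \int[nu]_(z in `[0%E, +oo%E[%classic) (fine z * t / (1 - fine z * t)).

Definition S_domain nu : set R := `]fine (nu [set 0%E]) - 1, 0[%classic.

(* For [t] outside [S_domain nu] the default value 0 is returned. *)
Definition psi_inverse nu (t : R) : R :=
  xget 0 [set s | s < 0 /\ psi_transform nu s = t].

Definition S_transform nu (t : R) : R := (t + 1) / t * psi_inverse nu t.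

(* [nu] is a probability measure on [0, +oo[ other than the Dirac mass at 0. *)
Definition nondegenerate nu : Prop :=
  nu `[0%E, +oo%E[%classic = 1%E /\ (nu [set 0%E] < 1)%E.

(* [nu] is the free multiplicative convolution of [nu1] and [nu2], all three
   nondegenerate. The S-transform determines a nondegenerate measure, so [nu]
   is unique. *)
Definition is_free_mul nu1 nu2 nu : Prop :=
  [/\ nondegenerate nu1, nondegenerate nu2, nondegenerate nu,
      S_domain nu1 `&` S_domain nu2 `<=` S_domain nu
    & forall t, (S_domain nu1 `&` S_domain nu2) t ->
        S_transform nu t = S_transform nu1 t * S_transform nu2 t].

End Defs.

(* Main.v *)
Require Import Defs.
From HB Require Import structures.
From mathcomp Require Import all_boot all_order all_algebra.
From mathcomp Require Import all_classical all_reals all_analysis.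
From mathcomp Require Import measurable_realfun.
From mathcomp Require Import complex.
From mathcomp Require Import ring lra.
Import Order.TTheory GRing.Theory Num.Theory.
Import numFieldNormedType.Exports.
Local Open Scope classical_set_scope.
Local Open Scope ring_scope.

Set Implicit Arguments.
Unset Strict Implicit.
Unset Printing Implicit Defensive.

(** The idea is to read the limiting zero distribution off the ratios of
consecutive coefficients, because finite free convolution acts on these ratios
by multiplication.

Let Q have degree at most n and nonnegative zeros, listed as z, those missing
being placed at +oo. The function F_n(t) = (1/n) * sum_z t / (t + z) is the
logarithmic derivative t P'(t) / (n P(t)) of the polynomial P whose coefficients
p_k are the absolute values of those of Q, and it is also the integral of
z |-> t / (t + z), a continuous function on [0,+oo], against the empirical
measure. Weak convergence to nu therefore gives F_n(t) -> F(t) for t > 0, where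
F is the same integral for nu; F increases from nu {0} to 1 - nu {+oo}, strictly
if these two numbers differ.

From F_n to the coefficients. The number n F_n(t) is the mean of the
probability weights p_k t^k / P(t). The sequence p_k is log-concave, so these
weights are unimodal, and the mean is within a bounded distance of the mode if t
is moved by a constant factor ([pole_sum_ge_mode], [pole_sum_le_mode]). Hence
for k ~ a n and a in the gap (nu {0}, 1 - nu {+oo}), the ratio p_k / p_(k+1)
tends to the solution tau(a) of F(tau(a)) = a ([ratio_of_transform]).
The same two inequalities, read backwards, recover lim F_n from the
limits of the ratios ([transform_gt_of_ratio], [transform_lt_of_ratio]).

The convolution. Up to sign, its k-th coefficient is the product of the two k-th
coefficients divided by binomial(n, k), so its ratios tend to
h(a) = tau1(a) tau2(a) (1 - a) / a ([convolution_has_ratio]). By a concavity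
argument tau(a) (1 - a) / a is nondecreasing ([pole_inverse_odds]), and tau is
strictly increasing; so h is strictly increasing, and it runs from 0 to +oo over
the intersection of the two gaps. Consequently F_n(t) converges for every t > 0
([transform_is_cvg]), and its limit at h(a) is a. The backward reading needs
log-concavity for the convolution, that is, its zeros have to be nonnegative as
well. This is the Schur-Szego theorem ([nonneg_rooted_finite_free_mul]), proved
by composing polar derivatives, each of which preserves the absence of zeros in
the upper half-plane (Laguerre).

The limit measure. In the coordinate v = z / (1 + z) in [0,1], the limits of the
averages of t / (t + z) determine those of the powers of 1 - v, hence those of
all polynomials in v, in particular of polynomials close to step functions. So
the quantile functions of the empirical measures converge outside a countable
set ([quantile_cvg]). The limit quantile function carries the uniform
distribution on [0,1] to the measure nu, and dominated convergence gives weak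
convergence ([weak_limit_exists]).

The S-transform. If nu {+oo} = 0, then psi(-1/t) = F(t) - 1, so that
S(a - 1) = a / ((1 - a) tau(a)); with tau = h for the limit measure, the
multiplicativity of S is the formula for h. *)

(** * Schur-Szego composition as an iterated polar derivative *)

(** Finite free multiplicative convolution over an arbitrary field; over the complex
numbers the factors can be peeled off one zero at a time. *)
Definition schur_szego (F : fieldType) (n : nat) (P Q : {poly F}) : {poly F} :=
  \poly_(k < n.+1) ((-1) ^+ (n - k) * (P`_k * Q`_k / 'C(n, k)%:R)).

(** The polar derivative of P, as a polynomial of formal degree n, with respect to
the point y / z of the projective line, divided by n. *)
Definition polar (F : fieldType) (n : nat) (y z : F) (P : {poly F}) :=
  n%:R^-1 *: (y *: P^`() + z *: (P *+ n - 'X * P^`())).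

Lemma horner_schur_szego (F : fieldType) n (P Q : {poly F}) x :
  (schur_szego n P Q).[x] =
  \sum_(k < n.+1) (-1) ^+ (n - k) * (P`_k * Q`_k / 'C(n, k)%:R) * x ^+ k.
Proof. by rewrite /schur_szego horner_poly. Qed.

(** Splitting off a linear factor of the second argument lowers the formal degree by
one: with Q = (y X - z) Q1, the recursion of the coefficients of Q is absorbed
into the first argument through binomial(n+1, k+1) = (n+1)/(k+1) binomial(n, k).
The point x of evaluation enters the pole y x / z. *)
Lemma schur_szego_polar (F : numFieldType) n (y z x : F) (P Q : {poly F}) :
  (size Q <= n.+1)%N ->
  (schur_szego n.+1 P ((y *: 'X - z%:P) * Q)).[x] =
  (schur_szego n (polar n.+1 (y * x) z P) Q).[x].
Proof.
move=> sQ; rewrite !horner_schur_szego.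
have cf (k : nat) : ((y *: 'X - z%:P) * Q)`_k =
    (if k is j.+1 then y * Q`_j else 0) - z * Q`_k.
  rewrite mulrBl coefB -scalerAl coefZ coefXM coefCM.
  by case: k => [|k] /=; rewrite ?mulr0.
transitivity (\sum_(k < n.+2) (-1) ^+ (n.+1 - k) * (P`_k *
     (if k : nat is j.+1 then y * Q`_j else 0) / 'C(n.+1, k)%:R) * x ^+ k +
   \sum_(k < n.+2) - ((-1) ^+ (n.+1 - k) * (P`_k *
     (z * Q`_k) / 'C(n.+1, k)%:R) * x ^+ k)).
  rewrite -big_split /=; apply: eq_bigr => k _; rewrite cf.
  by case: (nat_of_ord k) => [|j] /=; ring.
rewrite big_ord_recl /= mulr0 mul0r mulr0 mul0r add0r.
rewrite [X in _ + X]big_ord_recr /=.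
rewrite (nth_default 0 sQ) !(mulr0, mul0r) oppr0 addr0 -big_split /=.
apply: eq_bigr => k _; rewrite /bump /= add1n subSS.
have kn : (k <= n)%N by rewrite -ltnS.
rewrite /polar coefZ coefD !coefZ coefB coefMn coefXM !coef_deriv subSn// !exprS.
have b1 : 'C(n.+1, k.+1)%:R = n.+1%:R / k.+1%:R * 'C(n, k)%:R :> F.
  apply: (mulfI (_ : k.+1%:R != 0 :> F)); first by rewrite pnatr_eq0.
  by rewrite -natrM -mul_bin_diag /= mulrA mulrCA divff ?pnatr_eq0// mulr1 natrM.
have nk : (n.+1%:R - k%:R : F) = (n.+1 - k)%:R by rewrite natrB// ltnW.
have nk0 : (n.+1%:R - k%:R : F) != 0 by rewrite nk pnatr_eq0 subn_eq0 -ltnNge ltnS.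
have b2 : 'C(n.+1, k)%:R = n.+1%:R / (n.+1%:R - k%:R) * 'C(n, k)%:R :> F.
  apply: (mulfI nk0).
  by rewrite [in LHS]nk -natrM -mul_bin_down /= mulrA mulrCA divff// mulr1 natrM.
set jk := (X in y * Q`_X); have -> : jk = k by [].
rewrite b1 b2.
have c0 : 'C(n, k)%:R != 0 :> F by rewrite pnatr_eq0 -lt0n bin_gt0.
have n0 : n.+1%:R != 0 :> F by rewrite pnatr_eq0.
have k0 : k.+1%:R != 0 :> F by rewrite pnatr_eq0.
have e : (if k == 0%N :> nat then 0 else P`_k.-1.+1 *+ k.-1.+1) = P`_k *+ k.
  by case: (nat_of_ord k) => [|j] //=; rewrite mulr0n.
rewrite e.
move: nk0 c0 n0 k0; rewrite -[P`_k *+ n.+1]mulr_natr -[P`_k *+ k]mulr_natr.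
rewrite -[P`_k.+1 *+ k.+1]mulr_natr.
move: (n.+1%:R : F) (k.+1%:R : F) (k%:R : F) ('C(n, k)%:R : F) => N K1 K B.
move: ((-1) ^+ (n - k)) (P`_k.+1) (P`_k) (Q`_k) (x ^+ k) => S p1 p0 q X.
move=> nk0 c0 n0 k0; field.
by rewrite c0 nk0 k0 n0.
Qed.

(** * The theorem of Laguerre for the upper half-plane *)

Definition upper_free (R : rcfType) (P : {poly R[i]}) : Prop :=
  forall x : R[i], 0 < complex.Im x -> P.[x] != 0.

Section Laguerre.
Context {R : rcfType}.
Implicit Types (P : {poly R[i]}) (x w : R[i]) (s : seq R[i]).
Local Notation Re := (@complex.Re R).
Local Notation Im := (@complex.Im R).

Lemma Im_neq0 x : 0 < Im x -> x != 0.
Proof. by apply: contraTneq => -> /=; rewrite ltxx. Qed.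

(** The form in which the hypothesis is used: P is a product over zeros in the closed
lower half-plane. *)
Lemma upper_free_factor P : upper_free P ->
  exists s : seq R[i], [/\ P = lead_coef P *: \prod_(w <- s) ('X - w%:P),
    {in s, forall w, Im w <= 0}, lead_coef P != 0 & (size P).-1 = size s].
Proof.
move=> Pf; case: (closed_field_poly_normal P) => s Ps.
have P0 : P != 0.
  apply/eqP => P0; have := Pf (Complex 0 1) ltr01.
  by rewrite P0 horner0 eqxx.
exists s; split => //; first last.
- by rewrite Ps size_scale ?lead_coef_eq0// size_prod_XsubC.
- by rewrite lead_coef_eq0.
move=> w ws; rewrite leNgt; apply/negP => /Pf/eqP; apply.
apply/eqP; rewrite -/(root P w) Ps rootZ ?lead_coef_eq0//.
by rewrite root_prod_XsubC.
Qed.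

Lemma deriv_prod_XsubC_horner s x : {in s, forall w, Im w <= 0} -> 0 < Im x ->
  (\prod_(w <- s) ('X - w%:P))^`().[x] =
  (\prod_(w <- s) ('X - w%:P)).[x] * \sum_(w <- s) (x - w)^-1.
Proof.
move=> + x0; elim: s => [|w s ih] sw.
  by rewrite !big_nil derivC horner0 mulr0.
have xw : x - w != 0.
  apply: Im_neq0; rewrite raddfB /=.
  by rewrite subr_gt0 (le_lt_trans _ x0)// sw ?mem_head.
rewrite !big_cons derivM derivXsubC mul1r hornerD !hornerM ih; last first.
  by move=> v vs; apply: sw; rewrite inE vs orbT.
rewrite hornerXsubC; set p := (\prod_(_ <- _) _).[x]; set t := \sum_(_ <- _) _.
by field.
Qed.

Lemma ImV x : Im x^-1 = - Im x / (Re x ^+ 2 + Im x ^+ 2).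
Proof. by case: x => a b /=; rewrite -mulNr. Qed.

Lemma ReV x : Re x^-1 = Re x / (Re x ^+ 2 + Im x ^+ 2).
Proof. by case: x => a b. Qed.

(** For Im x > 0, the map w |-> 1 / (x - w) sends the lower half-plane to the disc
Im x * |u|^2 + Im u <= 0, which is convex; the left-hand side equals
Im w / |x - w|^2. *)
Lemma disc_in x w : Im w <= 0 -> 0 < Im x ->
  Im x * (Re (x - w)^-1 ^+ 2 + Im (x - w)^-1 ^+ 2) + Im (x - w)^-1 <= 0.
Proof.
move=> w0 x0; rewrite !ImV !ReV.
have -> : Re (x - w) = Re x - Re w by rewrite raddfB.
have -> : Im (x - w) = Im x - Im w by rewrite raddfB.
set a := Re x - Re w; set b := Im x - Im w.
have b0 : 0 < b by rewrite subr_gt0 (le_lt_trans w0).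
have d0 : 0 < a ^+ 2 + b ^+ 2 by rewrite ltr_wpDl ?sqr_ge0// exprn_gt0.
have -> : Im x * ((a / (a ^+ 2 + b ^+ 2)) ^+ 2 +
    (- b / (a ^+ 2 + b ^+ 2)) ^+ 2) + - b / (a ^+ 2 + b ^+ 2) =
    Im w / (a ^+ 2 + b ^+ 2).
  have -> : Im w = Im x - b by rewrite /b; ring.
  by field; rewrite lt0r_neq0.
by rewrite pmulr_lle0 ?invr_gt0.
Qed.

(** The counterpart of [disc_in]: points of the upper half-plane are sent outside the
disc. *)
Lemma disc_out x xi : 0 < Im xi -> x != xi ->
  0 < Im x * (Re (x - xi)^-1 ^+ 2 + Im (x - xi)^-1 ^+ 2) + Im (x - xi)^-1.
Proof.
move=> w0 xxi; rewrite !ImV !ReV.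
have -> : Re (x - xi) = Re x - Re xi by rewrite raddfB.
have -> : Im (x - xi) = Im x - Im xi by rewrite raddfB.
set a := Re x - Re xi; set b := Im x - Im xi.
have d0 : 0 < a ^+ 2 + b ^+ 2.
  rewrite lt0r addr_ge0 ?sqr_ge0// andbT.
  apply: contraNneq xxi => /eqP; rewrite paddr_eq0 ?sqr_ge0// !sqrf_eq0.
  rewrite !subr_eq0 => /andP[/eqP e1 /eqP e2]; apply/eqP.
  by move: e1 e2; case: (x) (xi) => ? ? [? ?] /= -> ->.
have -> : Im x * ((a / (a ^+ 2 + b ^+ 2)) ^+ 2 +
    (- b / (a ^+ 2 + b ^+ 2)) ^+ 2) + - b / (a ^+ 2 + b ^+ 2) =
    Im xi / (a ^+ 2 + b ^+ 2).
  have -> : Im xi = Im x - b by rewrite /b; ring.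
  by field; rewrite lt0r_neq0.
by rewrite divr_gt0.
Qed.

(** Convexity of the disc for the sum t of the images of the zeros: the tangent
inequality Im x * |u - (p + i q)|^2 >= 0 is added up over the zeros. *)
Lemma disc_sum s x (p q : R) : {in s, forall w, Im w <= 0} -> 0 < Im x ->
  let t := \sum_(w <- s) (x - w)^-1 in
  Im x * (Re t * p + Im t * q) *+ 2 + Im t <=
  (Im x * (p ^+ 2 + q ^+ 2)) *+ size s.
Proof.
move=> + x0; elim: s => [|w s ih] sw /=.
  by rewrite big_nil /= !mul0r !addr0 mulr0 mul0rn mulr0n.
have {}ih := ih (fun v vs => sw v (mem_behead (vs : v \in behead (w :: s)))).
rewrite big_cons [in leRHS]mulrS; move: ih; set t := \sum_(_ <- _) _ => /= ih.
have := disc_in (sw _ (mem_head _ _)) x0; set u := _^-1 => hu.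
have -> : Re (u + t) = Re u + Re t by rewrite raddfD.
have -> : Im (u + t) = Im u + Im t by rewrite raddfD.
have : 0 <= Im x * ((Re u - p) ^+ 2 + (Im u - q) ^+ 2).
  by rewrite mulr_ge0 ?addr_ge0 ?sqr_ge0// ltW.
rewrite !mulr2n; move: hu ih; move: (_ *+ size s) => M.
move: (Re u) (Im u) (Re t) (Im t) => ru iu rt it; nra.
Qed.

(** The theorem of Laguerre for a pole xi in the open half-plane. A zero x would make
(n+1) / (x - xi) the sum of 1 / (x - w) over the zeros w of P, so that
1 / (x - xi) would be an average of points of the disc (0, the image of
infinity, counting for the missing zeros), although it lies outside. *)
Lemma upper_free_polar n P xi (x : R[i]) : upper_free P -> (size P <= n.+2)%N ->
  0 < Im xi -> 0 < Im x ->
  P.[x] *+ n.+1 + (xi - x) * P^`().[x] != 0.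
Proof.
move=> Pf sP xi0 x0; have Px := Pf x x0.
have [s [Ps sw l0 ss]] := upper_free_factor Pf.
have dP : P^`().[x] = P.[x] * \sum_(w <- s) (x - w)^-1.
  by rewrite Ps derivZ !hornerZ deriv_prod_XsubC_horner// mulrA.
have [->|xxi] := eqVneq x xi.
  by rewrite subrr mul0r addr0 mulrn_eq0 /= Pf.
rewrite dP; set t := \sum_(_ <- _) _.
apply/negP => /eqP e.
have nz : x - xi != 0 by rewrite subr_eq0.
have te : t = (x - xi)^-1 *+ n.+1.
  apply: (mulfI Px); apply: (mulfI nz).
  rewrite !mulrnAr [(x - xi) * (P.[x] * (x - xi)^-1)]mulrCA divff// mulr1.
  apply/eqP; rewrite -subr_eq0 -oppr_eq0; apply/eqP; rewrite -[RHS]e; ring.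
have sn : (size s <= n.+1)%N by rewrite -ss -ltnS; case: (size P) sP.
have := @disc_sum s x (Re (x - xi)^-1) (Im (x - xi)^-1) sw x0.
rewrite -/t te /=; have := disc_out xi0 xxi; set z := _^-1.
have -> : Re (z *+ n.+1) = Re z *+ n.+1 by rewrite raddfMn.
have -> : Im (z *+ n.+1) = Im z *+ n.+1 by rewrite raddfMn.
set A := Im x * (Re z ^+ 2 + Im z ^+ 2) => h1 h2.
have A0 : 0 <= A by rewrite mulr_ge0 ?addr_ge0 ?sqr_ge0// ltW.
have /(le_trans h2) : A *+ size s <= A *+ n.+1.
  by rewrite -(mulr_natr A) -(mulr_natr A n.+1) ler_wpM2l// ler_nat.
rewrite -(mulr_natr A) -(mulr_natr (Im z)) -(mulr_natr (Re z)).
have N0 : (0 : R) < n.+1%:R by rewrite ltr0n.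
have : 0 < n.+1%:R * (A + Im z) by rewrite mulr_gt0.
rewrite /A; set N := n.+1%:R; nra.
Qed.

(** The pole at infinity (Gauss-Lucas). At x in the half-plane, P'/P is the sum of the
1 / (x - w), all of negative imaginary part, so it only vanishes for constant P. *)
Lemma upper_free_deriv P : upper_free P -> P^`() = 0 \/ upper_free P^`().
Proof.
move=> Pf; have [s [Ps sw l0 ss]] := upper_free_factor Pf.
case: s Ps sw ss => [|w0 s] Ps sw ss.
  by left; rewrite Ps big_nil derivZ derivC scaler0.
right => x x0; have Px := Pf x x0.
rewrite Ps derivZ !hornerZ deriv_prod_XsubC_horner// mulrA -hornerZ -Ps.
rewrite mulf_neq0// -oppr_eq0; apply: Im_neq0.
have Im0 w : w \in (w0 :: s) -> 0 < - Im (x - w)^-1.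
  move=> /sw w1; rewrite ImV raddfB /= mulNr opprK.
  have b0 : 0 < Im x - Im w by rewrite subr_gt0 (le_lt_trans w1).
  by rewrite divr_gt0// ltr_wpDl ?sqr_ge0// exprn_gt0.
rewrite big_cons raddfN raddfD raddf_sum /= opprD -sumrN ltr_pwDl ?Im0 ?mem_head//.
by rewrite big_seq sumr_ge0// => w ws; rewrite ltW// Im0// inE ws orbT.
Qed.

(** The pole at 0. If x is in the half-plane then, up to the factor P(x) / x, the value
at x is (n + 1 - size s) x - sum_w x w / (x - w), where x w / (x - w) is the
inverse of 1/w - 1/x and has negative imaginary part unless w = 0; so it can
only vanish if all n + 1 zeros are 0. *)
Lemma upper_free_polar0 n P : upper_free P -> (size P <= n.+2)%N ->
  P *+ n.+1 - 'X * P^`() = 0 \/ upper_free (P *+ n.+1 - 'X * P^`()).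
Proof.
move=> Pf sP; have [s [Ps sw l0 ss]] := upper_free_factor Pf.
have sn : (size s <= n.+1)%N by rewrite -ss -ltnS; case: (size P) sP.
have [/andP[/eqP e /allP s0]|] := boolP ((size s == n.+1) && all (pred1 0) s).
  left; have -> : P = lead_coef P *: 'X^(n.+1).
    rewrite {1}Ps -e; congr (_ *: _).
    elim: (s) s0 => [|w t ih] s0; first by rewrite big_nil.
    rewrite big_cons ih => [|v vt]; last by apply: s0; rewrite inE vt orbT.
    by rewrite (eqP (s0 w (mem_head _ _))) subr0 exprS.
  rewrite derivZ derivXn -scalerAr mulrnAr /= -exprS scalerMnr.
  by rewrite subrr.
move=> nz; right => x x0; have Px := Pf x x0.
rewrite hornerD hornerN hornerMn hornerM hornerX.
have dP : P^`().[x] = P.[x] * \sum_(w <- s) (x - w)^-1.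
  by rewrite Ps derivZ !hornerZ deriv_prod_XsubC_horner// mulrA.
have xn0 : x != 0 by exact: Im_neq0.
have xw w : w \in s -> x - w != 0.
  move=> /sw w0; apply: Im_neq0; rewrite raddfB /=.
  by rewrite subr_gt0 (le_lt_trans _ x0).
suff : 0 < Im (x *+ (n.+1 - size s) - \sum_(w <- s) x * w / (x - w)).
  move=> /Im_neq0; apply: contra_neq => e.
  suff -> : \sum_(w <- s) x * w / (x - w) =
      x * (x * (\sum_(w <- s) (x - w)^-1) - (size s)%:R).
    apply: (mulfI Px); rewrite mulr0.
    transitivity (x * (P.[x] *+ n.+1 - x * P^`().[x])); last by rewrite e mulr0.
    rewrite dP -(mulr_natr x) natrB// -(mulr_natr P.[x]).
    by move: (\sum_(_ <- _) _) => t; ring.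
  elim: (s) xw => [|w t ih] tw; first by rewrite !big_nil mulr0 subrr mulr0.
  rewrite !big_cons ih => [|v vt]; last by apply: tw; rewrite inE vt orbT.
  have := tw w (mem_head _ _); rewrite /= -natr1.
  by move: (\sum_(_ <- _) _) => u h; field.
have Imt w : Im w <= 0 -> w != 0 -> 0 < - Im (x * w / (x - w)).
  move=> w0 wn0; have xw0 : x - w != 0.
    apply: Im_neq0; rewrite raddfB /= subr_gt0 (le_lt_trans _ x0)//.
  have -> : x * w / (x - w) = (w^-1 - x^-1)^-1.
    have e : w^-1 - x^-1 = (x - w) / (x * w) by field; rewrite xn0 wn0.
    by rewrite e invf_div.
  rewrite ImV mulNr opprK raddfB /= !ImV.
  have d (z : R[i]) : z != 0 -> 0 < Re z ^+ 2 + Im z ^+ 2.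
    move=> z0; rewrite lt0r addr_ge0 ?sqr_ge0// andbT.
    apply: contraNneq z0 => /eqP; rewrite paddr_eq0 ?sqr_ge0// !sqrf_eq0.
    by case: z => a b /= /andP[/eqP -> /eqP ->].
  have i0 : 0 < - Im w / (Re w ^+ 2 + Im w ^+ 2) -
      - Im x / (Re x ^+ 2 + Im x ^+ 2).
    rewrite mulNr [- _ / _]mulNr opprK ltr_wpDl ?divr_gt0 ?d//.
    by rewrite -mulNr divr_ge0 ?oppr_ge0// ltW ?d.
  by rewrite divr_gt0// ltr_wpDl ?sqr_ge0// exprn_gt0.
rewrite raddfB raddfMn raddf_sum /= -sumrN.
have Imge w : w \in s -> 0 <= - Im (x * w / (x - w)).
  move=> /sw w0; have [->|wn0] := eqVneq w 0; last by rewrite ltW// Imt.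
  by rewrite mulr0 mul0r /= oppr0.
have S0 : 0 <= \sum_(w <- s) - Im (x * w / (x - w)).
  by rewrite big_seq sumr_ge0.
have [e|ne] := eqVneq (size s) n.+1; last first.
  by rewrite ltr_wpDr// pmulrn_rgt0// subn_gt0 ltn_neqAle ne.
move: nz; rewrite e eqxx /= => /allPn[w ws /= w0].
rewrite subnn mulr0n add0r (big_rem w)//= ltr_pwDl ?Imt ?sw//.
by rewrite big_seq sumr_ge0// => v /mem_rem; exact: Imge.
Qed.
End Laguerre.

(** * The Schur-Szego theorem *)

Section Szego.
Context {R : rcfType}.
Implicit Types (P Q : {poly R[i]}) (x : R[i]) (s : seq R).
Local Notation Im := (@complex.Im R).
Local Notation "a %:C" := (real_complex R a).

Lemma size_polar n (y z : R[i]) P : (size P <= n.+2)%N ->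
  (size (polar n.+1 y z P) <= n.+1)%N.
Proof.
move=> sP; apply/leq_sizeP => j nj; rewrite /polar coefZ coefD !coefZ coefB coefMn.
rewrite coefXM coef_deriv; case: j nj => // j nj.
have [e|] := eqVneq j n; last first.
  move=> jn; have nj1 : (n.+2 <= j.+1)%N.
    by rewrite ltnS ltn_neqAle eq_sym jn -ltnS.
  have Pj : P`_j.+1 = 0 by apply: (leq_sizeP _ _ sP).
  have Pj1 : P`_j.+2 = 0 by apply: (leq_sizeP _ _ sP); apply: leqW.
  by rewrite /= coef_deriv Pj Pj1 !mul0rn subrr !mulr0 addr0 mulr0.
rewrite /= coef_deriv e subrr mulr0 addr0.
by rewrite (leq_sizeP _ _ sP n.+2)// mul0rn !mulr0.
Qed.

Lemma horner_polar n (y z x : R[i]) P : (polar n y z P).[x] =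
  n%:R^-1 * (y * P^`().[x] + z * (P.[x] *+ n - x * P^`().[x])).
Proof. by rewrite !(hornerE, hornerMn). Qed.

Lemma schur_szego0 n Q : schur_szego n 0 Q = 0 :> {poly R[i]}.
Proof.
by apply/polyP => k; rewrite coef_poly !coef0 !mul0r mulr0; case: ifP.
Qed.

Lemma schur_szegoZ n (c : R[i]) P Q :
  schur_szego n (c *: P) Q = c *: schur_szego n P Q.
Proof.
apply/polyP => k; rewrite coefZ !coef_poly coefZ; case: ifP => _; rewrite ?mulr0//.
by rewrite -!mulrA mulrCA.
Qed.

Definition cofactor_poly s : {poly R[i]} := \prod_(a <- s) ('X - (a%:C)%:P).

(** If all zeros of Q are positive, all poles x / a lie in the open half-plane together
with x, and no polar derivative on the way can vanish. *)
Lemma schur_szego_interior s P x : {in s, forall a, 0 < a} -> upper_free P ->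
  (size P <= (size s).+1)%N -> 0 < Im x ->
  (schur_szego (size s) P (cofactor_poly s)).[x] != 0.
Proof.
rewrite /cofactor_poly.
elim: s P => [|a s ih] P s0 Pf sP x0.
  rewrite horner_schur_szego big_ord_recl big_ord0 /= big_nil coef1 expr0 !mul1r.
  rewrite bin0 divr1 addr0 !mulr1.
  have := Pf x x0.
  by rewrite [P in P.[_]](size1_polyC sP) hornerC.
rewrite big_cons /= -[X in (X - _) * _]scale1r schur_szego_polar; last first.
  by rewrite size_prod_XsubC.
rewrite mul1r; have a0 : 0 < a by exact: s0 (mem_head _ _).
apply: ih => //.
- by move=> b bs; apply: s0; rewrite inE bs orbT.
- move=> u u0; rewrite horner_polar mulf_neq0 ?invr_eq0 ?pnatr_eq0//.
  have aC0 : a%:C != 0 :> R[i] by rewrite fmorph_eq0 gt_eqF.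
  have xi0 : 0 < Im (x / a%:C).
    by rewrite -fmorphV; case: (x) x0 => p q /= q0; rewrite mulr0 add0r mulr_gt0 ?invr_gt0.
  have := upper_free_polar Pf sP xi0 u0; apply: contra_neq => e.
  apply: (mulfI aC0); rewrite mulr0 -[RHS]e.
  rewrite -(mulr_natr P.[u]); move: (P.[u]) (P^`().[u]) ((size s).+1%:R : R[i]) => p q N.
  by field.
- exact: size_polar.
Qed.

(** Zeros of Q at 0 and missing zeros (at infinity) give poles on the boundary of the
half-plane. These polar derivatives do not depend on x up to a scalar, hence
they are taken first, and the vanishing of one of them is the vanishing of
the whole convolution. *)
Lemma schur_szego_upper n s P : (size s <= n)%N -> {in s, forall a, 0 <= a} ->
  upper_free P -> (size P <= n.+1)%N ->
  (forall x, (schur_szego n P (cofactor_poly s)).[x] = 0) \/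
  upper_free (schur_szego n P (cofactor_poly s)).
Proof.
elim: n s P => [|n ih] s P sn s0 Pf sP.
  right=> x x0; case: s sn s0 => // _ _.
  exact: (@schur_szego_interior [::]).
have [sn1|] := ltnP (size s) n.+1.
  (* a missing zero: the factor 1 is 0 * X - (-1) *)
  have E x : (schur_szego n.+1 P (cofactor_poly s)).[x] =
    (schur_szego n (polar n.+1 0 (-1) P) (cofactor_poly s)).[x].
    have := @schur_szego_polar _ n 0 (-1) x P (cofactor_poly s).
    rewrite size_prod_XsubC mul0r => /(_ sn1) <-.
    by rewrite scale0r sub0r polyCN opprK mul1r.
  have [P0|PF] := upper_free_polar0 Pf sP.
    left=> x; rewrite E /polar P0 scale0r add0r scaler0 scaler0.
    by rewrite schur_szego0 horner0.
  have [|Z|NZ] := ih s (polar n.+1 0 (-1) P) sn1 s0 _ (size_polar _ _ sP).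
  - move=> x x0; rewrite /polar scale0r add0r scaleN1r hornerZ hornerN.
    by rewrite mulf_neq0 ?oppr_eq0 ?PF// invr_eq0 pnatr_eq0.
  - by left=> x; rewrite E.
  - by right=> x x0; rewrite E NZ.
move=> sn'; have {sn sn'} sn : size s = n.+1 by apply/eqP; rewrite eqn_leq sn.
have [z0|nz] := boolP (0 \in s); last first.
  right=> x x0; rewrite -sn; apply: schur_szego_interior => //; last by rewrite sn.
  move=> a as_; rewrite lt_neqAle s0// andbT.
  by apply: contraNneq nz => ->.
have E x : (schur_szego n.+1 P (cofactor_poly s)).[x] =
    x * n.+1%:R^-1 * (schur_szego n P^`() (cofactor_poly (rem 0 s))).[x].
  have -> : cofactor_poly s = (1 *: 'X - 0%:P) * cofactor_poly (rem 0 s).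
    by rewrite /cofactor_poly (big_rem _ z0) /= scale1r.
  rewrite schur_szego_polar; last first.
    by rewrite size_prod_XsubC size_rem// sn.
  rewrite /polar scale0r addr0 mul1r !schur_szegoZ !hornerZ.
  by rewrite mulrCA mulrA.
have [P0|PF] := upper_free_deriv Pf.
  by left=> x; rewrite E P0 schur_szego0 horner0 mulr0.
have [||||Z|NZ] := ih (rem 0 s) P^`().
- by rewrite size_rem// sn.
- by move=> a /mem_rem; exact: s0.
- exact: PF.
- by apply: leq_trans (size_poly _ _) _; case: (size P) sP.
- by left=> x; rewrite E Z mulr0.
- right=> x x0; rewrite E !mulf_neq0 ?NZ ?invr_eq0 ?pnatr_eq0//; exact: Im_neq0.
Qed.

End Szego.

(** * Log-concave coefficients: the mean lies near the mode *)

Section PosPoly.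
Context {F : realFieldType}.
Implicit Types (s : seq F) (t c x : F).

Definition pos_poly s : {poly F} := \prod_(a <- s) ('X + a%:P).

(** For P = [pos_poly s] this is t P'(t) / P(t), that is, the mean of the probability
weights p_k t^k / P(t) on the exponents k. *)
Definition pole_sum s t : F := \sum_(a <- s) t / (t + a).

(** For nonnegative sequences this form, with i <= j arbitrary, also excludes internal
zeros. *)
Definition log_concave (p : nat -> F) : Prop :=
  forall i j, (i <= j)%N -> p i * p j.+1 <= p i.+1 * p j.

Lemma coef_pos_poly_cons a s k :
  (pos_poly (a :: s))`_k =
  (if k is j.+1 then (pos_poly s)`_j else 0) + a * (pos_poly s)`_k.
Proof.
rewrite /pos_poly big_cons mulrDl coefD coefXM coefCM.
by case: k.
Qed.

Lemma coef_prod_XsubC_sign s k :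
  (\prod_(a <- s) ('X - a%:P))`_k = (-1) ^+ (size s + k) * (pos_poly s)`_k.
Proof.
elim: s k => [|a s ih] k.
  rewrite /pos_poly !big_nil !coef1 /=.
  by case: k => [|k] /=; rewrite ?expr0 ?mulr1 ?mulr0.
rewrite coef_pos_poly_cons big_cons mulrBl coefB coefXM coefCM ih.
by case: k => [|k]; rewrite ?ih ?addn0 ?addnS ?addSn ?exprS /=; ring.
Qed.

Lemma coef_pos_poly_ge0 s k : {in s, forall a, 0 <= a} -> 0 <= (pos_poly s)`_k.
Proof.
elim: s k => [|a s ih] k s0; first by rewrite /pos_poly big_nil coef1 ler0n.
have {}ih j : 0 <= (pos_poly s)`_j.
  by apply: ih => b bs; apply: s0; rewrite inE bs orbT.
rewrite coef_pos_poly_cons; apply: addr_ge0; last first.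
  exact: mulr_ge0 (s0 _ (mem_head _ _)) (ih _).
by case: k => [|j] //=; rewrite ih.
Qed.

(** Multiplication by X + a preserves log-concavity; this is the induction step over
the zeros. *)
Lemma log_concave_shift (p : nat -> F) a : (forall k, 0 <= p k) ->
  log_concave p -> 0 <= a ->
  log_concave (fun k => (if k is j.+1 then p j else 0) + a * p k).
Proof.
move=> p0 lc a0 i j ij; have h1 := lc _ _ ij.
have aa : 0 <= a * a by rewrite mulr_ge0.
case: i ij h1 => [|i] ij h1.
  case: j ij h1 => [|j] ij h1; first by rewrite mulrC.
  have := mulr_ge0 (p0 0%N) (p0 j).
  have := mulr_ge0 a0 (mulr_ge0 (p0 1%N) (p0 j)); have := ler_wpM2l aa h1.
  by move: (p 0%N) (p 1%N) (p j) (p j.+1) (p j.+2) => *; nra.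
case: j ij h1 => // j ij h1.
have h2 := lc i j ij; have h3 := ler_wpM2l aa h1.
have h4 : a * (p i * p j.+2) <= a * (p i.+2 * p j).
  apply: ler_wpM2l => //; have [->|ne] := eqVneq i j; first by rewrite mulrC.
  apply: (@le_trans _ _ (p i.+1 * p j.+1)); first by rewrite lc// leqW.
  by rewrite lc// ltn_neqAle ne.
move: (p i) (p i.+1) (p i.+2) (p j) (p j.+1) (p j.+2) h2 h3 h4 => *; nra.
Qed.

Lemma log_concave_pos_poly s : {in s, forall a, 0 <= a} ->
  log_concave (fun k => (pos_poly s)`_k).
Proof.
elim: s => [|a s ih] s0 i j ij.
  by rewrite /pos_poly big_nil !coef1 /= mulr0 mulr_ge0// ?ler0n.
have s0' : {in s, forall b, 0 <= b}.
  by move=> b bs; apply: s0; rewrite inE bs orbT.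
rewrite !coef_pos_poly_cons; apply: log_concave_shift ij => //.
- by move=> k; exact: coef_pos_poly_ge0.
- exact: ih.
- exact: s0 (mem_head _ _).
Qed.

Lemma horner_pos_poly_gt0 s t : {in s, forall a, 0 <= a} -> 0 < t ->
  0 < (pos_poly s).[t].
Proof.
move=> s0 t0; rewrite /pos_poly horner_prod big_seq prodr_gt0// => a /s0 a0.
by rewrite !hornerE ltr_pwDl.
Qed.

Lemma deriv_pos_poly s t : {in s, forall a, 0 <= a} -> 0 < t ->
  t * (pos_poly s)^`().[t] = pole_sum s t * (pos_poly s).[t].
Proof.
move=> + t0; rewrite /pos_poly /pole_sum; elim: s => [|a s ih] s0.
  by rewrite !big_nil derivC horner0 mulr0 mul0r.
have {}ih := ih (fun b bs => s0 b (mem_behead (bs : b \in behead (a :: s)))).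
rewrite !big_cons derivM derivD derivX derivC addr0 mul1r hornerD !hornerM.
rewrite hornerD hornerX hornerC mulrDr mulrCA ih.
have ta : t + a != 0 by rewrite gt_eqF// ltr_pwDl// s0 ?mem_head.
by move: (\sum_(_ <- _) _) (_.[t]) => A B; field.
Qed.

(** Centering the mean at k turns bounds on it into termwise bounds. *)
Lemma weighted_sum s t n : (size (pos_poly s) <= n)%N ->
  {in s, forall a, 0 <= a} -> 0 < t -> forall k : F,
  (k - pole_sum s t) * (pos_poly s).[t] =
  \sum_(j < n) (k - j%:R) * ((pos_poly s)`_j * t ^+ j).
Proof.
move=> sn s0 t0 k; rewrite mulrBl -deriv_pos_poly//.
under eq_bigr do rewrite mulrBl.
rewrite sumrB -mulr_sumr -horner_coef_wide//; congr (_ - _).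
case: n sn => [|n] sn.
  move: sn; rewrite leqn0 size_poly_eq0 => /eqP ->.
  by rewrite deriv0 horner0 mulr0 big_ord0.
rewrite (@horner_coef_wide _ n) => [|]; last first.
  by apply: leq_trans (size_poly _ _) _; case: (size _) sn.
rewrite big_ord_recl mul0r add0r mulr_sumr; apply: eq_bigr => j _.
rewrite coef_deriv lift0 exprS -[(pos_poly s)`_j.+1 *+ _]mulr_natr.
by move: (j.+1%:R : F) (t ^+ j) (_`__) => *; ring.
Qed.

(** The difference of the two sides is the remainder of a telescoping sum. *)
Lemma arith_geo_sum x m : 0 <= x -> x < 1 ->
  \sum_(i < m) i%:R * x ^+ i <= x / (1 - x) ^+ 2.
Proof.
move=> x0 x1; have y0 : 0 < 1 - x by rewrite subr_gt0.
suff -> : \sum_(i < m) i%:R * x ^+ i =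
    x / (1 - x) ^+ 2 - (m%:R / (1 - x) + x / (1 - x) ^+ 2) * x ^+ m.
  by rewrite gerBl mulr_ge0 ?exprn_ge0// addr_ge0 ?divr_ge0 ?sqr_ge0 ?(ltW y0).
elim: m => [|m ih]; first by rewrite big_ord0 mul0r add0r expr0 mulr1 subrr.
rewrite big_ord_recr /= ih (exprS x m) -[m.+1%:R]natr1.
move: (m%:R : F) (x ^+ m) => M X.
by field; rewrite gt_eqF.
Qed.

(** The sum of i * c^(-i) over i, which bounds the first moment of the geometric tail on
one side of the mode. *)
Definition tail_const c : F := c^-1 / (1 - c^-1) ^+ 2.

Section Mode.
Variables (s : seq F).
Hypothesis s0 : {in s, forall a, 0 <= a}.
Let p k := (pos_poly s)`_k.
Let p0 k : 0 <= p k. Proof. exact: coef_pos_poly_ge0. Qed.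
Let lc : log_concave p. Proof. exact: log_concave_pos_poly. Qed.

Let coef_le_horner k t : 0 < t -> p k * t ^+ k <= (pos_poly s).[t].
Proof.
move=> t0; rewrite (@horner_coef_wide _ (maxn (size (pos_poly s)) k.+1)) ?leq_maxl//.
have kn : (k < maxn (size (pos_poly s)) k.+1)%N by rewrite leq_maxr.
rewrite (bigD1 (Ordinal kn))//= lerDl sumr_ge0// => j _.
by rewrite mulr_ge0 ?p0// exprn_ge0// ltW.
Qed.

(** At parameter t the weights increase up to k, by log-concavity. At parameter c t
the weights below k therefore decay geometrically away from k, at rate 1/c,
and pull the mean below k by at most a constant. *)
Lemma pole_sum_ge_mode k t c : 0 < t -> 1 < c -> 0 < p k.+1 ->
  p k <= t * p k.+1 -> k%:R - tail_const c <= pole_sum s (c * t).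
Proof.
move=> t0 c1 pk1 pk; have c0 : 0 < c by rewrite (lt_trans ltr01).
have step j : (j <= k)%N -> p j <= t * p j.+1.
  move=> jk; rewrite -(ler_pM2r pk1); apply: (le_trans (lc jk)).
  by rewrite -[leRHS]mulrA [leRHS]mulrCA ler_wpM2l.
have mono i : (i <= k)%N -> p (k - i)%N * t ^+ (k - i) <= p k * t ^+ k.
  elim: i => [|i ih] ik; first by rewrite subn0.
  apply: le_trans (ih (ltnW ik)).
  have -> : (k - i = (k - i.+1).+1)%N by rewrite -subSn.
  rewrite exprS mulrA [p _ * t]mulrC ler_wpM2r ?exprn_ge0 ?(ltW t0)//.
  by rewrite step// leq_subr.
set u := c * t; have u0 : 0 < u by rewrite mulr_gt0.
have P0 := horner_pos_poly_gt0 s0 u0.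
set x := c^-1; have x0 : 0 <= x by rewrite invr_ge0 ltW.
have x1 : x < 1 by rewrite invf_lt1.
rewrite lerBlDr -lerBlDl -(ler_pM2r P0).
set n := maxn (size (pos_poly s)) k.+1.
rewrite (@weighted_sum _ _ n)// ?leq_maxl//.
apply: (@le_trans _ _ (\sum_(j < n | (j < k.+1)%N)
    (k - j)%:R * x ^+ (k - j) * (p k * u ^+ k))).
  rewrite [leRHS]big_mkcond; apply: ler_sum => j _; case: ifPn => jk.
    rewrite natrB// -mulrA ler_wpM2l ?subr_ge0 ?ler_nat//.
    have := mono _ (leq_subr j k); rewrite subKn// => m.
    have e : c ^+ j = x ^+ (k - j) * c ^+ k.
      rewrite -{2}(subnK (_ : (j <= k)%N))// exprD mulrA -exprMn mulVf ?gt_eqF//.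
      by rewrite expr1n mul1r.
    rewrite /u !exprMn -/(p _) mulrCA.
    have -> : x ^+ (k - j) * (p k * (c ^+ k * t ^+ k)) = c ^+ j * (p k * t ^+ k).
      by rewrite e; ring.
    by rewrite ler_wpM2l// exprn_ge0// ltW.
  rewrite mulr_le0_ge0 ?mulr_ge0 ?p0 ?exprn_ge0 ?(ltW u0)//.
  by rewrite subr_le0 ler_nat ltnW// ltnNge.
rewrite -mulr_suml; apply: ler_pM; rewrite ?mulr_ge0 ?p0 ?exprn_ge0 ?(ltW u0)//.
- by apply: sumr_ge0 => j _; rewrite mulr_ge0// exprn_ge0.
- rewrite -(big_ord_widen n (fun j => (k - j)%:R * x ^+ (k - j))) ?leq_maxr//.
  rewrite (reindex_inj rev_ord_inj) /=.
  rewrite (eq_bigr (fun j : 'I_k.+1 => j%:R * x ^+ j)) => [|j _].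
    exact: arith_geo_sum.
  by rewrite /= subSS subKn// -ltnS.
- exact: coef_le_horner.
Qed.

(** The mirror image of [pole_sum_ge_mode]: at t the weights decrease from k on. *)
Lemma pole_sum_le_mode k t c : 0 < t -> 1 < c -> 0 < p k ->
  t * p k.+1 <= p k -> pole_sum s (t / c) <= k%:R + tail_const c.
Proof.
move=> t0 c1 pk0 pk; have c0 : 0 < c by rewrite (lt_trans ltr01).
have step j : (k <= j)%N -> t * p j.+1 <= p j.
  move=> jk; rewrite -(ler_pM2l pk0); rewrite mulrCA.
  apply: (@le_trans _ _ (t * (p k.+1 * p j))); first by rewrite ler_wpM2l ?lc// ltW.
  by rewrite mulrA ler_wpM2r.
have mono i : p (k + i)%N * t ^+ (k + i) <= p k * t ^+ k.
  elim: i => [|i ih]; first by rewrite addn0.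
  apply: le_trans ih; rewrite addnS exprS mulrA [p _ * t]mulrC.
  by rewrite ler_wpM2r ?exprn_ge0 ?(ltW t0)// step// leq_addr.
set u := t / c; have u0 : 0 < u by rewrite divr_gt0.
have P0 := horner_pos_poly_gt0 s0 u0.
set x := c^-1; have x0 : 0 <= x by rewrite invr_ge0 ltW.
have x1 : x < 1 by rewrite invf_lt1.
rewrite -lerBlDl -(ler_pM2r P0) -opprB mulNr.
set n := maxn (size (pos_poly s)) k.+1.
rewrite (@weighted_sum _ _ n)// ?leq_maxl// -sumrN.
apply: (@le_trans _ _ (\sum_(j < n | (k <= j)%N)
    (j - k)%:R * x ^+ (j - k) * (p k * u ^+ k))).
  rewrite [leRHS]big_mkcond; apply: ler_sum => j _; case: ifPn => jk.
    rewrite natrB// -mulrA -mulNr opprB ler_wpM2l ?subr_ge0 ?ler_nat//.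
    have := mono (j - k)%N; rewrite subnKC// => m.
    rewrite /u !exprMn -/(p _) -/x.
    have -> : p j * (t ^+ j * x ^+ j) = x ^+ j * (p j * t ^+ j) by ring.
    have -> : x ^+ (j - k) * (p k * (t ^+ k * x ^+ k)) = x ^+ j * (p k * t ^+ k).
      by rewrite -[in RHS](subnK jk) exprD; ring.
    by rewrite ler_wpM2l// exprn_ge0.
  rewrite oppr_le0 mulr_ge0 ?mulr_ge0 ?p0 ?exprn_ge0 ?(ltW u0)//.
  by rewrite subr_ge0 ler_nat ltnW// ltnNge.
rewrite -mulr_suml; apply: ler_pM; rewrite ?mulr_ge0 ?p0 ?exprn_ge0 ?(ltW u0)//.
- by apply: sumr_ge0 => j _; rewrite mulr_ge0// exprn_ge0.
- rewrite -(@big_geq_mkord _ _ _ k n xpredT (fun j => (j - k)%:R * x ^+ (j - k))).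
  rewrite -[X in \sum_(X <= _ < _) _]add0n big_addn big_mkord.
  under eq_bigr do rewrite addnK.
  exact: arith_geo_sum.
- exact: coef_le_horner.
Qed.

(** The support of a log-concave sequence is an interval, and k is not in it; all the
weight then lies on one side of k. *)
Lemma coef_eq0_pole_sum k : p k = 0 ->
  (forall t, 0 < t -> pole_sum s t <= k%:R) \/
  (forall t, 0 < t -> k%:R <= pole_sum s t).
Proof.
move=> pk; set n := size (pos_poly s).
have [/existsP[i /= pi]|/existsPn/= pl] := boolP [exists i : 'I_k, 0 < p i].
  have pj j : (k <= j)%N -> p j = 0.
    move=> /subnKC <-; elim: (j - k)%N => [|m ih]; first by rewrite addn0.
    apply/eqP; rewrite eq_le p0 andbT addnS.
    have := lc (leq_trans (ltnW (ltn_ord i)) (leq_addr m k)).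
    by rewrite ih mulr0 pmulr_rle0.
  left=> t t0; have P0 := horner_pos_poly_gt0 s0 t0.
  rewrite -subr_ge0 -(pmulr_lge0 _ P0) (@weighted_sum _ _ n)//.
  apply: sumr_ge0 => j _; have [kj|jk] := leqP k j.
    by rewrite -/(p _) pj// mul0r mulr0.
  by rewrite mulr_ge0 ?subr_ge0 ?ler_nat ?(ltnW jk)// mulr_ge0 ?p0// exprn_ge0// ltW.
right=> t t0; have P0 := horner_pos_poly_gt0 s0 t0.
rewrite -subr_le0 -(pmulr_lle0 _ P0) (@weighted_sum _ _ n)//.
apply: sumr_le0 => j _; have [kj|jk] := leqP k j.
  by rewrite mulr_le0_ge0 ?subr_le0 ?ler_nat// mulr_ge0 ?p0// exprn_ge0// ltW.
have := pl (Ordinal jk); rewrite /= -leNgt => pj.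
by rewrite -/(p _) (_ : p j = 0) ?mul0r ?mulr0//; apply/eqP; rewrite eq_le pj p0.
Qed.

End Mode.
End PosPoly.

(** * Real polynomials with nonnegative zeros *)

Section RealZeros.
Context {R : realType}.
Implicit Types (Q P : {poly R}).
Local Notation Re := (@complex.Re R).
Local Notation Im := (@complex.Im R).
Local Notation toC := (map_poly (real_complex R)).

Definition real_zeros Q : seq R := [seq Re z | z <- complex_zeros Q].

Lemma complex_ge0 (z : R[i]) : 0 <= z -> z = real_complex R (Re z) /\ 0 <= Re z.
Proof. by case: z => a b; rewrite lecE /= => /andP[/eqP -> ->]. Qed.

Lemma nonneg_rooted_factor Q : Q != 0 -> nonneg_rooted Q ->
  [/\ Q = lead_coef Q *: \prod_(a <- real_zeros Q) ('X - a%:P),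
      {in real_zeros Q, forall a, 0 <= a} & size (real_zeros Q) = (size Q).-1].
Proof.
move=> Q0 nQ; have lQ : lead_coef Q != 0 by rewrite lead_coef_eq0.
have := svalP (closed_field_poly_normal (toC Q)).
rewrite -/(complex_zeros Q) lead_coef_map => e.
have cge0 z : z \in complex_zeros Q -> 0 <= z.
  move=> zQ; apply: nQ; rewrite e rootZ ?fmorph_eq0//.
  by rewrite root_prod_XsubC.
have e2 : Q = lead_coef Q *: \prod_(a <- real_zeros Q) ('X - a%:P).
  apply: (map_poly_inj (real_complex R)); rewrite [LHS]e map_polyZ rmorph_prod.
  rewrite big_map; congr (_ *: _); rewrite !big_seq; apply: eq_bigr => z zQ.
  rewrite rmorphB /= map_polyX map_polyC; congr (_ - _%:P).
  exact: (complex_ge0 (cge0 _ zQ)).1.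
split => //.
  by move=> _ /mapP[z zQ ->]; exact: (complex_ge0 (cge0 _ zQ)).2.
by rewrite [in RHS]e2 size_scale// size_prod_XsubC.
Qed.

Lemma coef_nonneg_rooted Q k : Q != 0 -> nonneg_rooted Q ->
  Q`_k = lead_coef Q * ((-1) ^+ ((size Q).-1 + k) * (pos_poly (real_zeros Q))`_k).
Proof.
move=> Q0 /(nonneg_rooted_factor Q0)[Qe _ s]; rewrite {1}Qe coefZ.
by rewrite coef_prod_XsubC_sign s.
Qed.

Lemma norm_coef_nonneg_rooted Q k : Q != 0 -> nonneg_rooted Q ->
  `|Q`_k| = `|lead_coef Q| * (pos_poly (real_zeros Q))`_k.
Proof.
move=> Q0 nQ; rewrite (coef_nonneg_rooted k Q0 nQ) !normrM normrX normrN1 expr1n mul1r.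
have [_ z0 _] := nonneg_rooted_factor Q0 nQ.
by congr (_ * _); rewrite ger0_norm// coef_pos_poly_ge0.
Qed.

Lemma upper_free_nonneg_rooted Q : nonneg_rooted Q -> upper_free (toC Q).
Proof.
move=> nQ x x0; apply/negP => /nQ/complex_ge0[xE _].
by move: x0; rewrite xE /= ltxx.
Qed.

(** All signs combine to a sign common to the polynomial times (-1)^k: evaluated at a
negative number, all terms have the same sign. *)
Lemma coef_finite_free_mul n P Q k : (k <= n)%N -> P != 0 -> Q != 0 ->
  nonneg_rooted P -> nonneg_rooted Q ->
  (finite_free_mul n P Q)`_k =
  lead_coef P * lead_coef Q * (-1) ^+ (n + (size P).-1 + (size Q).-1) * (-1) ^+ k *
  ((pos_poly (real_zeros P))`_k * (pos_poly (real_zeros Q))`_k / 'C(n, k)%:R).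
Proof.
move=> kn P0 Q0 nP nQ; rewrite coef_poly ltnS kn.
rewrite (coef_nonneg_rooted k P0 nP) (coef_nonneg_rooted k Q0 nQ).
have -> : (-1) ^+ (n - k) = (-1) ^+ n * (-1) ^+ k :> R.
  by rewrite -[X in _ ^+ X * _](subnK kn) exprD -mulrA -expr2 sqrr_sign mulr1.
rewrite !exprD; have s2 : (-1) ^+ k * (-1) ^+ k = 1 :> R.
  by rewrite -expr2 sqrr_sign.
set a := (-1) ^+ k; set b := _ ^+ n; set c := _ ^+ _.-1; set d := _ ^+ _.-1.
set u := _`_k; set v := _`_k; set B := _%:R.
transitivity (a * a * (lead_coef P * lead_coef Q * (b * c * d) * a * (u * v / B))).
  by ring.
by rewrite s2 mul1r.
Qed.

Lemma map_finite_free_mul n P Q :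
  toC (finite_free_mul n P Q) = schur_szego n (toC P) (toC Q).
Proof.
apply/polyP => k; rewrite coef_map [in LHS]coef_poly [in RHS]coef_poly !coef_map /=.
case: ifP => _; last exact: rmorph0.
by rewrite rmorphM rmorphXn rmorphN1 rmorphM rmorphM fmorphV rmorph_nat.
Qed.

Lemma schur_szegoZr n c (P Q : {poly R[i]}) :
  schur_szego n P (c *: Q) = c *: schur_szego n P Q.
Proof.
apply/polyP => k; rewrite coefZ !coef_poly coefZ; case: ifP => _; rewrite ?mulr0//.
by ring.
Qed.

(** There is no zero in the upper half-plane by [schur_szego_upper], none in the lower
one by conjugation, and none on the negative axis because there all terms
have the same sign. *)
Theorem nonneg_rooted_finite_free_mul n P Q : P != 0 -> Q != 0 ->
  nonneg_rooted P -> nonneg_rooted Q -> (size P <= n.+1)%N -> (size Q <= n.+1)%N ->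
  finite_free_mul n P Q != 0 -> nonneg_rooted (finite_free_mul n P Q).
Proof.
move=> P0 Q0 nP nQ sP sQ S0.
have uS : upper_free (toC (finite_free_mul n P Q)).
  have lQ : lead_coef Q != 0 by rewrite lead_coef_eq0.
  have [Qe Qp sz] := nonneg_rooted_factor Q0 nQ.
  have E : toC (finite_free_mul n P Q) = real_complex R (lead_coef Q) *:
      schur_szego n (toC P) (cofactor_poly (real_zeros Q)).
    rewrite map_finite_free_mul -schur_szegoZr; congr schur_szego.
    rewrite {1}Qe map_polyZ rmorph_prod; congr (_ *: _).
    by apply: eq_bigr => a _; rewrite rmorphB /= map_polyX map_polyC.
  have [||Z|NZ] := @schur_szego_upper _ n (real_zeros Q) (toC P) _ Qp
    (upper_free_nonneg_rooted nP).
  - by rewrite sz; case: (size Q) sQ.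
  - by rewrite size_map_poly.
  - have /closed_nonrootP[x] : toC (finite_free_mul n P Q) != 0.
      by rewrite map_poly_eq0.
    by rewrite /root E hornerZ Z mulr0 eqxx.
  - by move=> x x0; rewrite E hornerZ mulf_neq0 ?NZ// fmorph_eq0.
(* the zeros are real *)
move=> z rz.
have z1 : Im z <= 0 by rewrite leNgt; apply/negP => /uS; rewrite -/(root _ _) rz.
have z2 : 0 <= Im z.
  rewrite leNgt; apply/negP => z0.
  have : 0 < Im (conjc z) by case: (z) z0 => a b /=; rewrite oppr_gt0.
  move=> /uS; rewrite -/(root _ _) -complex_root_conj.
  rewrite -map_poly_comp (_ : _ \o _ = real_complex R) ?rz//.
  by apply/funext => a /=; rewrite oppr0.
have zE : z = real_complex R (Re z).
  by case: (z) z1 z2 => a b /= b1 b2; congr Complex; apply/eqP; rewrite eq_le b1.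
rewrite zE ler0c leNgt; apply/negP => r0.
move: rz; rewrite zE; set r := Re z in r0 *; rewrite fmorph_root.
move=> /eqP; set c := lead_coef P * lead_coef Q * (-1) ^+ (n + (size P).-1 + (size Q).-1).
have [_ zP _] := nonneg_rooted_factor P0 nP.
have [_ zQ _] := nonneg_rooted_factor Q0 nQ.
rewrite (@horner_coef_wide _ n.+1); last exact: size_poly.
under eq_bigr => k _.
  rewrite coef_finite_free_mul//; last by rewrite -ltnS.
  rewrite -/c -(mulrA c) -(mulrA c) (mulrC ((-1) ^+ k)) -(mulrA _ ((-1) ^+ k)).
  rewrite -exprMn mulN1r; over.
rewrite -mulr_sumr => /eqP; rewrite mulf_eq0 => /orP[/eqP c0|].
  have : lead_coef P * lead_coef Q == 0.
    by move: c0 => /eqP; rewrite mulf_eq0 signr_eq0 orbF.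
  by rewrite mulf_eq0 !lead_coef_eq0 (negbTE P0) (negbTE Q0).
rewrite psumr_eq0 => [/allP h|k _]; last first.
  rewrite mulr_ge0 ?divr_ge0 ?mulr_ge0 ?coef_pos_poly_ge0//.
  by rewrite exprn_ge0// oppr_ge0 ltW.
move/negP: S0; apply; apply/eqP/polyP => k; rewrite coef0.
have [kn|nk] := leqP k n; last by rewrite coef_poly ltnS leqNgt nk.
rewrite coef_finite_free_mul//.
have := h (Ordinal (kn : (k < n.+1)%N)) (mem_index_enum _).
by rewrite mulf_eq0 expf_eq0 oppr_eq0 (lt_eqF r0) andbF orbF => /eqP ->; rewrite mulr0.
Qed.

End RealZeros.

(** * The kernel t / (t + z) *)

Section Kernel.
Context {F : realFieldType}.
Implicit Types (t u c v m : F).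

(** The function t / (t + z) in the coordinate v = z / (1 + z), in which it is
continuous up to z = +oo, that is, v = 1. *)
Definition pole t v : F := t * (1 - v) / (t * (1 - v) + v).

Lemma pole_den_gt0 t v : 0 < t -> 0 <= v <= 1 -> 0 < t * (1 - v) + v.
Proof.
move=> t0 /andP[v0 v1]; have [->|vn1] := eqVneq v 1; first by rewrite subrr mulr0 add0r.
by rewrite ltr_pwDl// mulr_gt0// subr_gt0 lt_neqAle vn1.
Qed.

Lemma pole_itv t v : 0 < t -> 0 <= v <= 1 -> 0 <= pole t v <= 1.
Proof.
move=> t0 v01; have d := pole_den_gt0 t0 v01; case/andP: v01 => v0 v1.
have n0 : 0 <= t * (1 - v) by rewrite mulr_ge0 ?subr_ge0// ltW.
by rewrite divr_ge0 ?(ltW d)//= ler_pdivrMr// mul1r lerDl.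
Qed.

Lemma pole_contract t a : 0 < t -> 0 <= a -> pole t (a / (1 + a)) = t / (t + a).
Proof.
move=> t0 a0; have a1 : 1 + a != 0 by rewrite gt_eqF// ltr_pwDl.
have ta : t + a != 0 by rewrite gt_eqF// ltr_pwDl.
rewrite /pole; have -> : 1 - a / (1 + a) = (1 + a)^-1 by field.
by field; rewrite ta a1.
Qed.

Lemma pole_sub t u v : 0 < t -> 0 < u -> 0 <= v <= 1 ->
  pole u v - pole t v =
  (u - t) * (v * (1 - v)) / ((t * (1 - v) + v) * (u * (1 - v) + v)).
Proof.
move=> t0 u0 v01; have d := pole_den_gt0 t0 v01; have e := pole_den_gt0 u0 v01.
by rewrite /pole; field; rewrite (gt_eqF d) (gt_eqF e).
Qed.

Lemma le_pole t u v : 0 < t -> t <= u -> 0 <= v <= 1 -> pole t v <= pole u v.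
Proof.
move=> t0 tu v01; have u0 := lt_le_trans t0 tu.
rewrite -subr_ge0 pole_sub//.
have d := pole_den_gt0 t0 v01; have e := pole_den_gt0 u0 v01.
case/andP: v01 => v0 v1.
by rewrite divr_ge0 ?mulr_ge0 ?subr_ge0 ?(ltW d) ?(ltW e).
Qed.

(** A dilation of the parameter acts on the values of the kernel by a fixed Moebius
map, which is concave for c >= 1. *)
Lemma pole_scale t c v : 0 < t -> 0 < c -> 0 <= v <= 1 ->
  pole (c * t) v = c * pole t v / (1 + (c - 1) * pole t v).
Proof.
move=> t0 c0 v01; have d := pole_den_gt0 t0 v01.
have e := pole_den_gt0 (mulr_gt0 c0 t0) v01.
have E : 1 + (c - 1) * pole t v = (c * t * (1 - v) + v) / (t * (1 - v) + v).
  by rewrite /pole; field; rewrite gt_eqF.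
by rewrite E /pole; field; rewrite (gt_eqF d) (gt_eqF e).
Qed.

Lemma pole_scale_le t c v : 0 < t -> 1 <= c -> 0 <= v <= 1 ->
  pole (c * t) v <= c * pole t v.
Proof.
move=> t0 c1 v01; have c0 : 0 < c by rewrite (lt_le_trans ltr01).
have /andP[k0 _] := pole_itv t0 v01.
rewrite pole_scale// ler_pdivrMr; last by rewrite ltr_pwDl// mulr_ge0// subr_ge0.
apply: ler_peMr; first exact: mulr_ge0 (ltW c0) k0.
by rewrite lerDl mulr_ge0// subr_ge0.
Qed.

(** The tangent line at m of the concave function in [pole_scale]; integrated, it is
the Jensen inequality. *)
Lemma pole_scale_tangent t c v m : 0 < t -> 1 <= c -> 0 <= v <= 1 -> 0 <= m ->
  pole (c * t) v <=
  c * m / (1 + (c - 1) * m) + c / (1 + (c - 1) * m) ^+ 2 * (pole t v - m).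
Proof.
move=> t0 c1 v01 m0; have c0 : 0 < c by rewrite (lt_le_trans ltr01).
have /andP[k0 _] := pole_itv t0 v01.
rewrite pole_scale//; set k := pole t v in k0 *.
have b0 : 0 <= c - 1 by rewrite subr_ge0.
have d1 : 0 < 1 + (c - 1) * k by rewrite ltr_pwDl// mulr_ge0.
have d2 : 0 < 1 + (c - 1) * m by rewrite ltr_pwDl// mulr_ge0.
rewrite -subr_ge0.
have -> : c * m / (1 + (c - 1) * m) + c / (1 + (c - 1) * m) ^+ 2 * (k - m) -
   c * k / (1 + (c - 1) * k) =
   c * (c - 1) * (k - m) ^+ 2 / ((1 + (c - 1) * m) ^+ 2 * (1 + (c - 1) * k)).
  by field; rewrite (gt_eqF d1) (gt_eqF d2).
apply: divr_ge0; last exact: mulr_ge0 (sqr_ge0 _) (ltW d1).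
exact: mulr_ge0 (mulr_ge0 (ltW c0) b0) (sqr_ge0 _).
Qed.

(** All increments of the kernel in the parameter are comparable to v (1 - v), hence to
each other. So a transform that is constant between two points is constant. *)
Lemma pole_osc t u t1 t2 : 0 < t -> 0 < u -> 0 < t1 -> t1 < t2 ->
  exists2 C : F, 0 <= C & forall v, 0 <= v <= 1 ->
    pole u v - pole t v <= C * (pole t2 v - pole t1 v).
Proof.
move=> t0 u0 t10 t12; have t20 := lt_trans t10 t12.
(* the denominators lie between min 1 s and max 1 s *)
pose lo (s : F) : F := Num.min 1 s; pose hi (s : F) : F := Num.max 1 s.
have lo0 s : 0 < s -> 0 < lo s by move=> s0; rewrite lt_min ltr01.
have hi0 s : 0 < hi s by rewrite lt_max ltr01.
have loP s v : 0 < s -> 0 <= v <= 1 -> lo s <= s * (1 - v) + v.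
  move=> s0 /andP[v0 v1]; have : lo s <= 1 by rewrite ge_min lexx.
  have : lo s <= s by rewrite ge_min lexx orbT.
  nra.
have hiP s v : 0 < s -> 0 <= v <= 1 -> s * (1 - v) + v <= hi s.
  move=> s0 /andP[v0 v1]; have : 1 <= hi s by rewrite le_max lexx.
  have : s <= hi s by rewrite le_max lexx orbT.
  nra.
exists (`|u - t| / (lo t * lo u) * (hi t1 * hi t2) / (t2 - t1)).
  rewrite !mulr_ge0 ?invr_ge0 ?mulr_ge0 ?subr_ge0 ?(ltW t12)//; apply: ltW; rewrite ?lo0//.
move=> v v01; rewrite !pole_sub//; set w := v * (1 - v).
have w0 : 0 <= w by case/andP: v01 => *; rewrite mulr_ge0// subr_ge0.
have d0 := pole_den_gt0 t0 v01; have d1 := pole_den_gt0 u0 v01.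
have d2 := pole_den_gt0 t10 v01; have d3 := pole_den_gt0 t20 v01.
have D0 : 0 < (t * (1 - v) + v) * (u * (1 - v) + v) by rewrite mulr_gt0.
have D1 : 0 < (t1 * (1 - v) + v) * (t2 * (1 - v) + v) by rewrite mulr_gt0.
have L0 : 0 < lo t * lo u by rewrite mulr_gt0 ?lo0.
have LP : lo t * lo u <= (t * (1 - v) + v) * (u * (1 - v) + v).
  by rewrite ler_pM ?loP// ltW// lo0.
have HP : (t1 * (1 - v) + v) * (t2 * (1 - v) + v) <= hi t1 * hi t2.
  by rewrite ler_pM ?hiP ?(ltW d2) ?(ltW d3).
move: D0 D1 LP HP; set A := (_ * _) in L0 *; set D := (_ + v) * _.
set E := (_ + v) * _; set H := hi _ * _ => D0 D1 LP HP.
apply: (@le_trans _ _ (`|u - t| / A * w)).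
  rewrite [leRHS]mulrAC; apply: (@le_trans _ _ (`|u - t| * w / D)).
    by rewrite ler_wpM2r ?invr_ge0 ?(ltW D0)// ler_wpM2r// ler_norm.
  apply: ler_wpM2l; first by rewrite mulr_ge0 ?normr_ge0.
  by rewrite lef_pV2 ?posrE.
have -> : `|u - t| / A * H / (t2 - t1) * ((t2 - t1) * w / E) =
    `|u - t| / A * w * (H / E).
  by field; rewrite (gt_eqF L0) (gt_eqF D1) subr_eq0 (gt_eqF t12).
apply: ler_peMr; last by rewrite ler_pdivlMr// mul1r.
exact: mulr_ge0 (divr_ge0 (normr_ge0 _) (ltW L0)) w0.
Qed.

End Kernel.

(** * The half-line [0,+oo] as a copy of [0,1] *)

Section HalfLine.
Context {R : realType}.
Implicit Types (f g : \bar R -> R) (nu : probability (\bar R) R) (t u v : R).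

Definition half_line : set (\bar R) := `[0%E, +oo%E]%classic.
Local Notation D := half_line.

Lemma measurable_half_line : measurable D.
Proof. exact: emeasurable_itv. Qed.
Hint Resolve measurable_half_line : core.

Lemma contract_itv x : D x -> 0 <= contract x <= 1.
Proof.
rewrite /half_line/= in_itv/= leey andbT => x0; apply/andP; split.
  by rewrite -(@contract0 R) le_contract.
by have := contract_le1 x; rewrite ler_norml => /andP[].
Qed.

Lemma norm_le1_itv v : 0 <= v <= 1 -> `|v| <= 1.
Proof. by move=> /andP[v0 v1]; rewrite ger0_norm. Qed.

Lemma expand_half_line v : 0 <= v <= 1 -> D (expand v).
Proof.
move=> v01; rewrite /half_line/= in_itv/= leey andbT.
by rewrite -(@le_contract R) contract0 expandK ?inE ?norm_le1_itv//; case/andP: v01.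
Qed.

Lemma expand_contract_itv v : 0 <= v <= 1 -> contract (expand v) = v :> R.
Proof. by move=> v01; rewrite expandK ?inE ?norm_le1_itv. Qed.

Lemma expand_ratio a : 0 <= a -> expand (a / (1 + a)) = a%:E :> \bar R.
Proof.
by move=> a0; rewrite -[RHS]contractK /= ger0_norm.
Qed.

Lemma continuous_contract : continuous (@contract R).
Proof.
move=> x; apply/cvgrPdist_lt => e e0.
exact: (@nbhsx_ballx R (\bar R) x e e0).
Qed.

Lemma within_continuous_expand f :
  {within D, continuous f} -> {within `[0%R, 1%R], continuous (f \o @expand R)}.
Proof.
move=> /subspace_continuousP cf; apply/subspace_continuousP => v /= v01.
have v01' : 0 <= v <= 1 by move: v01; rewrite in_itv.
apply/cvgrPdist_lt => e e0.
have /cvgrPdist_lt/(_ e e0) := cf _ (expand_half_line v01').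
rewrite /within /= => /nbhs_ballP[d /= d0 H].
apply/nbhs_ballP; exists d => //= w vw /=; rewrite in_itv /= => w01.
apply: H; last exact: expand_half_line.
by rewrite /ball /= /ereal_ball !expand_contract_itv//.
Qed.

Lemma within_continuous_contract (g : R -> R) :
  {within `[0%R, 1%R], continuous g} -> {within D, continuous (g \o @contract R)}.
Proof.
move=> /subspace_continuousP cf; apply/subspace_continuousP => x xD.
have v01 := contract_itv xD.
have v01' : `[0, 1]%classic (contract x) by rewrite /= in_itv.
apply/cvgrPdist_lt => e e0.
have /cvgrPdist_lt/(_ e e0) := cf _ v01'.
rewrite /within /= => /nbhs_ballP[d /= d0 H].
apply/nbhs_ballP; exists d => //= y xy yD.
by apply: H; [exact: xy|rewrite in_itv/= contract_itv].
Qed.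

(** The two infinite points are measurable singletons, so only the restriction to the
finite points matters. *)
Lemma measurable_ereal_fun f : measurable_fun setT (f \o EFin) -> measurable_fun setT f.
Proof.
move=> mf _ B mB; rewrite setTI.
have -> : f @^-1` B = EFin @` ((f \o EFin) @^-1` B) `|`
    (([set +oo%E] `&` f @^-1` B) `|` ([set -oo%E] `&` f @^-1` B)).
  apply/seteqP; split => [[r| |] /= Bx|x /=].
  - by left; exists r.
  - by right; left.
  - by right; right.
  - by case=> [[r Br <-]//|[[]|[]]].
have m1 (x : \bar R) : measurable ([set x] `&` f @^-1` B).
  have [Bx|Bx] := pselect (B (f x)).
    rewrite (_ : _ `&` _ = [set x]); first exact: emeasurable_set1.
    by apply/seteqP; split => [y []//|y -> /=].
  rewrite (_ : _ `&` _ = set0)//.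
  by apply/seteqP; split => [y [-> ]//|].
apply: measurableU; last exact: measurableU.
apply: measurable_image_EFin; rewrite -[X in _ X]setTI; exact: mf.
Qed.

Lemma measurable_contract : measurable_fun setT (@contract R).
Proof.
apply: measurable_ereal_fun; apply: continuous_measurable_fun => r.
apply: (@cvg_comp _ _ _ EFin (@contract R)); last exact: continuous_contract.
by apply: cvg_EFin; [exact: nearW | exact: cvg_id].
Qed.

Lemma measurable_within f : {within D, continuous f} -> measurable_fun D f.
Proof.
move=> cf; apply: (eq_measurable_fun ((f \o @expand R) \o @contract R)).
  by move=> x _ /=; rewrite contractK.
apply: (@measurable_comp _ _ _ (\bar R) R R `[0%R, 1%R]%classic (f \o @expand R) D (@contract R)) => //.
- by move=> _ [x xD <-]; rewrite /= in_itv /= contract_itv.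
- apply: subspace_continuous_measurable_fun => //.
  exact: within_continuous_expand.
- exact: measurable_funTS measurable_contract.
Qed.

Lemma bounded_within (g : R -> R) : {within `[0%R, 1%R], continuous g} ->
  exists2 M, 0 <= M & forall v, 0 <= v <= 1 -> `|g v| <= M.
Proof.
move=> cg; have [c1 _ h1] := EVT_max ler01 cg.
have [c2 _ h2] := EVT_min ler01 cg.
exists (`|g c1| + `|g c2|) => [|v v01]; first by rewrite addr_ge0.
have v01' : v \in `[0, 1] by rewrite in_itv.
have := h1 _ v01'; have := h2 _ v01'.
have := ler_norm (g c1); have := ler_norm (- g c2); rewrite normrN.
have := normr_ge0 (g c1); have := normr_ge0 (g c2).
by rewrite ler_norml => *; apply/andP; split; lra.
Qed.

Lemma integrable_within (mu : {measure set (\bar R) -> \bar R}) f :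
  (mu D < +oo)%E -> {within D, continuous f} -> mu.-integrable D (EFin \o f).
Proof.
move=> muD cf; apply: measurable_bounded_integrable => //.
  exact: measurable_within.
have [M M0 hM] := bounded_within (within_continuous_expand cf).
exists M; split; first exact: num_real.
move=> x Mx y yD /=; rewrite (le_trans _ (ltW Mx))//.
by rewrite -(contractK y) hM// contract_itv.
Qed.

Lemma within_continuous_pole t : 0 < t -> {within `[0%R, 1%R], continuous (pole t)}.
Proof.
move=> t0; apply/subspace_continuousP => v /=; rewrite in_itv /= => v01.
have ci : (fun w : R => w) @ within `[0, 1]%classic (nbhs v) --> v.
  by apply: cvg_within_filter; exact: cvg_id.
have c1 : (fun w : R => (t * (1 - w))%R) @ within `[0, 1]%classic (nbhs v) -->
    (t * (1 - v))%R.
  by apply: cvgM; [exact: cvg_cst | apply: cvgB => //; exact: cvg_cst].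
apply: cvgM => //; apply: cvgV; last exact: cvgD.
by rewrite gt_eqF// pole_den_gt0.
Qed.

End HalfLine.

(** * The kernel transform of a probability measure *)

Section BoundedConvergence.
Context d (T : measurableType d) (R : realType).
Variables (mu : {measure set T -> \bar R}) (D : set T).
Hypotheses (mD : measurable D) (muD : (mu D < +oo)%E).

Lemma bounded_integrable (f : T -> R) (M : R) : measurable_fun D f ->
  (forall x, D x -> `|f x| <= M) -> mu.-integrable D (EFin \o f).
Proof.
move=> mf fM; apply: measurable_bounded_integrable => //.
by exists M; split; [exact: num_real | move=> x Mx y Dy /=; rewrite (le_trans _ (ltW Mx))// fM].
Qed.

Lemma bounded_convergence (f_ : nat -> T -> R) (f : T -> R) (M : R) :
  (forall n, measurable_fun D (f_ n)) -> measurable_fun D f ->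
  (forall n x, D x -> `|f_ n x| <= M) ->
  {ae mu, forall x, D x -> f_ ^~ x @ \oo --> f x} ->
  (fun n => \int[mu]_(x in D) f_ n x) @ \oo --> \int[mu]_(x in D) f x.
Proof.
move=> mf_ mf fM fc.
have [] := @dominated_convergence _ _ _ mu D mD (fun n x => (f_ n x)%:E)
  (fun x => (f x)%:E) (fun=> M%:E).
- by move=> n; apply/measurable_EFinP; exact: mf_.
- exact/measurable_EFinP.
- by apply: filterS fc => x /[apply] h; apply: cvg_EFin; [exact: nearW|exact: h].
- apply/integrableP; split; first exact: measurable_cst.
  under eq_integral do rewrite /=.
  by rewrite integral_cst// lte_mul_pinfty.
- by apply: aeW => x n Dx; rewrite lee_fin fM.
move=> intf _ h; apply: fine_cvg.
by rewrite fineK; [exact: h | exact: integrable_fin_num intf].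
Qed.

End BoundedConvergence.

Definition mass_zero (R : realType) (nu : probability (\bar R) R) : R :=
  fine (nu [set 0%E]).

Definition mass_infty (R : realType) (nu : probability (\bar R) R) : R :=
  fine (nu [set +oo%E]).

Section PoleTransform.
Context {R : realType}.
Variable nu : probability (\bar R) R.
Hypothesis nu1 : nu half_line = 1%E.
Implicit Types (t u c a : R).
Local Notation D := (@half_line R).

(** With nu {+oo} = 0, this is 1 + psi_nu(-1/t). *)
Definition pole_transform t : R := \int[nu]_(x in D) pole t (contract x).
Local Notation F := pole_transform.

Let mD : measurable D. Proof. exact: measurable_half_line. Qed.
Let nuD : (nu D < +oo)%E. Proof. by rewrite nu1 ltry. Qed.

Lemma integrable_pole t : 0 < t -> nu.-integrable D (EFin \o (fun x => pole t (contract x))).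
Proof.
move=> t0; apply: integrable_within => //.
exact: within_continuous_contract (within_continuous_pole t0).
Qed.

Let int_cst a : nu.-integrable D (EFin \o (fun=> a)).
Proof. by apply: (@bounded_integrable _ _ _ _ _ _ _ _ `|a|). Qed.

Let F_cst a : \int[nu]_(x in D) a = a.
Proof.
have e : fine (nu D) = 1 by rewrite nu1.
by rewrite Rintegral_cst//= [X in a * X]e mulr1.
Qed.

Let int_lin a b t : 0 < t ->
  nu.-integrable D (EFin \o (fun x => a + b * pole t (contract x))).
Proof.
move=> t0; have := integrable_pole t0 => /(integrableZl mD b) h.
by have := integrableD mD (int_cst a) h; apply: eq_integrable.
Qed.

Let F_lin a b t : 0 < t -> \int[nu]_(x in D) (a + b * pole t (contract x)) = a + b * F t.
Proof.
move=> t0; rewrite RintegralD//; last first.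
  by have := integrable_pole t0 => /(integrableZl mD b); apply: eq_integrable.
by rewrite F_cst RintegralZl// integrable_pole.
Qed.

Lemma le_pole_transform t u : 0 < t -> t <= u -> F t <= F u.
Proof.
move=> t0 tu; apply: le_Rintegral => //; try exact: integrable_pole.
  by apply: integrable_pole; exact: lt_le_trans tu.
by move=> x xD; rewrite le_pole// contract_itv.
Qed.

Lemma pole_transform_scale_le t c : 0 < t -> 1 <= c -> F (c * t) <= c * F t.
Proof.
move=> t0 c1; have c0 : 0 < c by rewrite (lt_le_trans ltr01).
have -> : c * F t = 0 + c * F t by rewrite add0r.
rewrite -F_lin//; apply: le_Rintegral => //.
- by apply: integrable_pole; rewrite mulr_gt0.
- exact: int_lin.
- by move=> x xD; rewrite add0r pole_scale_le// contract_itv.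
Qed.

Lemma pole_transform_itv t : 0 < t -> 0 <= F t <= 1.
Proof.
move=> t0; apply/andP; split.
  apply: Rintegral_ge0 => x xD.
  by case/andP: (pole_itv t0 (contract_itv xD)).
rewrite -[leRHS](F_cst 1); apply: le_Rintegral => //; first exact: integrable_pole.
by move=> x xD; case/andP: (pole_itv t0 (contract_itv xD)).
Qed.

(** The Jensen inequality for [pole_scale]: the odds F / (1 - F) grow at most as fast as the
parameter. *)
Lemma pole_transform_logit t c : 0 < t -> 1 <= c ->
  F (c * t) * (1 - F t) <= c * F t * (1 - F (c * t)).
Proof.
move=> t0 c1; have c0 : 0 < c by rewrite (lt_le_trans ltr01).
have ct0 : 0 < c * t by rewrite mulr_gt0.
have /andP[m0 m1] := pole_transform_itv t0.
set m := F t in m0 m1 *.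
have d0 : 0 < 1 + (c - 1) * m by rewrite ltr_pwDl// mulr_ge0// subr_ge0.
suff : F (c * t) <= c * m / (1 + (c - 1) * m).
  by rewrite ler_pdivlMr//; move: (F (c * t)) => y; nra.
pose b := c / (1 + (c - 1) * m) ^+ 2.
have -> : c * m / (1 + (c - 1) * m) = (c * m / (1 + (c - 1) * m) - b * m) + b * F t.
  by rewrite subrK.
rewrite -F_lin//; apply: le_Rintegral => //; first exact: integrable_pole.
  exact: int_lin.
move=> x xD; apply: le_trans (pole_scale_tangent t0 c1 (contract_itv xD) m0) _.
by rewrite -/b le_eqVlt; apply/orP; left; apply/eqP; ring.
Qed.

Lemma pole_transform_flat t u t1 t2 : 0 < t -> 0 < u -> 0 < t1 -> t1 < t2 ->
  F t1 = F t2 -> F u <= F t.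
Proof.
move=> t0 u0 t10 t12 E; have t20 := lt_trans t10 t12.
have [C C0 H] := pole_osc t0 u0 t10 t12.
have : \int[nu]_(x in D) (0 + 1 * pole u (contract x) - (0 + 1 * pole t (contract x))) <=
    \int[nu]_(x in D) ((0 + C * pole t2 (contract x)) - (0 + C * pole t1 (contract x))).
  apply: le_Rintegral => //.
  - by have := integrableB mD (int_lin 0 1 u0) (int_lin 0 1 t0); apply: eq_integrable.
  - by have := integrableB mD (int_lin 0 C t20) (int_lin 0 C t10); apply: eq_integrable.
  - by move=> x xD; rewrite !mul1r !add0r -mulrBr H// contract_itv.
rewrite !RintegralB//; try exact: int_lin.
by rewrite !F_lin// E subrr subr_le0 !mul1r !add0r.
Qed.

Lemma pole_transform_ge t : 0 < t -> mass_zero nu <= F t.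
Proof.
move=> t0.
have -> : mass_zero nu = \int[nu]_(x in D) \1_[set 0%E] x.
  rewrite /mass_zero /mass_infty /Rintegral integral_indic// setIidl// => _ ->.
  by rewrite /half_line/= in_itv/= lexx leey.
apply: le_Rintegral => //; last 2 first.
- exact: integrable_pole.
- move=> x xD; rewrite indicE; case: (boolP (x \in _)) => [/set_mem ->|_].
    by rewrite contract0 /pole subr0 mulr1 addr0 divff// gt_eqF.
  by case/andP: (pole_itv t0 (contract_itv xD)).
apply: (@bounded_integrable _ _ _ _ _ _ _ _ 1) => //.
by move=> x _; rewrite indicE; case: (_ \in _); rewrite ?normr1 ?normr0.
Qed.

Lemma pole_transform_le t : 0 < t -> F t <= 1 - mass_infty nu.
Proof.
move=> t0.
have -> : mass_infty nu = \int[nu]_(x in D) \1_[set +oo%E] x.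
  rewrite /mass_zero /mass_infty /Rintegral integral_indic// setIidl// => _ ->.
  by rewrite /half_line/= in_itv/= lexx leey.
have ii : nu.-integrable D (EFin \o \1_[set +oo%E]).
  apply: (@bounded_integrable _ _ _ _ _ _ _ _ 1) => //.
  by move=> x _; rewrite indicE; case: (_ \in _); rewrite ?normr1 ?normr0.
rewrite -{1}(F_cst 1) -RintegralB//; apply: le_Rintegral => //.
- exact: integrable_pole.
- by have := integrableB mD (int_cst 1) ii; apply: eq_integrable.
- move=> x xD; rewrite indicE; case: (boolP (x \in _)) => [/set_mem ->|_].
    by rewrite /= /pole subrr mulr0 mul0r.
  by rewrite subr0; case/andP: (pole_itv t0 (contract_itv xD)).
Qed.

Lemma pole_transform_lt a : mass_zero nu < a -> exists2 t, 0 < t & F t < a.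
Proof.
move=> h; have hk n : 0 < (n.+1%:R^-1 : R) by rewrite invr_gt0 ltr0n.
suff : (fun n => F n.+1%:R^-1) @ \oo --> mass_zero nu.
  move=> /cvgr_lt/(_ a h) [N _ /(_ N (leqnn N)) /= H].
  by exists N.+1%:R^-1.
have -> : mass_zero nu = \int[nu]_(x in D) \1_[set 0%E] x.
  rewrite /mass_zero /mass_infty /Rintegral integral_indic// setIidl// => _ ->.
  by rewrite /half_line/= in_itv/= lexx leey.
apply: (bounded_convergence mD nuD (M := 1)) => [n||n x xD|].
- apply: measurable_within.
  exact: within_continuous_contract (within_continuous_pole (hk n)).
- by apply: measurable_indic; exact: emeasurable_set1.
- have /andP[p0 p1] := pole_itv (hk n) (contract_itv xD).
  by rewrite ger0_norm.
- apply: aeW => x xD; rewrite indicE; case: (boolP (x \in _)) => [/set_mem ->|nx].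
    rewrite (_ : (fun n => _) = fun=> 1); first exact: cvg_cst.
    by apply/funext => n; rewrite contract0 /pole subr0 mulr1 addr0 divff.
  rewrite mulr0n; have /andP[v0 v1] := contract_itv xD; set v := contract x in v0 v1 *.
  have v0' : 0 < v.
    rewrite lt_neqAle v0 andbT eq_sym contract_eq0; apply: contraNneq nx => ->.
    exact/mem_set.
  apply: (@squeeze_cvgr _ _ _ _ (fun=> 0) (fun n => n.+1%:R^-1 * v^-1)).
  + apply: nearW => n; have n0 := hk n.
    have v01 : 0 <= v <= 1 by rewrite v0.
    have /andP[-> _] := pole_itv n0 v01; have d := pole_den_gt0 n0 v01.
    rewrite /pole /=; apply: ler_pM; rewrite ?mulr_ge0 ?subr_ge0 ?invr_ge0 ?(ltW d) ?(ltW n0)//.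
      by rewrite ler_piMr ?(ltW n0)// gerBl.
    by rewrite lef_pV2 ?posrE// lerDr mulr_ge0 ?subr_ge0// ltW.
  + exact: cvg_cst.
  + by rewrite -(mul0r v^-1); apply: cvgM; [exact: cvg_harmonic|exact: cvg_cst].
Qed.

Lemma pole_transform_gt a : a < 1 - mass_infty nu -> exists2 t, 0 < t & a < F t.
Proof.
move=> h; have hk n : 0 < (n.+1%:R : R) by rewrite ltr0n.
suff : (fun n => F n.+1%:R) @ \oo --> 1 - mass_infty nu.
  move=> /cvgr_gt/(_ a h) [N _ /(_ N (leqnn N)) /= H].
  by exists N.+1%:R.
have ii : nu.-integrable D (EFin \o \1_[set +oo%E]).
  apply: (@bounded_integrable _ _ _ _ _ _ _ _ 1) => //.
  by move=> x _; rewrite indicE; case: (_ \in _); rewrite ?normr1 ?normr0.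
have -> : 1 - mass_infty nu = \int[nu]_(x in D) (1 - \1_[set +oo%E] x).
  rewrite RintegralB// F_cst /mass_zero /mass_infty /Rintegral integral_indic// setIidl// => _ ->.
  by rewrite /half_line/= in_itv/= lexx leey.
apply: (bounded_convergence mD nuD (M := 1)) => [n||n x xD|].
- apply: measurable_within.
  exact: within_continuous_contract (within_continuous_pole (hk n)).
- by apply: measurable_funB => //; by apply: measurable_indic; exact: emeasurable_set1.
- have /andP[p0 p1] := pole_itv (hk n) (contract_itv xD).
  by rewrite ger0_norm.
- apply: aeW => x xD; rewrite indicE; case: (boolP (x \in _)) => [/set_mem ->|nx].
    rewrite (_ : (fun n => _) = fun=> 0); first by rewrite subrr; exact: cvg_cst.
    by apply/funext => n; rewrite /= /pole subrr mulr0 mul0r.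
  rewrite subr0; have /andP[v0 v1] := contract_itv xD; set v := contract x in v0 v1 *.
  have v1' : 0 < 1 - v.
    rewrite subr_gt0 lt_neqAle v1 andbT contract_eq1; apply: contraNneq nx => ->.
    exact/mem_set.
  apply: (@squeeze_cvgr _ _ _ _ (fun n => 1 - n.+1%:R^-1 * (1 - v)^-1) (fun=> 1)).
  + apply: nearW => n; have n0 := hk n.
    have v01 : 0 <= v <= 1 by rewrite v0.
    have /andP[_ ->] := pole_itv n0 v01; have d := pole_den_gt0 n0 v01.
    rewrite andbT lerBlDr -lerBlDl -invfM.
    have -> : 1 - pole n.+1%:R v = v / (n.+1%:R * (1 - v) + v).
      by rewrite /pole; move: (_%:R) d => w d; field; rewrite gt_eqF.
    rewrite ler_pdivrMr// ler_pdivlMl ?mulr_gt0//.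
    apply: (@le_trans _ _ (n.+1%:R * (1 - v))); last by rewrite lerDl.
    by apply: ler_piMr => //; exact: mulr_ge0 (ltW n0) (ltW v1').
  + have : (fun n => 1 - n.+1%:R^-1 * (1 - v)^-1) @ \oo --> 1 - 0 * (1 - v)^-1.
      by apply: cvgB; [exact: cvg_cst|apply: cvgM; [exact: cvg_harmonic|exact: cvg_cst]].
    by rewrite mul0r subr0.
  + exact: cvg_cst.
Qed.

End PoleTransform.

(** * Integration against empirical measures of zeros *)

Section Empirical.
Context {R : realType}.
Implicit Types (Q : {poly R}) (f : \bar R -> R).
Local Notation D := (@half_line R).

Let mD : measurable D. Proof. exact: measurable_half_line. Qed.

Let D_fin a : 0 <= a -> D a%:E.
Proof. by move=> a0; rewrite /half_line/= in_itv/= leey lee_fin a0. Qed.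

Let D_oo : D +oo%E.
Proof. by rewrite /half_line/= in_itv/= leey. Qed.

Let integral_empirical_ge0 n Q f : {in real_zeros Q, forall a, 0 <= a} ->
  measurable_fun D f -> (forall x, D x -> 0 <= f x) ->
  (\int[empirical_zeros n Q]_(x in D) (f x)%:E =
   (n%:R^-1 * (\sum_(a <- real_zeros Q) f a%:E + (n - (size Q).-1)%:R * f +oo%E))%:E)%E.
Proof.
move=> z0 mf f0; have mf' : measurable_fun D (EFin \o f) by exact/measurable_EFinP.
have f0' x : D x -> (0 <= (EFin \o f) x)%E by move=> xD; rewrite lee_fin f0.
rewrite /empirical_zeros ge0_integral_mscale// ge0_integral_measure_add//.
rewrite ge0_integral_measure_sum// ge0_integral_mscale// integral_dirac//=.
rewrite diracE mem_set// mul1e EFinM EFinD EFinM; congr (_ * (_ + _))%E.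
rewrite /real_zeros big_map (big_nth 0) big_mkord -sumEFin; apply: eq_bigr => i _.
rewrite integral_dirac// diracE mem_set ?mul1e//.
by apply: D_fin; apply: z0; apply: map_f; exact: mem_nth.
Qed.

Lemma integral_empirical n Q f : {in real_zeros Q, forall a, 0 <= a} ->
  measurable_fun D f ->
  (\int[empirical_zeros n Q]_(x in D) (f x)%:E =
   (n%:R^-1 * (\sum_(a <- real_zeros Q) f a%:E + (n - (size Q).-1)%:R * f +oo%E))%:E)%E.
Proof.
move=> z0 mf; rewrite integralE.
pose fp x := Num.max (f x) 0; pose fn x := Num.max (- f x) 0.
have fpe : (fun x => (f x)%:E)^\+%E = EFin \o fp.
  by apply/funext => x; rewrite funeposE /= /fp EFin_max.
have fne : (fun x => (f x)%:E)^\-%E = EFin \o fn.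
  by apply/funext => x; rewrite funenegE /= /fn EFin_max.
rewrite fpe fne !integral_empirical_ge0//; last 4 first.
- exact: (measurable_maxr (measurable_funN mf) (measurable_cst (0 : R))).
- by move=> x _; rewrite le_max lexx orbT.
- exact: (measurable_maxr mf (measurable_cst (0 : R))).
- by move=> x _; rewrite le_max lexx orbT.
rewrite -EFinB -mulrBr; congr (_ * _)%:E.
have d x : f x = fp x - fn x.
  rewrite /fp /fn; have [h|h] := leP (f x) 0.
    by rewrite max_l ?oppr_ge0// sub0r opprK.
  by rewrite max_r ?oppr_le0 ?ltW// subr0.
rewrite (d +oo%E); under [in RHS]eq_bigr do rewrite d.
rewrite sumrB; ring.
Qed.

(** The zeros in the coordinate z / (1 + z), the missing ones being placed at 1, so that
there are exactly n of them. *)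
Definition contracted_zeros n Q : seq R :=
  [seq a / (1 + a) | a <- real_zeros Q] ++ nseq (n - (size Q).-1) 1.

Lemma contracted_zeros_itv n Q : {in real_zeros Q, forall a, 0 <= a} ->
  {in contracted_zeros n Q, forall v, 0 <= v <= 1}.
Proof.
move=> z0 v; rewrite mem_cat => /orP[/mapP[a az ->]|].
  have a0 := z0 _ az; rewrite divr_ge0 ?addr_ge0//=.
  by rewrite ler_pdivrMr ?ltr_pwDl// mul1r lerDr.
by rewrite mem_nseq => /andP[_ /eqP ->]; rewrite ler01 lexx.
Qed.

Lemma size_contracted_zeros n Q : size (real_zeros Q) = (size Q).-1 ->
  (size Q <= n.+1)%N -> size (contracted_zeros n Q) = n.
Proof.
move=> s sQ; rewrite size_cat size_map size_nseq s subnKC//.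
by case: (size Q) sQ.
Qed.

Lemma integral_empirical_expand n Q f : {in real_zeros Q, forall a, 0 <= a} ->
  measurable_fun D f ->
  (\int[empirical_zeros n Q]_(x in D) (f x)%:E =
   (n%:R^-1 * \sum_(v <- contracted_zeros n Q) f (expand v))%:E)%E.
Proof.
move=> z0 mf; rewrite integral_empirical//; congr (_ * _)%:E.
rewrite /contracted_zeros big_cat; congr (_ + _); first rewrite [in RHS]big_map.
  by rewrite big_seq [RHS]big_seq; apply: eq_bigr => a /z0 a0; rewrite expand_ratio.
rewrite big_nseq iter_addr_0 expand1//.
by rewrite mulr_natl.
Qed.

Lemma sum_pole_contracted_zeros n Q t : {in real_zeros Q, forall a, 0 <= a} ->
  0 < t -> \sum_(v <- contracted_zeros n Q) pole t v = pole_sum (real_zeros Q) t.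
Proof.
move=> z0 t0; rewrite /contracted_zeros big_cat /= [X in X + _]big_map [X in _ + X]big1_seq.
  rewrite addr0 /pole_sum big_seq [RHS]big_seq; apply: eq_bigr => a /z0 a0.
  by rewrite pole_contract.
by move=> v /=; rewrite mem_nseq => /andP[_ /eqP ->]; rewrite /pole subrr mulr0 mul0r.
Qed.

End Empirical.

(** * Averages of the kernels determine averages of polynomials *)

Section Averages.
Context {R : realType}.
Implicit Types (g h : R -> R) (t s v a b e : R) (p : {poly R}).
Variable l : nat -> seq R.
Hypothesis size_l : forall n, size (l n) = n.
Hypothesis l01 : forall n, {in l n, forall v, 0 <= v <= 1}.

Definition average n g : R := n%:R^-1 * \sum_(v <- l n) g v.
Local Notation avg_cvg g := (cvgn (average ^~ g)).

Lemma le_average n g h : (forall v, 0 <= v <= 1 -> g v <= h v) ->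
  average n g <= average n h.
Proof.
move=> gh; rewrite ler_wpM2l ?invr_ge0// big_seq [leRHS]big_seq.
by apply: ler_sum => v vl; apply: gh; exact: l01 vl.
Qed.

Lemma averageD n g h : average n (fun v => g v + h v) = average n g + average n h.
Proof. by rewrite /average big_split mulrDr. Qed.

Lemma averageZ n a g : average n (fun v => a * g v) = a * average n g.
Proof. by rewrite /average -mulr_sumr mulrCA. Qed.

Lemma eq_average n g h : (forall v, 0 <= v <= 1 -> g v = h v) ->
  average n g = average n h.
Proof. by move=> gh; apply/eqP; rewrite eq_le !le_average// => v /gh ->. Qed.

Lemma average_cst n a : (0 < n)%N -> average n (fun=> a) = a.
Proof.
move=> n0; rewrite /average big_const_seq count_predT size_l iter_addr_0.
by rewrite -[a *+ n]mulr_natl mulrA mulVf ?mul1r// pnatr_eq0 -lt0n.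
Qed.

Lemma average_dist n g h e : 0 <= e -> (forall v, 0 <= v <= 1 -> `|g v - h v| <= e) ->
  `|average n g - average n h| <= e.
Proof.
move=> e0 gh; have [->|n0] := posnP n; first by rewrite /average invr0 !mul0r subrr normr0.
have gE v : 0 <= v <= 1 -> h v - e <= g v <= h v + e.
  by move=> /gh; rewrite ler_distl.
rewrite ler_distl -(@average_cst n e n0).
rewrite -averageD -mulN1r -averageZ -averageD; apply/andP; split;
  apply: le_average => v /gE /andP[]//.
by rewrite mulN1r.
Qed.

Lemma avg_cvgD g h : avg_cvg g -> avg_cvg h -> avg_cvg (fun v => g v + h v).
Proof.
move=> cg ch; rewrite (_ : average ^~ _ = (average ^~ g) \+ (average ^~ h)).
  exact: is_cvgD.
by apply/funext => n /=; rewrite averageD.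
Qed.

Lemma avg_cvgZ a g : avg_cvg g -> avg_cvg (fun v => a * g v).
Proof.
move=> cg; rewrite (_ : average ^~ _ = fun n => a * average n g).
  by apply: is_cvgM => //; exact: is_cvg_cst.
by apply/funext => n /=; rewrite averageZ.
Qed.

Lemma eq_avg_cvg g h : (forall v, 0 <= v <= 1 -> g v = h v) -> avg_cvg g -> avg_cvg h.
Proof.
move=> gh; rewrite (_ : average ^~ h = average ^~ g)//.
by apply/funext => n; apply: eq_average => v /gh.
Qed.

Lemma avg_cvg_cst a : avg_cvg (fun=> a).
Proof.
apply/cvg_ex; exists a; apply: cvg_near_cst.
by exists 1%N => // n n1; rewrite average_cst.
Qed.

(** Convergence of averages passes to uniform limits; the approximation of the
powers of 1 - v by combinations of kernels rests on this. *)
Lemma avg_cvg_uniform g :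
  (forall e, 0 < e -> exists2 h, avg_cvg h &
     forall v, 0 <= v <= 1 -> `|g v - h v| <= e) -> avg_cvg g.
Proof.
move=> H; apply/cauchy_cvgP; apply: cauchy_exP => e e0.
have e2 : 0 < e / 2 by rewrite divr_gt0.
have [h ch gh] := H _ e2; exists (lim (average ^~ h @ \oo)).
rewrite /nbhs/=; move/cvgrPdist_lt : ch => /(_ _ e2); apply: filterS => n hn.
rewrite /ball /= (splitr e).
apply: le_lt_trans (ler_distD (average n h) _ _) _.
rewrite ltr_leD// distrC average_dist//; exact: ltW.
Qed.

Hypothesis cvg_pole : forall t, 0 < t -> avg_cvg (pole t).

Let geo_den s v : 0 < s -> s <= 2^-1 -> 0 <= v <= 1 -> 2^-1 <= 1 - s * (1 - v).
Proof. by move=> s0 s2 /andP[v0 v1]; nra. Qed.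

(** With u = 1 - v, the kernel at parameter 1 - s is (1 - s) u / (1 - s u). From
u^k / (1 - s u) for all small s one gets u^k as the uniform limit s -> 0, and
then u^(k+1) / (1 - s u) as the quotient of u^k / (1 - s u) - u^k by s. *)
Let avg_cvg_geo k s : 0 < s -> s <= 2^-1 ->
  avg_cvg (fun v => (1 - v) ^+ k.+1 / (1 - s * (1 - v))).
Proof.
suff pow_of_geo j : (forall s, 0 < s -> s <= 2^-1 ->
    avg_cvg (fun v => (1 - v) ^+ j.+1 / (1 - s * (1 - v)))) ->
    avg_cvg (fun v => (1 - v) ^+ j.+1).
  elim: k s => [|k ih] s s0 s2.
    have s1 : 0 < 1 - s by rewrite subr_gt0 (le_lt_trans s2)// invf_lt1 ?ltr1n.
    have := avg_cvgZ (a := (1 - s)^-1) (cvg_pole s1).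
    apply: eq_avg_cvg => v v01; have d := pole_den_gt0 s1 v01.
    have e : (1 - s) * (1 - v) + v = 1 - s * (1 - v) by ring.
    rewrite /pole e in d *; rewrite expr1.
    by field; rewrite (gt_eqF d) (gt_eqF s1).
  have := avg_cvgZ (a := s^-1) (avg_cvgD (ih s s0 s2) (avg_cvgZ (a := -1) (@pow_of_geo k ih))).
  apply: eq_avg_cvg => v v01; have d := geo_den s0 s2 v01.
  have d0 : 0 < 1 - s * (1 - v) by rewrite (lt_le_trans _ d)// invr_gt0.
  rewrite [in RHS]exprS; move: (_ ^+ k.+1) => w.
  by field; rewrite (gt_eqF d0) (gt_eqF s0).
move=> geo; apply: avg_cvg_uniform => e e0.
pose r := Num.min (2^-1) (e / 2).
have r0 : 0 < r by rewrite lt_min invr_gt0 ltr0n divr_gt0.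
have r2 : r <= 2^-1 by rewrite ge_min lexx.
have re : r <= e / 2 by rewrite ge_min lexx orbT.
exists (fun v => (1 - v) ^+ j.+1 / (1 - r * (1 - v))); first exact: geo.
move=> v v01; have d := geo_den r0 r2 v01.
have d0 : 0 < 1 - r * (1 - v) by rewrite (lt_le_trans _ d)// invr_gt0.
case/andP: v01 => v0 v1; set w := (1 - v) ^+ j.+1.
have u01 : 0 <= 1 - v <= 1 by rewrite subr_ge0 v1 gerBl.
have w01 : 0 <= w <= 1.
  by case/andP: u01 => u0 u1; apply/andP; split; [exact: exprn_ge0 | exact: exprn_ile1].
have -> : w - w / (1 - r * (1 - v)) = - (w * (r * (1 - v)) / (1 - r * (1 - v))).
  by field; rewrite gt_eqF.
case/andP: u01 => u0 u1; case/andP: w01 => w0 w1.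
have rv0 : 0 <= r * (1 - v) by rewrite mulr_ge0// ltW.
rewrite normrN ger0_norm; last exact: divr_ge0 (mulr_ge0 w0 rv0) (ltW d0).
rewrite ler_pdivrMr//; apply: (@le_trans _ _ (r * (1 - v))).
  by rewrite ler_piMl.
by move: re d; nra.
Qed.

Let avg_cvg_pow k : avg_cvg (fun v => (1 - v) ^+ k).
Proof.
case: k => [|k].
  apply: (eq_avg_cvg _ (@avg_cvg_cst 1)).
  by move=> v _; rewrite expr0.
have h0 : (0 : R) < 2^-1 by rewrite invr_gt0.
apply: (eq_avg_cvg _ (avg_cvgD (@avg_cvg_geo k _ h0 (lexx _))
  (avg_cvgZ (a := - 2^-1) (@avg_cvg_geo k.+1 _ h0 (lexx _))))) => v v01.
 have d := geo_den h0 (lexx _) v01.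
have d0 : 0 < 1 - 2^-1 * (1 - v) by rewrite (lt_le_trans _ d)// invr_gt0.
rewrite [_ ^+ k.+2]exprS; move: (_ ^+ k.+1) => w.
by move: d0; set c : R := 2^-1; move: c => c d0; field; rewrite gt_eqF.
Qed.

Lemma avg_cvg_poly p : avg_cvg (horner p).
Proof.
pose q := p \Po (1 - 'X).
have E v : p.[v] = q.[1 - v].
  by rewrite horner_comp !hornerE opprB addrC subrK.
apply: (@eq_avg_cvg (fun v => \sum_(i < size q) q`_i * (1 - v) ^+ i)).
  by move=> v _; rewrite E horner_coef.
elim: (size q) => [|m ih].
  by apply: (eq_avg_cvg _ (@avg_cvg_cst 0)) => v _; rewrite big_ord0.
apply: (eq_avg_cvg _ (avg_cvgD ih (avg_cvgZ (a := q`_m) (@avg_cvg_pow m)))) => v _.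
by rewrite big_ord_recr.
Qed.

End Averages.

Section StepPolynomial.
Context {R : realType}.
Implicit Types (a b c e v x : R).

Lemma bernoulli_ge x N : 0 <= x -> 1 + N%:R * x <= (1 + x) ^+ N.
Proof.
move=> x0; elim: N => [|N ih]; first by rewrite mul0r addr0 expr0.
rewrite exprS -natr1; apply: (@le_trans _ _ ((1 + x) * (1 + N%:R * x))); last first.
  by rewrite ler_wpM2l// addr_ge0.
have : 0 <= N%:R * x * x by rewrite !mulr_ge0.
by move: (N%:R : R) => M; nra.
Qed.

Lemma bernoulli_le x N : 0 <= x <= 1 -> 1 - N%:R * x <= (1 - x) ^+ N.
Proof.
move=> /andP[x0 x1]; elim: N => [|N ih]; first by rewrite mul0r subr0 expr0.
rewrite exprS -natr1; apply: (@le_trans _ _ ((1 - x) * (1 - N%:R * x))); last first.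
  by rewrite ler_wpM2l// subr_ge0.
have : 0 <= N%:R * x * x by rewrite !mulr_ge0.
by move: (N%:R : R) => M; nra.
Qed.

Lemma exprn_small x e : 0 <= x < 1 -> 0 < e -> \forall m \near \oo, x ^+ m <= e.
Proof.
move=> /andP[x0 x1] e0; have : (fun m => x ^+ m) @ \oo --> 0.
  by apply: cvg_expr; rewrite ger0_norm.
by move=> /cvgr_le; apply.
Qed.

(** The polynomial (1 - v^m)^N with N about c^(-m), where a < c < b: by the Bernoulli
inequalities it is at least 1 - N a^m below a and at most 1 / (N b^m) above
b, and N a^m and N b^m tend to 0 and +oo. *)
Lemma step_polynomial a b e : 0 <= a -> a < b -> b <= 1 -> 0 < e ->
  exists p : {poly R}, forall v, 0 <= v <= 1 ->
    [/\ 0 <= p.[v] <= 1, (v <= a -> 1 - e <= p.[v]) & (b <= v -> p.[v] <= e)].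
Proof.
move=> a0 ab b1 e0; pose c := (a + b) / 2.
have ac : a < c by rewrite /c; lra.
have cb : c < b by rewrite /c; lra.
have c0 : 0 < c by exact: le_lt_trans ac.
have b0 : 0 < b by exact: lt_trans cb.
have h1 : 0 <= a / c < 1 by rewrite divr_ge0 ?(ltW c0)//= ltr_pdivrMr// mul1r.
have h2 : 0 <= c / b < 1 by rewrite divr_ge0 ?(ltW c0) ?(ltW b0)//= ltr_pdivrMr// mul1r.
have e2 : 0 < e / 2 by rewrite divr_gt0.
have [m [m1 m2]] : exists m, (a / c) ^+ m <= e / 2 /\ (c / b) ^+ m <= e.
  have [N _ HN] := filterI (exprn_small h1 e2) (exprn_small h2 e0).
  by exists N; exact: (HN N (leqnn N)).
pose x := (c ^+ m)^-1; have cm0 : 0 < c ^+ m by rewrite exprn_gt0.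
have x1 : 1 <= x by rewrite invf_ge1// exprn_ile1 ?(ltW c0)//; lra.
have x0 : 0 <= x by lra.
(* x <= N <= 2 x *)
pose N := (Num.truncn x).+1.
have /andP[N1 N2] : x <= N%:R <= 2 * x.
  have /andP[t1 t2] := truncn_itv x0; rewrite (ltW t2) /N -natr1.
  by lra.
exists ((1 - 'X^m) ^+ N) => v /andP[v0 v1].
have -> : ((1 - 'X^m) ^+ N).[v] = (1 - v ^+ m) ^+ N by rewrite !hornerE.
have w01 : 0 <= v ^+ m <= 1 by rewrite exprn_ge0// exprn_ile1.
have /andP[w0 w1] := w01.
have u01 : 0 <= (1 - v ^+ m) ^+ N <= 1.
  by rewrite exprn_ge0 ?subr_ge0//= exprn_ile1 ?subr_ge0// gerBl.
split=> // [va|bv].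
  apply: le_trans (bernoulli_le N w01).
  rewrite lerD2l lerN2; apply: (@le_trans _ _ (2 * x * a ^+ m)).
    by rewrite ler_pM// ?lerXn2r ?nnegrE.
  have -> : 2 * x * a ^+ m = 2 * (a / c) ^+ m by rewrite expr_div_n /x; ring.
  by lra.
have bm0 : 0 < b ^+ m by rewrite exprn_gt0.
have wb : b ^+ m <= v ^+ m by rewrite lerXn2r ?nnegrE ?(ltW b0).
have xb : x * b ^+ m <= N%:R * v ^+ m by rewrite ler_pM// ltW.
have xb0 : 0 < x * b ^+ m by rewrite mulr_gt0// invr_gt0.
apply: (@le_trans _ _ (x * b ^+ m)^-1); last first.
  by rewrite invfM /x invrK -expr_div_n.
rewrite -[leRHS]mul1r ler_pdivlMr//.
apply: (@le_trans _ _ ((1 - v ^+ m) ^+ N * (1 + v ^+ m) ^+ N)).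
  rewrite ler_wpM2l//; first by case/andP: u01.
  by apply: le_trans (bernoulli_ge N w0); apply: le_trans xb _; rewrite lerDr.
rewrite -exprMn exprn_ile1//; last by nra.
by rewrite mulr_ge0 ?subr_ge0// addr_ge0.
Qed.

End StepPolynomial.

(** * Almost everywhere convergence of quantile functions *)

Section Quantile.
Context {R : realType}.
Implicit Types (g : R -> R) (s a b e v : R) (p : {poly R}).
Variable l : nat -> seq R.
Hypothesis size_l : forall n, size (l n) = n.
Hypothesis l01 : forall n, {in l n, forall v, 0 <= v <= 1}.
Local Notation average := (average l).

Definition sorted_value n k : R := nth 0 (sort <=%R (l n.+1)) k.

Definition cell n k : set R := `[k%:R / n.+1%:R, k.+1%:R / n.+1%:R[%classic.

(** The quantile function of the uniform measure on the list of n + 1 values, as a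
combination of indicators, which makes it measurable and easy to integrate;
it vanishes outside [0,1[. *)
Definition quantile n s : R := \sum_(k < n.+1) sorted_value n k * \1_(cell n k) s.

Lemma sorted_value_itv n k : 0 <= sorted_value n k <= 1.
Proof.
rewrite /sorted_value; have [h|h] := ltnP k (size (sort <=%R (l n.+1))).
  by apply: (l01 (n := n.+1)); rewrite -(mem_sort <=%R) mem_nth.
by rewrite nth_default// lexx ler01.
Qed.

Lemma le_sorted_value n i j : (i <= j)%N -> (j < n.+1)%N ->
  sorted_value n i <= sorted_value n j.
Proof.
move=> ij jn; apply: (sorted_leq_nth le_trans lexx); rewrite ?inE ?size_sort ?size_l//.
- exact: sort_le_sorted.
- exact: leq_ltn_trans jn.
Qed.

Lemma average_sorted n g :
  average n.+1 g = n.+1%:R^-1 * \sum_(k < n.+1) g (sorted_value n k).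
Proof.
rewrite /average; congr (_ * _).
have /(perm_big _)-> : perm_eq (l n.+1) (sort <=%R (l n.+1)) by rewrite perm_sym perm_sort.
by rewrite (big_nth 0) big_mkord size_sort size_l.
Qed.

Lemma cell_truncn n k s : 0 <= s -> (k < n.+1)%N ->
  (s \in cell n k) = (k == Num.truncn (n.+1%:R * s)).
Proof.
move=> s0 kn; have n0 : 0 < n.+1%:R :> R by rewrite ltr0n.
have := truncn_itv (mulr_ge0 (ltW n0) s0); set m := Num.truncn _ => /andP[m1 m2].
apply/idP/eqP => [/set_mem|->]; last first.
  apply/mem_set; rewrite /cell /= in_itv /= ler_pdivrMr// ltr_pdivlMr//.
  by rewrite mulrC m1.
rewrite /cell /= in_itv /= ler_pdivrMr// ltr_pdivlMr// => /andP[k1 k2].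
apply/eqP; rewrite eqn_leq -ltnS -(ltr_nat R) (le_lt_trans k1) ?[s * _]mulrC//=.
by rewrite -ltnS -(ltr_nat R) (le_lt_trans m1)// mulrC.
Qed.

Lemma truncn_cell n s : 0 <= s < 1 -> (Num.truncn (n.+1%:R * s) < n.+1)%N.
Proof.
move=> /andP[s0 s1]; have n0 : 0 < n.+1%:R :> R by rewrite ltr0n.
have /andP[m1 _] := truncn_itv (mulr_ge0 (ltW n0) s0).
by rewrite -(ltr_nat R) (le_lt_trans m1)// gtr_pMr.
Qed.

Lemma cell_sum n (c : nat -> R) s : 0 <= s < 1 ->
  \sum_(k < n.+1) c k * \1_(cell n k) s = c (Num.truncn (n.+1%:R * s)).
Proof.
move=> s01; have kn := truncn_cell n s01; case/andP: s01 => s0 _.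
rewrite (bigD1 (Ordinal kn))//= indicE cell_truncn// eqxx mulr1 big1 ?addr0//.
move=> k /eqP kk; rewrite indicE cell_truncn//.
by case: eqP => [e|]; [case: kk; exact: val_inj | rewrite mulr0].
Qed.

Lemma cell_sub n k : (k < n.+1)%N -> cell n k `<=` `[0, 1[%classic.
Proof.
move=> kn s; rewrite /cell /= !in_itv /= => /andP[h1 h2].
rewrite (le_trans _ h1)/= ?divr_ge0//; apply: lt_le_trans h2 _.
by rewrite ler_pdivrMr ?ltr0n// mul1r ler_nat.
Qed.

Lemma cell_sum_out n (c : nat -> R) s : ~ `[0, 1[%classic s ->
  \sum_(k < n.+1) c k * \1_(cell n k) s = 0.
Proof.
move=> ns; rewrite big1// => k _; rewrite indicE; case: (boolP (_ \in _)); last by rewrite mulr0.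
by move=> /set_mem /(cell_sub (ltn_ord k)).
Qed.

Lemma quantile_itv n s : 0 <= quantile n s <= 1.
Proof.
rewrite /quantile; have [s01|s01] := pselect (`[0, 1[%classic s).
  by rewrite cell_sum ?sorted_value_itv//; move: s01; rewrite /= in_itv.
by rewrite cell_sum_out// lexx ler01.
Qed.

(** At least the proportion s of the values is at most the s-quantile. *)
Lemma average_ge n s a e p : 0 <= s < 1 -> e <= 1 ->
  (forall v, 0 <= v <= 1 -> 0 <= p.[v]) ->
  (forall v, 0 <= v <= 1 -> v <= a -> 1 - e <= p.[v]) ->
  quantile n s <= a -> s * (1 - e) <= average n.+1 (horner p).
Proof.
move=> s01 e1 p0 pa; rewrite /quantile cell_sum// average_sorted.
have := truncn_cell n s01; have s0 : 0 <= s by case/andP: s01.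
have n0 : 0 < n.+1%:R :> R by rewrite ltr0n.
have := truncn_itv (mulr_ge0 (ltW n0) s0); set m := Num.truncn _ => /andP[_ m2] mn ma.
rewrite ler_pdivlMl// mulrA; have e0 : 0 <= 1 - e by rewrite subr_ge0.
apply: (@le_trans _ _ (m.+1%:R * (1 - e))); first by rewrite ler_wpM2r// ltW.
apply: (@le_trans _ _ (\sum_(k < n.+1 | (k < m.+1)%N) (1 - e))).
  rewrite -(big_ord_widen n.+1 (fun=> 1 - e))//.
  by rewrite sumr_const card_ord mulr_natl.
rewrite big_mkcond; apply: ler_sum => k _; case: ifP => [km|_].
  by rewrite pa ?sorted_value_itv// (le_trans _ ma)// le_sorted_value.
by rewrite p0// sorted_value_itv.
Qed.

Lemma average_le n s b e p : 0 <= s < 1 -> 0 <= e ->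
  (forall v, 0 <= v <= 1 -> p.[v] <= 1) ->
  (forall v, 0 <= v <= 1 -> b <= v -> p.[v] <= e) ->
  b <= quantile n s -> average n.+1 (horner p) <= s + e.
Proof.
move=> s01 e0 p1 pb; rewrite /quantile cell_sum// average_sorted.
have := truncn_cell n s01; have s0 : 0 <= s by case/andP: s01.
have n0 : 0 < n.+1%:R :> R by rewrite ltr0n.
have := truncn_itv (mulr_ge0 (ltW n0) s0); set m := Num.truncn _ => /andP[m1 _] mn mb.
rewrite ler_pdivrMl// mulrDr.
apply: (@le_trans _ _ (\sum_(k < n.+1) ((if (k < m)%N then 1 else 0) + e))).
  apply: ler_sum => k _; case: ltnP => km.
    by rewrite (le_trans (p1 _ _)) ?sorted_value_itv// lerDl.
  by rewrite add0r pb ?sorted_value_itv// (le_trans mb)// le_sorted_value.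
rewrite big_split /= sumr_const card_ord -[e *+ _]mulr_natl lerD2r -big_mkcond /=.
by rewrite -(big_ord_widen n.+1 (fun=> 1))// ?(ltnW mn)// sumr_const card_ord.
Qed.

Hypothesis cvg_pole : forall t, 0 < t -> cvgn (average ^~ (pole t)).

(** The sequence of s-quantiles is infinitely often below a and infinitely often above
b. *)
Definition oscillates (a b s : R) : Prop :=
  [/\ 0 <= s < 1, forall N, exists2 n, (N <= n)%N & quantile n s <= a
    & forall N, exists2 n, (N <= n)%N & b <= quantile n s].

(** If both s < s' oscillate, a polynomial close to the step between a and b has
averages infinitely often at least about s' and infinitely often at most
about s, although these averages converge. *)
Lemma oscillates_subsingleton a b s s' : a < b ->
  oscillates a b s -> oscillates a b s' -> s' <= s.
Proof.
move=> ab [s01 _ sb] [s01' sa _]; rewrite leNgt; apply/negP => ss'.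
have a0 : 0 <= a.
  by have [n _ /(le_trans _)->//] := sa 0%N; case/andP: (quantile_itv n s').
have b1 : b <= 1.
  by have [n _ /le_trans->//] := sb 0%N; case/andP: (quantile_itv n s).
(* the bounds s' (1 - e) - e and s + 2 e for the limit of the averages are
   incompatible, as s' <= 1 *)
pose e := (s' - s) / 4; have e0 : 0 < e by rewrite /e; lra.
have e1 : e <= 1 by rewrite /e; lra.
have [p hp] := step_polynomial a0 ab b1 e0.
have cp : cvgn (average ^~ (horner p)) by exact: avg_cvg_poly.
move: cp => /cvgrPdist_lt/(_ e e0)[N _ HN]; move: HN; set c := limn _ => HN.
have [n1 Nn1 h1] := sa N; have [n2 Nn2 h2] := sb N.
have := HN n1.+1 (leqW Nn1); have := HN n2.+1 (leqW Nn2).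
rewrite /= !ltr_distl => /andP[_ c2] /andP[c1 _].
have A : s' * (1 - e) <= average n1.+1 (horner p).
  apply: average_ge h1 => // v v01; first by have [/andP[]] := hp v v01.
  by have [] := hp v v01.
have B : average n2.+1 (horner p) <= s + e.
  apply: average_le h2 => //; first exact: ltW.
    by move=> v v01; have [/andP[]] := hp v v01.
  by move=> v v01; have [] := hp v v01.
have s1 : s' * e <= e by rewrite ler_piMl ?(ltW e0)//; lra.
by move: A B c1 c2 s1; rewrite mulrBr mulr1 /e; lra.
Qed.

Definition bad_points : set R :=
  \bigcup_(r in [set r : rat * rat | ratr r.1 < ratr r.2 :> R])
    [set s | oscillates (ratr r.1) (ratr r.2) s].

Lemma countable_bad_points : countable bad_points.
Proof.
apply: bigcup_countable => // -[a b] /= ab.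
have [[s os]|no] := pselect (exists s, oscillates (ratr a) (ratr b) s).
  rewrite (_ : [set _ | _] = [set s]) ?countable1//.
  apply/seteqP; split => [s' os' /=|_ ->//].
  by apply/eqP; rewrite eq_le !(oscillates_subsingleton ab).
rewrite (_ : [set _ | _] = set0); first exact: countable0.
by apply/seteqP; split => // s os; case: no; exists s.
Qed.

(** A bounded sequence that oscillates between no two rationals converges, here to its
lower limit. *)
Lemma quantile_cvg s : 0 <= s < 1 -> ~ bad_points s -> cvgn (quantile ^~ s).
Proof.
move=> s01 nb; pose S := [set y | exists N, forall n, (N <= n)%N -> y <= quantile n s].
have S0 : S 0 by exists 0%N => n _; case/andP: (quantile_itv n s).
have Sub : ubound S 1.
  move=> y [N HN]; apply: le_trans (HN N (leqnn N)) _.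
  by case/andP: (quantile_itv N s).
have hS : has_sup S by split; [exists 0 | exists 1].
apply/cauchy_cvgP; apply: cauchy_exP => e e0.
have [y [N1 HN1] yS] := sup_adherent e0 hS.
have e2 : sup S + e / 2 < sup S + e by lra.
(* the quantiles are infinitely often at most a, since a is larger than sup S;
   as they do not oscillate between a and b, they end up below b *)
exists (sup S).
have [a /andP[/= a1 a2]] : exists a : rat, (sup S + e / 2 < ratr a < sup S + e).
  by have [a aI] := rat_in_itvoo e2; exists a; move: aI; rewrite in_itv.
have [b /andP[/= b1 b2]] : exists b : rat, ratr a < (ratr b : R) < sup S + e.
  by have [b bI] := rat_in_itvoo a2; exists b; move: bI; rewrite in_itv.
have nS : ~ S (ratr a).
  by move=> /(ub_le_sup hS.2); lra.
have [N2 HN2] : exists N, forall n, (N <= n)%N -> quantile n s < ratr b.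
  apply: contrapT => h; apply: nb; exists (a, b) => //=; split => // N.
    apply: contrapT => k; apply: nS; exists N => n Nn.
    by rewrite leNgt; apply/negP => /ltW q; apply: k; exists n.
  apply: contrapT => k; apply: h; exists N => n Nn.
  by rewrite ltNge; apply/negP => q; apply: k; exists n.
exists (maxn N1 N2) => // n /=; rewrite geq_max => /andP[n1 n2].
have := HN1 n n1; have := HN2 n n2.
by rewrite /ball /= ltr_distl => *; apply/andP; split; lra.
Qed.

End Quantile.

(** * The limit measure *)

Section QuantileMeasure.
Context {R : realType}.
Variable l : nat -> seq R.
Hypothesis size_l : forall n, size (l n) = n.
Hypothesis l01 : forall n, {in l n, forall v, 0 <= v <= 1}.
Hypothesis cvg_pole : forall t, 0 < t -> cvgn ((average l) ^~ (pole t)).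
Local Notation q := (quantile l).
Local Notation P := (uniform_prob (@ltr01 R)).

(** The truncation makes the limit a value in [0,1] also at the exceptional points,
where the upper limit of the quantiles is not a limit. *)
Definition clamp (x : R) : R := Num.min (Num.max x 0) 1.

Lemma clamp_itv x : 0 <= clamp x <= 1.
Proof. by rewrite /clamp le_min ge_min lexx orbT le_max lexx orbT ler01. Qed.

Lemma clamp_id x : 0 <= x <= 1 -> clamp x = x.
Proof. by move=> /andP[x0 x1]; rewrite /clamp (max_l x0) min_l. Qed.

Definition quantile_limit (s : R) : R := clamp (limn_sup (q ^~ s)).

Lemma measurable_cell n k : measurable (cell n k : set R).
Proof. exact: measurable_itv. Qed.

Lemma measurable_cell_sum n m (c : nat -> R) :
  measurable_fun setT (fun s : R => \sum_(k < m) c k * \1_(cell n k) s).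
Proof.
apply: measurable_sum => k; apply: measurable_funM => //.
exact: measurable_indic (measurable_cell _ _).
Qed.

Lemma measurable_quantile n : measurable_fun setT (q n).
Proof. exact: measurable_cell_sum. Qed.

Lemma measurable_quantile_limit : measurable_fun setT quantile_limit.
Proof.
apply: measurable_minr => //; apply: measurable_maxr => //.
apply: measurable_fun_limn_sup => [s _|s _|n]; last exact: measurable_quantile.
- by exists 1 => _ [n _ <-]; case/andP: (quantile_itv l01 n s).
- by exists 0 => _ [n _ <-]; case/andP: (quantile_itv l01 n s).
Qed.

Definition limit_variable (s : R) : \bar R := expand (quantile_limit s).

Lemma contract_limit_variable s : contract (limit_variable s) = quantile_limit s.
Proof. by rewrite expand_contract_itv// clamp_itv. Qed.

Lemma measurable_limit_variable : measurable_fun setT limit_variable.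
Proof.
apply: (measurability _ (ErealGenOInfty.measurableE R)) => _ [_ [x ->] <-].
have -> : setT `&` limit_variable @^-1` `]x%:E, +oo[%classic =
    setT `&` quantile_limit @^-1` `]contract x%:E, +oo[%classic.
  rewrite !setTI; apply/seteqP; split => s /=; rewrite !in_itv/= !andbT;
    by rewrite -lt_contract contract_limit_variable.
exact: measurable_quantile_limit.
Qed.

Lemma uniform_prob_sub (A : set R) : measurable A -> A `<=` `[0, 1]%classic ->
  P A = lebesgue_measure A.
Proof.
move=> mA A01; rewrite /uniform_prob (eq_integral (fun=> 1%:E)).
  by rewrite integral_cst// mul1e.
move=> s /set_mem /A01; rewrite /= in_itv /= /uniform_pdf => ->.
by rewrite subr0 invr1.
Qed.

Lemma uniform_prob_cell n k : (k < n.+1)%N -> P (cell n k) = (n.+1%:R^-1)%:E.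
Proof.
move=> kn; rewrite uniform_prob_sub; first last.
- move=> s /(cell_sub kn); rewrite /= !in_itv /= => /andP[-> /ltW ->].
  by [].
- exact: measurable_cell.
rewrite /cell lebesgue_measure_itv /= lte_fin ltr_pM2r ?invr_gt0 ?ltr0n// ltr_nat.
by rewrite ltnSn -EFinB -mulrBl -natrB// subSnn mul1r.
Qed.

Let PT : (P setT < +oo)%E.
Proof. by rewrite probability_setT ltry. Qed.

Lemma uniform_prob_out : P (~` `[0, 1[%classic) = 0%E.
Proof.
rewrite probability_setC; last exact: measurable_itv.
rewrite [X in (_ - X)%E](_ : _ = 1%E) ?subee//.
rewrite [LHS]uniform_prob_sub; first last.
- by move=> s /=; rewrite !in_itv /= => /andP[-> /ltW ->].
- exact: measurable_itv.
by rewrite lebesgue_measure_itv /= lte_fin ltr01 oppr0 adde0.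
Qed.

Lemma uniform_prob_bad_points : P (bad_points l) = 0%E.
Proof.
have cb := countable_bad_points size_l l01 cvg_pole.
have mb : measurable (bad_points l) by exact: countable_measurable cb.
apply: null_set_integral => //; last exact: countable_lebesgue_measure0.
apply/measurable_EFinP/measurable_funTS; exact: measurable_uniform_pdf.
Qed.

Lemma integral_cell_sum n m (c : nat -> R) : (m <= n.+1)%N ->
  P.-integrable setT (EFin \o (fun s : R => \sum_(k < m) c k * \1_(cell n k) s)) /\
  \int[P]_s (\sum_(k < m) c k * \1_(cell n k) s) = n.+1%:R^-1 * \sum_(k < m) c k.
Proof.
elim: m => [|m ih] mn.
  have -> : (fun s : R => \sum_(k < 0) c k * \1_(cell n k) s) = cst 0.
    by apply/funext => s; rewrite big_ord0.
  split; first exact: finite_measure_integrable_cst.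
  by rewrite big_ord0 mulr0 /Rintegral integral0.
have [ii ie] := ih (ltnW mn).
have i1 : P.-integrable setT (EFin \o (\1_(cell n m) : R -> R)).
  by apply: (@integrable_indic _ _ _ P); exact: measurable_cell.
have i2 : P.-integrable setT (EFin \o (fun s => c m * \1_(cell n m) s)).
  by have := integrableZl measurableT (c m) i1; apply: eq_integrable.
split.
  have := integrableD measurableT ii i2; apply: eq_integrable => // s _ /=.
  by rewrite big_ord_recr.
rewrite (@eq_Rintegral _ _ _ P setT (fun s : R => \sum_(k < m) c k * \1_(cell n k) s +
   c m * \1_(cell n m) s)); last by move=> s _; rewrite big_ord_recr.
have e : \int[P]_s (\1_(cell n m) s : R) = n.+1%:R^-1.
  rewrite /Rintegral integral_indic//; last exact: measurable_cell.
  have -> : cell n m `&` setT = cell n m :> set R by exact: setIT.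
  by have /= -> := uniform_prob_cell mn.
by rewrite RintegralD// ie RintegralZl// e big_ord_recr mulrDr [c m * _]mulrC.
Qed.

Lemma average_quantile n (g : R -> R) :
  average l n.+1 g = \int[P]_s g (q n s).
Proof.
have [ii ie] := integral_cell_sum (fun k => g (sorted_value l n k)) (leqnn n.+1).
have mN : measurable (~` `[0, 1[%classic : set R).
  by apply: measurableC; exact: measurable_itv.
have i0 : P.-integrable setT (EFin \o (\1_(~` `[0, 1[%classic) : R -> R)).
  exact: (@integrable_indic _ _ _ P).
have i1 : P.-integrable setT (EFin \o (fun s => g 0 * \1_(~` `[0, 1[%classic) s)).
  by have := integrableZl measurableT (g 0) i0; apply: eq_integrable.
rewrite (average_sorted size_l) -ie.
rewrite [RHS](@eq_Rintegral _ _ _ P setT (fun s =>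
   \sum_(k < n.+1) g (sorted_value l n k) * \1_(cell n k) s +
   g 0 * \1_(~` `[0, 1[%classic) s)).
  have e : \int[P]_s (\1_(~` `[0, 1[%classic) s : R) = 0.
    rewrite /Rintegral integral_indic// setIT.
    by have /= -> := uniform_prob_out.
  by rewrite RintegralD// [X in _ + X]RintegralZl// e mulr0 addr0.
move=> s _; rewrite /quantile indicE in_setC.
case: (boolP (s \in _)) => [/set_mem s01|/negP s01].
  have s01' : 0 <= s < 1 by move: s01; rewrite /= in_itv.
  by rewrite (cell_sum _ (fun k => g (sorted_value l n k)))// cell_sum// mulr0 addr0.
have s01' : ~ `[0, 1[%classic s by move=> /mem_set.
by rewrite (cell_sum_out _ (fun k => g (sorted_value l n k)))// cell_sum_out// mulr1 add0r.
Qed.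

Let limit_mixin := @isMeasurableFun.Build _ _ (measurableTypeR R) (\bar R) limit_variable
  measurable_limit_variable.
Let limit_rv : {mfun measurableTypeR R >-> \bar R} := HB.pack limit_variable limit_mixin.

(** The limit measure is the law of the limit quantile function at a uniform random
variable; weak convergence is dominated convergence for the composition of a
continuous function with the quantile functions. *)
Theorem weak_limit_exists : exists nu : probability (\bar R) R,
  nu half_line = 1%E /\
  forall f : \bar R -> R, {within half_line, continuous f} ->
    average l ^~ (f \o @expand R) @ \oo --> \int[nu]_(x in half_line) f x.
Proof.
pose nu : probability (\bar R) R := distribution P limit_rv.
have pre : limit_variable @^-1` half_line = setT.
  by apply/seteqP; split => // s _; rewrite /= ; apply: expand_half_line; exact: clamp_itv.
exists nu; split.
  by rewrite /nu /distribution /pushforward /= pre probability_setT.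
move=> f cf; have cg := within_continuous_expand cf.
set g := f \o @expand R in cg *.
have mg : measurable_fun (`[0%R, 1%R]%classic : set R) g.
  by apply: subspace_continuous_measurable_fun.
have [M M0 hM] := bounded_within cg.
have mgq (U : R -> R) : measurable_fun setT U -> (forall s, 0 <= U s <= 1) ->
    measurable_fun setT (g \o U).
  move=> mU U01; apply: (@measurable_comp _ _ _ R R R `[0%R, 1%R]%classic g setT U) => //.
  by move=> _ [s _ <-]; rewrite /= in_itv /= U01.
have E : \int[nu]_(x in half_line) f x = \int[P]_s g (quantile_limit s).
  pose fD := (EFin \o f) \_ half_line.
  have mfD : measurable_fun setT fD.
    apply/(measurable_restrictT _ _).1 => //; first exact: measurable_half_line.
    by apply/measurable_EFinP; exact: measurable_within.
  have e s : fD (limit_variable s) = (g (quantile_limit s))%:E.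
    by rewrite /fD patchE mem_set//; apply: expand_half_line; exact: clamp_itv.
  rewrite /Rintegral; congr fine.
  rewrite (eq_integral fD); last by move=> x xD; rewrite /fD patchE xD.
  rewrite /nu /distribution integral_pushforward//; last 2 first.
  - rewrite pre (_ : _ \o _ = EFin \o (g \o quantile_limit)); last exact/funext.
    apply: (bounded_integrable measurableT PT (M := M)).
      by apply: mgq; [exact: measurable_quantile_limit | move=> s; exact: clamp_itv].
    by move=> s _; apply: hM; exact: clamp_itv.
  - exact: measurable_half_line.
  by rewrite pre; apply: eq_integral => s _; exact: e.
rewrite E -cvg_shiftS /=.
under eq_fun do rewrite average_quantile.
apply: (bounded_convergence (measurableT) PT (M := M)) => [n||n s _|].
- apply: mgq; [exact: measurable_quantile | exact: quantile_itv].
- apply: mgq; [exact: measurable_quantile_limit | by move=> s; exact: clamp_itv].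
- exact: hM (quantile_itv l01 n s).
have mb : measurable (bad_points l).
  by apply: countable_measurable => //; exact: countable_bad_points.
have mN : measurable (~` `[0, 1[%classic : set R).
  by apply: measurableC; exact: measurable_itv.
exists (~` `[0, 1[%classic `|` bad_points l); split.
- exact: measurableU.
- by apply: null_set_setU => //; [exact: uniform_prob_out|exact: uniform_prob_bad_points].
move=> s /= /not_implyP[_ ns]; apply: contrapT => /not_orP[/contrapT s01 nb]; apply: ns.
have s01' : 0 <= s < 1 by move: s01; rewrite /= in_itv.
have cq := quantile_cvg l01 s01' nb.
have L : q ^~ s @ \oo --> quantile_limit s.
  rewrite /quantile_limit cvg_limn_supE// clamp_id//.
  apply/andP; split.
    by apply: limr_ge => //; apply: nearW => n; case/andP: (quantile_itv l01 n s).
  by apply: limr_le => //; apply: nearW => n; case/andP: (quantile_itv l01 n s).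
move/subspace_continuousP : cg => /(_ (quantile_limit s)).
rewrite /= in_itv /= clamp_itv => /(_ isT) cgl.
apply: (@cvg_comp _ _ _ (q ^~ s) g _ _ _ _ cgl) => A.
rewrite /within /= => /L [N _ HN]; exists N => // n /HN /=; apply.
by rewrite in_itv; exact: (quantile_itv l01 n s).
Qed.

End QuantileMeasure.

(** * Ratios of consecutive coefficients *)

Section CoefficientRatio.
Context {R : realType}.
Implicit Types (t c C a b h tau : R).
Variable z : nat -> seq R.
Local Notation p n k := (pos_poly (z n))`_k.
Local Notation k_ a n := (Num.truncn (a * n%:R)).

(** The ratio of the coefficients of index k and k + 1 tends to h, for k = floor(a n).
Multiplicative bounds express this without divisions. *)
Definition has_ratio a h : Prop := forall c, 1 < c -> \forall n \near \oo,
  [/\ 0 < p n (k_ a n), 0 < p n (k_ a n).+1,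
      p n (k_ a n) <= c * h * p n (k_ a n).+1 &
      h / c * p n (k_ a n).+1 <= p n (k_ a n)].

Hypothesis z_ge0 : \forall n \near \oo, {in z n, forall a, 0 <= a}.

Lemma near_linear_lt a b C : a < b -> \forall n \near \oo, a * n%:R + C < b * n%:R.
Proof.
move=> ab; have [N HN] : exists N : nat, C / (b - a) < N%:R.
  by exists (Num.truncn (C / (b - a))).+1; exact: truncnS_gt.
exists N => // n /= Nn; rewrite -ltrBrDl -mulrBl mulrC -ltr_pdivrMr ?subr_gt0//.
by apply: lt_le_trans HN _; rewrite ler_nat.
Qed.

Lemma truncn_mul_le a n : 0 <= a -> (k_ a n)%:R <= a * n%:R.
Proof. by move=> a0; have /andP[] := truncn_itv (mulr_ge0 a0 (ler0n R n)). Qed.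

Lemma truncn_mul_ge a n : 0 <= a -> a * n%:R - 1 <= (k_ a n)%:R.
Proof.
move=> a0; have /andP[_ /ltW] := truncn_itv (mulr_ge0 a0 (ler0n R n)).
by rewrite -natr1 lerBlDr.
Qed.

(** If the ratio at k exceeded c tau, then by [pole_sum_le_mode] the mean at a
parameter slightly above tau would be at most k + O(1), while it is about
n F(t) with F(t) > a. The lower bound is symmetric, and a vanishing
coefficient would make the means at all parameters lie on one side of k. *)
Lemma ratio_of_transform (F : R -> R) a tau : 0 < a -> 0 < tau ->
  (forall t, 0 < t -> (fun n => n%:R^-1 * pole_sum (z n) t) @ \oo --> F t) ->
  (forall t, 0 < t -> t < tau -> F t < a) -> (forall t, tau < t -> a < F t) ->
  has_ratio a tau.
Proof.
move=> a0 tau0 cF Flt Fgt c c1; have c0 : 0 < c by lra.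
have ev_gt t C : tau < t -> \forall n \near \oo, a * n%:R + C < pole_sum (z n) t.
  move=> tt; have := Fgt t tt; set b := F t => ab.
  have t0 : 0 < t by exact: lt_trans tt.
  pose m := (a + b) / 2; have am : a < m by rewrite /m; lra.
  have mb : m < F t by rewrite /m -/b; lra.
  have /cvgr_gt/(_ m mb) hn := cF t t0.
  near=> n; have n0 : 0 < n%:R :> R by rewrite ltr0n; near: n; exact: nbhs_infty_gt.
  apply: (@lt_trans _ _ (m * n%:R)); first by near: n; exact: near_linear_lt.
  by rewrite mulrC -ltr_pdivlMl//; near: n.
have ev_lt t C : 0 < t -> t < tau -> \forall n \near \oo, pole_sum (z n) t + C < a * n%:R.
  move=> t0 tt; have := Flt t t0 tt; set b := F t => ba.
  pose m := (a + b) / 2; have ma : m < a by rewrite /m; lra.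
  have bm : F t < m by rewrite /m -/b; lra.
  have /cvgr_lt/(_ m bm) hn := cF t t0.
  near=> n; have n0 : 0 < n%:R :> R by rewrite ltr0n; near: n; exact: nbhs_infty_gt.
  apply: (@lt_trans _ _ (m * n%:R + C)); last by near: n; exact: near_linear_lt.
  by rewrite ltrD2r mulrC -ltr_pdivrMl//; near: n.
(* 1 < c' < c: part of the factor c is spent on the bounded distance between
   mean and mode, the rest separates the parameter from tau *)
pose c' := (1 + c) / 2; have c'1 : 1 < c' by rewrite /c'; lra.
have c'0 : 0 < c' by lra.
have c'c : c' < c by rewrite /c'; lra.
have up : tau < c * tau / c'.
  by rewrite ltr_pdivlMr// mulrC ltr_pM2r.
have dn : c' * (tau / c) < tau.
  by rewrite mulrCA gtr_pMr// ltr_pdivrMr// mul1r.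
have dn0 : 0 < c' * (tau / c) by rewrite mulr_gt0// divr_gt0.
near=> n.
have zn : {in z n, forall a, 0 <= a} by near: n.
set k := k_ a n.
have kle : k%:R <= a * n%:R by exact: truncn_mul_le (ltW a0).
have kge : a * n%:R - 1 <= k%:R by exact: truncn_mul_ge (ltW a0).
have p_ge0 j : 0 <= p n j by exact: coef_pos_poly_ge0.
have hi : p n k <= c * tau * p n k.+1.
  rewrite leNgt; apply/negP => lt.
  have pk0 : 0 < p n k by apply: le_lt_trans lt; rewrite !mulr_ge0// ltW.
  have := @pole_sum_le_mode _ _ zn k (c * tau) c' (mulr_gt0 c0 tau0) c'1 pk0 (ltW lt).
  suff : a * n%:R + tail_const c' < pole_sum (z n) (c * tau / c') by lra.
  by near: n; exact: ev_gt.
have lo : tau / c * p n k.+1 <= p n k.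
  rewrite leNgt; apply/negP => lt.
  have t0 : 0 < tau / c by rewrite divr_gt0.
  have pk0 : 0 < p n k.+1 by rewrite -(pmulr_rgt0 _ t0); exact: le_lt_trans lt.
  have := @pole_sum_ge_mode _ _ zn k (tau / c) c' t0 c'1 pk0 (ltW lt).
  suff : pole_sum (z n) (c' * (tau / c)) + (1 + tail_const c') < a * n%:R by lra.
  by near: n; exact: ev_lt.
have pk : 0 < p n k.
  rewrite lt_neqAle p_ge0 andbT eq_sym; apply/eqP => pk0.
  have [h|h] := coef_eq0_pole_sum zn pk0.
    have := h _ (lt_trans tau0 up).
    suff : a * n%:R + 0 < pole_sum (z n) (c * tau / c') by lra.
    by near: n; exact: ev_gt.
  have := h _ dn0.
  suff : pole_sum (z n) (c' * (tau / c)) + 1 < a * n%:R by lra.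
  by near: n; exact: ev_lt.
split => //.
have ct0 : 0 < c * tau by rewrite mulr_gt0.
by rewrite -(pmulr_rgt0 _ ct0); exact: lt_le_trans hi.
Unshelve. all: by end_near. Qed.

Lemma transform_gt_of_ratio a h t b : 0 < a -> 0 < h -> has_ratio a h ->
  h < t -> b < a -> \forall n \near \oo, b < n%:R^-1 * pole_sum (z n) t.
Proof.
move=> a0 h0 ra ht ba; have t0 := lt_trans h0 ht.
have r1 : 1 < t / h by rewrite ltr_pdivlMr// mul1r.
pose c := Num.sqrt (t / h).
have c1 : 1 < c by rewrite /c -sqrtr1 ltr_sqrt// (lt_trans ltr01).
have cc : c * (c * h) = t.
  by rewrite mulrA -expr2 sqr_sqrtr ?divfK ?gt_eqF// ltW// (lt_trans ltr01).
have ch : 0 < c * h by rewrite mulr_gt0// (lt_trans ltr01).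
have rc := ra c c1.
near=> n; have n0 : 0 < n%:R :> R by rewrite ltr0n; near: n; exact: nbhs_infty_gt.
have zn : {in z n, forall a, 0 <= a} by near: n.
have [_ pk1 up _] : [/\ 0 < p n (k_ a n), 0 < p n (k_ a n).+1,
      p n (k_ a n) <= c * h * p n (k_ a n).+1 &
      h / c * p n (k_ a n).+1 <= p n (k_ a n)] by near: n.
rewrite ltr_pdivlMl// mulrC.
have := pole_sum_ge_mode zn ch c1 pk1 up; rewrite cc.
have := truncn_mul_ge n (ltW a0).
suff : b * n%:R + (1 + tail_const c) < a * n%:R by lra.
by near: n; exact: near_linear_lt.
Unshelve. all: by end_near. Qed.

Lemma transform_lt_of_ratio a h t b : 0 < a -> 0 < t -> has_ratio a h ->
  t < h -> a < b -> \forall n \near \oo, n%:R^-1 * pole_sum (z n) t < b.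
Proof.
move=> a0 t0 ra th ab; have h0 := lt_trans t0 th.
have r1 : 1 < h / t by rewrite ltr_pdivlMr// mul1r.
pose c := Num.sqrt (h / t).
have c1 : 1 < c by rewrite /c -sqrtr1 ltr_sqrt// (lt_trans ltr01).
have c0 : 0 < c by rewrite (lt_trans ltr01).
have cc : h / c / c = t.
  rewrite -mulrA -invfM -expr2 sqr_sqrtr ?ltW ?(lt_trans ltr01)//.
  by rewrite invf_div mulrC divfK// gt_eqF.
have ch : 0 < h / c by rewrite divr_gt0.
have rc := ra c c1.
near=> n; have n0 : 0 < n%:R :> R by rewrite ltr0n; near: n; exact: nbhs_infty_gt.
have zn : {in z n, forall a, 0 <= a} by near: n.
have [pk _ _ dn] : [/\ 0 < p n (k_ a n), 0 < p n (k_ a n).+1,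
      p n (k_ a n) <= c * h * p n (k_ a n).+1 &
      h / c * p n (k_ a n).+1 <= p n (k_ a n)] by near: n.
rewrite ltr_pdivrMl// mulrC.
have := pole_sum_le_mode zn ch c1 pk dn; rewrite cc.
have := truncn_mul_le n (ltW a0).
suff : a * n%:R + tail_const c < b * n%:R by lra.
by near: n; exact: near_linear_lt.
Unshelve. all: by end_near. Qed.

End CoefficientRatio.

(** * The inverse of the kernel transform *)

Section PoleInverse.
Context {R : realType}.
Variable nu : probability (\bar R) R.
Hypothesis nu1 : nu half_line = 1%E.
Implicit Types (t u a b : R).
Local Notation F := (pole_transform nu).
Local Notation lo := (mass_zero nu).
Local Notation hi := (1 - mass_infty nu).

Lemma mass_zero_ge0 : 0 <= lo.
Proof. exact: fine_ge0. Qed.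

Lemma compl_mass_infty_le1 : hi <= 1.
Proof. by rewrite gerBl; exact: fine_ge0. Qed.

Lemma ler_of_scale x y : 0 <= y -> (forall c : R, 1 < c -> x <= c * y) -> x <= y.
Proof.
move=> y0 h; rewrite leNgt; apply/negP => yx.
have := h 2 (ltr1n _ _); have [y_gt0|] := ltP 0 y; last by lra.
have c1 : 1 < (x + y) / (2 * y) by rewrite ltr_pdivlMr ?mulr_gt0//; lra.
have := h _ c1; rewrite (_ : (x + y) / (2 * y) * y = (x + y) / 2); first by lra.
by field; rewrite gt_eqF.
Qed.

Lemma pole_transform_mono t u : lo < hi -> 0 < t -> t < u -> F t < F u.
Proof.
move=> lh t0 tu; rewrite lt_neqAle le_pole_transform ?(ltW tu)// andbT.
apply/eqP => E; pose a := (lo + hi) / 2.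
have [|s s0 sa] := @pole_transform_lt _ nu nu1 a; first by rewrite /a; lra.
have [|v v0 va] := @pole_transform_gt _ nu nu1 a; first by rewrite /a; lra.
by have := lt_trans sa va; rewrite ltNge (pole_transform_flat nu1 s0 v0 t0 tu E).
Qed.

(** The candidate is the supremum tau of the parameters with F < a. The bounds
F(c t) <= c F(t) for c > 1 replace continuity in showing F(tau) = a. *)
Lemma pole_transform_onto a : lo < a < hi -> exists t, 0 < t /\ F t = a.
Proof.
move=> /andP[la ah]; have lh : lo < hi by exact: lt_trans ah.
have a0 : 0 < a by exact: le_lt_trans mass_zero_ge0 la.
have [t0 t00 t0a] := pole_transform_lt nu1 la.
have [t1 t10 t1a] := pole_transform_gt nu1 ah.
pose S := [set t | 0 < t /\ F t < a].
have hS : has_sup S.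
  split; first by exists t0.
  exists t1 => t [t_gt0 ta]; rewrite leNgt; apply/negP => /ltW.
  by move=> /(le_pole_transform nu1 t10); lra.
pose tau := sup S; have tau0 : 0 < tau.
  by apply: (lt_le_trans t00); apply: (ub_le_sup hS.2); split.
have below t : 0 < t -> t < tau -> F t < a.
  move=> t_gt0 /(sup_gt hS.1)[s [s0 sa] ts].
  by apply: le_lt_trans (le_pole_transform nu1 t_gt0 (ltW ts)) sa.
have above t : tau < t -> a <= F t.
  move=> tt; rewrite leNgt; apply/negP => ta.
  have : S t by split => //; exact: lt_trans tt.
  by move=> /(ub_le_sup hS.2); rewrite leNgt tt.
exists tau; split => //; apply/eqP; rewrite eq_le; apply/andP; split.
  apply: ler_of_scale (ltW a0) _ => c c1; have c0 : 0 < c by lra.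
  have tc0 : 0 < tau / c by rewrite divr_gt0.
  have tc : tau / c < tau by rewrite ltr_pdivrMr// ltr_pMr.
  have := pole_transform_scale_le nu1 tc0 (ltW c1).
  rewrite mulrC divfK ?gt_eqF// => /le_trans; apply.
  by rewrite ler_pM2l// ltW// below.
apply: ler_of_scale.
  by case/andP: (pole_transform_itv nu1 tau0).
move=> c c1; apply: le_trans (above (c * tau) _) _; first by rewrite ltr_pMl.
exact: pole_transform_scale_le (ltW c1).
Qed.

(** Any value does outside the gap. *)
Definition pole_inverse a : R := xget 1 [set t | 0 < t /\ F t = a].

Lemma pole_inverseP a : lo < a < hi -> 0 < pole_inverse a /\ F (pole_inverse a) = a.
Proof. by move=> /pole_transform_onto[t tP]; rewrite /pole_inverse; case: xgetP => [y _|/(_ t)]. Qed.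

Lemma pole_inverse_mono a b : lo < a < hi -> lo < b < hi -> a < b ->
  pole_inverse a < pole_inverse b.
Proof.
move=> aI bI; apply: contraTT; rewrite -!leNgt => h.
have [a0 <-] := pole_inverseP aI; have [b0 <-] := pole_inverseP bI.
exact: le_pole_transform.
Qed.

(** This is [pole_transform_logit] for the dilation that carries one inverse to the
other. *)
Lemma pole_inverse_odds a b : lo < a < hi -> lo < b < hi -> a <= b ->
  pole_inverse a * ((1 - a) / a) <= pole_inverse b * ((1 - b) / b).
Proof.
move=> aI bI; rewrite le_eqVlt => /predU1P[->//|ab].
have tab := pole_inverse_mono aI bI ab.
have [ta Fa] := pole_inverseP aI; have [tb Fb] := pole_inverseP bI.
have a0 : 0 < a by case/andP: aI => la _; exact: le_lt_trans mass_zero_ge0 la.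
have b0 : 0 < b by exact: lt_trans ab.
have c1 : 1 <= pole_inverse b / pole_inverse a by rewrite ler_pdivlMr// mul1r ltW.
have := pole_transform_logit nu1 ta c1.
rewrite divfK ?gt_eqF// Fa Fb => h.
have {}h : b * (1 - a) * pole_inverse a <= pole_inverse b * a * (1 - b).
  rewrite -ler_pdivlMr//; apply: le_trans h _.
  by rewrite le_eqVlt; apply/orP; left; apply/eqP; ring.
rewrite !mulrA ler_pdivrMr// mulrAC ler_pdivlMr//.
by apply: le_trans (le_trans h _); rewrite le_eqVlt; apply/orP; left; apply/eqP; ring.
Qed.

(** F(T) is below the upper end of the gap, since F is strictly increasing and bounded
by it. *)
Lemma pole_inverse_large a0 T : lo < a0 < hi -> 0 < T ->
  exists2 a, a0 < a < hi & forall b, a < b < hi -> T < pole_inverse b.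
Proof.
move=> aI T0; have /andP[la ah] := aI; have lh : lo < hi by exact: lt_trans ah.
have FT : F T < hi.
  apply: lt_le_trans (_ : F (T + 1) <= _).
    by apply: pole_transform_mono => //; rewrite ltrDl.
  by apply: pole_transform_le => //; rewrite addr_gt0.
have lF : lo <= F T by exact: pole_transform_ge.
pose m := Num.max a0 (F T).
have mh : m < hi by rewrite /m gt_max ah FT.
have a0m : a0 <= m by rewrite /m le_max lexx.
have Fm : F T <= m by rewrite /m le_max lexx orbT.
exists ((m + hi) / 2); first by apply/andP; split; lra.
move=> b /andP[b1 b2]; have bI : lo < b < hi by apply/andP; split; lra.
have [tb Fb] := pole_inverseP bI.
by rewrite ltNge; apply/negP => /(le_pole_transform nu1 tb); lra.
Qed.

Lemma pole_inverse_small a0 T : lo < a0 < hi -> 0 < T ->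
  exists2 a, lo < a < a0 & forall b, lo < b < a -> pole_inverse b < T.
Proof.
move=> aI T0; have /andP[la ah] := aI; have lh : lo < hi by exact: lt_trans ah.
have FT : lo < F T.
  apply: le_lt_trans (_ : F (T / 2) < _).
    by apply: pole_transform_ge => //; rewrite divr_gt0.
  by apply: pole_transform_mono => //; lra.
have Fh : F T <= hi by exact: pole_transform_le.
pose m := Num.min a0 (F T).
have lm : lo < m by rewrite /m lt_min la FT.
have ma0 : m <= a0 by rewrite /m ge_min lexx.
have mF : m <= F T by rewrite /m ge_min lexx orbT.
exists ((m + lo) / 2); first by apply/andP; split; lra.
move=> b /andP[b1 b2]; have bI : lo < b < hi by apply/andP; split; lra.
have [tb Fb] := pole_inverseP bI.
by rewrite ltNge; apply/negP => /(le_pole_transform nu1 T0); lra.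
Qed.

End PoleInverse.

(** * The limiting ratio function of the convolution *)

Section InverseProduct.
Context {R : realType}.
Implicit Types (nu : probability (\bar R) R) (a b t : R).

(** The open interval of values of the transform of nu. *)
Definition in_gap nu a : bool := mass_zero nu < a < 1 - mass_infty nu.

(** The inverse of the transform of the convolution. *)
Definition inverse_product nu1 nu2 a : R :=
  pole_inverse nu1 a * pole_inverse nu2 a * ((1 - a) / a).

Lemma inverse_productC nu1 nu2 a : inverse_product nu1 nu2 a = inverse_product nu2 nu1 a.
Proof. by rewrite /inverse_product (mulrC (pole_inverse nu1 a)). Qed.

Lemma in_gap_lt nu a : in_gap nu a -> 0 < a < 1.
Proof.
move=> /andP[h1 h2]; rewrite (le_lt_trans (mass_zero_ge0 nu) h1)/=.
exact: lt_le_trans h2 (compl_mass_infty_le1 nu).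
Qed.

Lemma odds_gt0 nu a : in_gap nu a -> 0 < (1 - a) / a.
Proof. by move=> /in_gap_lt/andP[a0 a1]; rewrite divr_gt0// subr_gt0. Qed.

Variables nu1 nu2 : probability (\bar R) R.
Hypotheses (nu1P : nu1 half_line = 1%E) (nu2P : nu2 half_line = 1%E).
Local Notation h := (inverse_product nu1 nu2).

Lemma inverse_product_gt0 a : in_gap nu1 a -> in_gap nu2 a -> 0 < h a.
Proof.
move=> a1 a2; have [t1 _] := pole_inverseP nu1P a1; have [t2 _] := pole_inverseP nu2P a2.
by rewrite /inverse_product mulr_gt0 ?(odds_gt0 a1)// mulr_gt0.
Qed.

Lemma inverse_product_mono a b : in_gap nu1 a -> in_gap nu2 a -> in_gap nu1 b ->
  in_gap nu2 b -> a < b -> h a < h b.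
Proof.
move=> a1 a2 b1 b2 ab.
have [ta1 _] := pole_inverseP nu1P a1; have [ta2 _] := pole_inverseP nu2P a2.
have [tb1 _] := pole_inverseP nu1P b1.
have m := pole_inverse_mono nu1P a1 b1 ab.
have w := pole_inverse_odds nu2P a2 b2 (ltW ab).
rewrite /inverse_product -!mulrA.
apply: (@lt_le_trans _ _ (pole_inverse nu1 b * (pole_inverse nu2 a * ((1 - a) / a)))).
  by rewrite ltr_pM2r// mulr_gt0// (odds_gt0 a1).
by rewrite ler_wpM2l// ltW.
Qed.

(** Near the upper end of the common gap, the measure whose gap ends first has an inverse
tending to +oo, while the remaining factor, being nondecreasing, stays away from
0. The case distinction on which gap ends first is made in
[inverse_product_large]. *)
Lemma inverse_product_large_sym a0 t : 1 - mass_infty nu1 <= 1 - mass_infty nu2 ->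
  in_gap nu1 a0 -> in_gap nu2 a0 -> 0 < t ->
  exists a, [/\ in_gap nu1 a, in_gap nu2 a & t < h a].
Proof.
move=> hh a1 a2 t0; have [ta2 _] := pole_inverseP nu2P a2.
set w := pole_inverse nu2 a0 * ((1 - a0) / a0).
have w0 : 0 < w by rewrite mulr_gt0// (odds_gt0 a1).
have [a aI aT] := pole_inverse_large nu1P a1 (divr_gt0 t0 w0).
have := aI; have := a1; have := a2; rewrite /in_gap => /andP[l2 h2] /andP[l1 h1] /andP[ia ih].
pose b := (a + (1 - mass_infty nu1)) / 2.
have ab : a < b < 1 - mass_infty nu1 by rewrite /b; apply/andP; split; lra.
have /andP[ab1 ab2] := ab.
have b1 : in_gap nu1 b by rewrite /in_gap; apply/andP; split; lra.
have b2 : in_gap nu2 b by rewrite /in_gap; apply/andP; split; lra.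
exists b; split => //; have [tb1 _] := pole_inverseP nu1P b1.
have a0b : a0 <= b by lra.
rewrite /inverse_product -mulrA; apply: (@lt_le_trans _ _ (pole_inverse nu1 b * w)).
  by rewrite -ltr_pdivrMr// aT.
by rewrite ler_wpM2l ?(ltW tb1)//; exact: pole_inverse_odds.
Qed.

Lemma inverse_product_small_sym a0 t : mass_zero nu2 <= mass_zero nu1 ->
  in_gap nu1 a0 -> in_gap nu2 a0 -> 0 < t ->
  exists a, [/\ in_gap nu1 a, in_gap nu2 a & h a < t].
Proof.
move=> hh a1 a2 t0; have [ta2 _] := pole_inverseP nu2P a2.
set w := pole_inverse nu2 a0 * ((1 - a0) / a0).
have w0 : 0 < w by rewrite mulr_gt0// (odds_gt0 a1).
have [a aI aT] := pole_inverse_small nu1P a1 (divr_gt0 t0 w0).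
have := aI; have := a1; have := a2; rewrite /in_gap => /andP[l2 h2] /andP[l1 h1] /andP[ia ih].
pose b := (a + mass_zero nu1) / 2.
have ab : mass_zero nu1 < b < a by rewrite /b; apply/andP; split; lra.
have /andP[ab1 ab2] := ab.
have b1 : in_gap nu1 b by rewrite /in_gap; apply/andP; split; lra.
have b2 : in_gap nu2 b by rewrite /in_gap; apply/andP; split; lra.
exists b; split => //; have [tb1 _] := pole_inverseP nu1P b1.
have a0b : b <= a0 by lra.
rewrite /inverse_product -mulrA; apply: (@le_lt_trans _ _ (pole_inverse nu1 b * w)).
  by rewrite ler_wpM2l ?(ltW tb1)//; exact: pole_inverse_odds.
by rewrite -ltr_pdivlMr// aT.
Qed.

End InverseProduct.

Section ProductRatio.
Context {R : realType}.
Variables nu1 nu2 : probability (\bar R) R.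
Hypotheses (nu1P : nu1 half_line = 1%E) (nu2P : nu2 half_line = 1%E).
Implicit Types (a b t : R).
Local Notation h := (inverse_product nu1 nu2).

Lemma inverse_product_large a0 t : in_gap nu1 a0 -> in_gap nu2 a0 -> 0 < t ->
  exists a, [/\ in_gap nu1 a, in_gap nu2 a & t < h a].
Proof.
move=> a1 a2 t0.
have [hh|/ltW hh] := leP (1 - mass_infty nu1) (1 - mass_infty nu2).
  exact: (inverse_product_large_sym nu1P nu2P hh a1 a2 t0).
have [a [i1 i2]] := inverse_product_large_sym nu2P nu1P hh a2 a1 t0.
by rewrite inverse_productC; exists a.
Qed.

Lemma inverse_product_small a0 t : in_gap nu1 a0 -> in_gap nu2 a0 -> 0 < t ->
  exists a, [/\ in_gap nu1 a, in_gap nu2 a & h a < t].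
Proof.
move=> a1 a2 t0.
have [hh|/ltW hh] := leP (mass_zero nu2) (mass_zero nu1).
  exact: (inverse_product_small_sym nu1P nu2P hh a1 a2 t0).
have [a [i1 i2]] := inverse_product_small_sym nu2P nu1P hh a2 a1 t0.
by rewrite inverse_productC; exists a.
Qed.

Lemma in_gap_between nu a b c : in_gap nu a -> in_gap nu c -> a <= b -> b <= c ->
  in_gap nu b :> bool.
Proof.
move=> /andP[a1 a2] /andP[c1 c2] ab bc; rewrite /in_gap (lt_le_trans a1 ab)/=.
exact: le_lt_trans bc c2.
Qed.

Variable z : nat -> seq R.
Hypothesis z_ge0 : \forall n \near \oo, {in z n, forall a, 0 <= a}.
Variable a0 : R.
Hypotheses (a01 : in_gap nu1 a0) (a02 : in_gap nu2 a0).
Hypothesis ratio_z : forall a, in_gap nu1 a -> in_gap nu2 a -> has_ratio z a (h a).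
Local Notation F n t := (n%:R^-1 * pole_sum (z n) t).

Let F_gt a t b : in_gap nu1 a -> in_gap nu2 a -> h a < t -> b < a ->
  \forall n \near \oo, b < F n t.
Proof.
move=> a1 a2; have /andP[a_gt0 _] := in_gap_lt a1.
apply: transform_gt_of_ratio => //; first exact: inverse_product_gt0.
exact: ratio_z.
Qed.

Let F_lt a t b : in_gap nu1 a -> in_gap nu2 a -> 0 < t -> t < h a -> a < b ->
  \forall n \near \oo, F n t < b.
Proof.
move=> a1 a2 t0; have /andP[a_gt0 _] := in_gap_lt a1.
by apply: transform_lt_of_ratio => //; exact: ratio_z.
Qed.

Lemma transform_cvg_at_inverse_product a : in_gap nu1 a -> in_gap nu2 a ->
  (fun n => F n (h a)) @ \oo --> a.
Proof.
move=> a1 a2; have ha := inverse_product_gt0 nu1P nu2P a1 a2.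
have [b [b1 b2 hb]] := inverse_product_small a1 a2 ha.
have [c [c1 c2 hc]] := inverse_product_large a1 a2 ha.
have ba : b < a.
  rewrite ltNge; apply/negP; rewrite le_eqVlt => /predU1P[e|ab].
    by move: hb; rewrite e ltxx.
  by have := inverse_product_mono nu1P nu2P a1 a2 b1 b2 ab; rewrite ltNge (ltW hb).
have ac : a < c.
  rewrite ltNge; apply/negP; rewrite le_eqVlt => /predU1P[e|ca].
    by move: hc; rewrite e ltxx.
  by have := inverse_product_mono nu1P nu2P c1 c2 a1 a2 ca; rewrite ltNge (ltW hc).
apply/cvgrPdist_lt => e e0.
pose b' := Num.max b (a - e / 2); pose c' := Num.min c (a + e / 2).
have bb' : b <= b' by rewrite /b' le_max lexx.
have b'a : b' < a by rewrite /b' gt_max ba/=; lra.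
have b'e : a - e < b' by rewrite /b' lt_max; apply/orP; right; lra.
have cc' : c' <= c by rewrite /c' ge_min lexx.
have ac' : a < c' by rewrite /c' lt_min ac/=; lra.
have c'e : c' < a + e by rewrite /c' gt_min; apply/orP; right; lra.
have b'1 := in_gap_between b1 a1 bb' (ltW b'a).
have b'2 := in_gap_between b2 a2 bb' (ltW b'a).
have c'1 := in_gap_between a1 c1 (ltW ac') cc'.
have c'2 := in_gap_between a2 c2 (ltW ac') cc'.
have hb' := inverse_product_mono nu1P nu2P b'1 b'2 a1 a2 b'a.
have hc' := inverse_product_mono nu1P nu2P a1 a2 c'1 c'2 ac'.
have H1 := F_gt b'1 b'2 hb' b'e; have H2 := F_lt c'1 c'2 ha hc' c'e.
apply: filterS2 H1 H2 => n h1 h2; rewrite ltr_distlC.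
by apply/andP; split.
Qed.

(** The limit at t is the supremum of the points a of the common gap with h(a) < t; at
such points F_n(t) is eventually above any b < a, and at points with h(a) > t
it is eventually below any b > a. *)
Lemma transform_is_cvg t : 0 < t -> cvgn (fun n => F n t).
Proof.
move=> t0.
have [b [b1 b2 hb]] := inverse_product_small a01 a02 t0.
have [c [c1 c2 hc]] := inverse_product_large a01 a02 t0.
pose S := [set a | [/\ in_gap nu1 a, in_gap nu2 a & h a < t]].
have ub_gap a : in_gap nu1 a -> in_gap nu2 a -> t <= h a -> ubound S a.
  move=> a1 a2 ta x [x1 x2 xt]; rewrite leNgt; apply/negP => ax.
  by have := inverse_product_mono nu1P nu2P a1 a2 x1 x2 ax; lra.
have hS : has_sup S by split; [exists b | exists c; apply: ub_gap => //; exact: ltW].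
have bS : b <= sup S by apply: (ub_le_sup hS.2); split.
have Sc : sup S <= c by apply: ge_sup hS.1 _; apply: ub_gap => //; exact: ltW.
have S1 : in_gap nu1 (sup S) by exact: in_gap_between bS Sc.
have S2 : in_gap nu2 (sup S) by exact: in_gap_between bS Sc.
apply/cvg_ex; exists (sup S); apply/cvgrPdist_lt => e e0.
have [a [a1 a2 at_] aS] := sup_adherent e0 hS.
have H1 := F_gt a1 a2 at_ aS.
(* two points d < d' of the common gap, above the supremum by less than e *)
pose m := Num.min (Num.min (1 - mass_infty nu1) (1 - mass_infty nu2)) (sup S + e).
have /andP[s11 s12] := S1; have /andP[s21 s22] := S2.
have m1 : m <= 1 - mass_infty nu1 by rewrite /m !ge_min lexx.
have m2 : m <= 1 - mass_infty nu2 by rewrite /m !ge_min lexx orbT.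
have m3 : m <= sup S + e by rewrite /m ge_min lexx orbT.
have m4 : sup S < m by rewrite /m !lt_min s12 s22 ltrDl.
have gap x : sup S < x -> x < m -> in_gap nu1 x /\ in_gap nu2 x.
  by move=> h1 h2; rewrite /in_gap; split; apply/andP; split; lra.
pose d := (sup S + m) / 2; pose d' := (d + m) / 2.
have Sd : sup S < d by rewrite /d; lra.
have dd' : d < d' by rewrite /d' /d; lra.
have d'm : d' < m by rewrite /d' /d; lra.
have [d1 d2] := gap d Sd (lt_trans dd' d'm).
have [d'1 d'2] := gap d' (lt_trans Sd dd') d'm.
have td : t <= h d.
  rewrite leNgt; apply/negP => hd.
  have : S d by split.
  by move=> /(ub_le_sup hS.2); rewrite leNgt Sd.
have td' := le_lt_trans td (inverse_product_mono nu1P nu2P d1 d2 d'1 d'2 dd').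
have H2 := F_lt d'1 d'2 t0 td' (lt_le_trans d'm m3).
apply: filterS2 H1 H2 => n h1 h2; rewrite ltr_distlC.
by apply/andP; split.
Qed.

End ProductRatio.

(** * The ratios of a finite free convolution *)

Section EmpiricalTransform.
Context {R : realType}.
Variables (Q : nat -> {poly R}) (nu : probability (\bar R) R).
Hypothesis hQ : forall n, (0 < n)%N ->
  [/\ Q n != 0, (size (Q n) <= n.+1)%N & nonneg_rooted (Q n)].
Hypothesis nuP : nu half_line = 1%E.
Hypothesis cvgQ : weak_cvg (fun n => empirical_zeros n (Q n)) nu.

Lemma near_real_zeros_ge0 :
  \forall n \near \oo, {in real_zeros (Q n), forall a, 0 <= a}.
Proof.
exists 1%N => // n /= n0; have [Q0 _ nQ] := hQ n0.
by have [_] := nonneg_rooted_factor Q0 nQ.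
Qed.

Lemma empirical_transform_cvg t : 0 < t ->
  (fun n => n%:R^-1 * pole_sum (real_zeros (Q n)) t) @ \oo --> pole_transform nu t.
Proof.
move=> t0; have cf := within_continuous_contract (within_continuous_pole t0).
have fi := integrable_fin_num (@measurable_half_line R) (integrable_pole nuP t0).
have := cvgQ cf; rewrite -(fineK fi).
move=> /fine_cvg; apply: cvg_trans; apply: near_eq_cvg.
apply: filterS near_real_zeros_ge0 => n z0 /=.
rewrite integral_empirical_expand//=; last exact: measurable_within.
rewrite -(sum_pole_contracted_zeros n z0 t0); congr (_ * _).
rewrite big_seq [RHS]big_seq; apply: eq_bigr => v vz /=.
by rewrite expand_contract_itv// (contracted_zeros_itv z0 vz).
Qed.

Lemma empirical_has_ratio a : in_gap nu a ->
  has_ratio (fun n => real_zeros (Q n)) a (pole_inverse nu a).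
Proof.
move=> aI; have [tau0 Ftau] := pole_inverseP nuP aI.
have /andP[a0 _] := in_gap_lt aI; have lh : mass_zero nu < 1 - mass_infty nu.
  by case/andP: aI; exact: lt_trans.
apply: (ratio_of_transform near_real_zeros_ge0 a0 tau0 empirical_transform_cvg) => t.
  by move=> t0 tt; rewrite -[ltRHS]Ftau pole_transform_mono.
by move=> tt; rewrite -[ltLHS]Ftau pole_transform_mono.
Qed.

End EmpiricalTransform.

Section ConvolutionRatio.
Context {R : realType}.
Variables Q1 Q2 : nat -> {poly R}.
Hypothesis hQ1 : forall n, (0 < n)%N ->
  [/\ Q1 n != 0, (size (Q1 n) <= n.+1)%N & nonneg_rooted (Q1 n)].
Hypothesis hQ2 : forall n, (0 < n)%N ->
  [/\ Q2 n != 0, (size (Q2 n) <= n.+1)%N & nonneg_rooted (Q2 n)].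
Implicit Types (a tau c : R).
Local Notation Qc n := (finite_free_mul n (Q1 n) (Q2 n)).
Local Notation z1 := (fun n => real_zeros (Q1 n)).
Local Notation z2 := (fun n => real_zeros (Q2 n)).
Local Notation zc := (fun n => real_zeros (finite_free_mul n (Q1 n) (Q2 n))).

Lemma norm_coef_finite_free_mul n k : (0 < n)%N -> (k <= n)%N ->
  `|(Qc n)`_k| = `|lead_coef (Q1 n)| * `|lead_coef (Q2 n)| *
    ((pos_poly (z1 n))`_k * (pos_poly (z2 n))`_k / 'C(n, k)%:R).
Proof.
move=> n0 kn; have [Q10 _ nQ1] := hQ1 n0; have [Q20 _ nQ2] := hQ2 n0.
rewrite coef_poly ltnS kn !normrM normrX normrN1 expr1n mul1r.
rewrite (norm_coef_nonneg_rooted k Q10 nQ1) (norm_coef_nonneg_rooted k Q20 nQ2).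
by rewrite normfV normr_nat; ring.
Qed.

Lemma truncn_mul_lt a n : 0 <= a -> a < 1 -> (0 < n)%N -> (Num.truncn (a * n%:R) < n)%N.
Proof.
move=> a0 a1 n0; rewrite -(ltr_nat R); apply: le_lt_trans (truncn_mul_le n a0) _.
by rewrite gtr_pMl// ltr0n.
Qed.

Lemma near_finite_free_mul_good a tau1 tau2 : 0 < a < 1 ->
  has_ratio z1 a tau1 -> has_ratio z2 a tau2 ->
  \forall n \near \oo, Qc n != 0 /\ nonneg_rooted (Qc n).
Proof.
move=> /andP[a0 a1] r1 r2; have h1 := r1 2 (ltr1n _ _); have h2 := r2 2 (ltr1n _ _).
have h3 := nbhs_infty_gt 0; apply: filterS3 h1 h2 h3 => n [p1 _ _ _] [p2 _ _ _] n0.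
have kn := ltnW (truncn_mul_lt (ltW a0) a1 n0).
have [Q10 s1 nQ1] := hQ1 n0; have [Q20 s2 nQ2] := hQ2 n0.
have Qc0 : Qc n != 0.
  apply/eqP => Q0; have := norm_coef_finite_free_mul n0 kn.
  rewrite Q0 coef0 normr0 => /esym/eqP; apply/negP.
  by rewrite gt_eqF// !mulr_gt0// ?normr_gt0 ?lead_coef_eq0// invr_gt0 ltr0n bin_gt0.
by split => //; exact: nonneg_rooted_finite_free_mul.
Qed.

Lemma near_binomial_ratio a c : 0 < a < 1 -> 1 < c -> \forall n \near \oo,
  let k := Num.truncn (a * n%:R) in
  ((1 - a) / a / c * k.+1%:R <= (n - k)%:R) /\ ((n - k)%:R <= c * ((1 - a) / a) * k.+1%:R).
Proof.
move=> /andP[a0 a1] c1; have c0 : 0 < c by lra.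
have b0 : 0 < 1 - a by rewrite subr_gt0.
have lt1 : (1 - a) / c < 1 - a by rewrite ltr_pdivrMr// ltr_pMr.
have lt2 : 1 - a < c * (1 - a) by rewrite ltr_pMl.
have h1 := near_linear_lt ((1 - a) / a / c) lt1; have h2 := near_linear_lt 1 lt2.
apply: filterS3 h1 h2 (nbhs_infty_gt 0) => n {}h1 {}h2 n0.
set k := Num.truncn _.
have kn : (k <= n)%N := ltnW (truncn_mul_lt (ltW a0) a1 n0).
have kle : k%:R <= a * n%:R := truncn_mul_le n (ltW a0).
have kge := truncn_mul_ge n (ltW a0); rewrite -/k in kge.
rewrite natrB// -natr1; split.
  apply: (@le_trans _ _ ((1 - a) / a / c * (a * n%:R + 1))).
    by rewrite ler_wpM2l ?lerD2r// !divr_ge0 ?ltW.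
  rewrite (_ : _ * (_ + 1) = (1 - a) / c * n%:R + (1 - a) / a / c); first by lra.
  by field; rewrite (gt_eqF a0) (gt_eqF c0).
apply: (@le_trans _ _ (c * ((1 - a) / a) * (a * n%:R))); last first.
  by rewrite ler_wpM2l; [|rewrite mulr_ge0 ?divr_ge0// ltW|lra].
rewrite (_ : _ * (a * _) = c * (1 - a) * n%:R); first by lra.
by field; rewrite gt_eqF.
Qed.

(** The ratio of the convolution is the product of the two given ratios and of
binomial(n, k+1) / binomial(n, k) = (n - k) / (k + 1), which tends to
(1 - a) / a. *)
Lemma convolution_has_ratio a tau1 tau2 : 0 < a < 1 -> 0 < tau1 -> 0 < tau2 ->
  has_ratio z1 a tau1 -> has_ratio z2 a tau2 ->
  has_ratio zc a (tau1 * tau2 * ((1 - a) / a)).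
Proof.
move=> a01 t1 t2 r1 r2 c c1; have /andP[a0 a1] := a01.
(* a factor d = 1 + e with d^3 <= c for each of the three ratios *)
pose e := Num.min 1 ((c - 1) / 7); have e0 : 0 < e by rewrite /e lt_min; apply/andP; split; lra.
have e1 : e <= 1 by rewrite /e ge_min lexx.
have e7 : e <= (c - 1) / 7 by rewrite /e ge_min lexx orbT.
pose d := 1 + e; have d1 : 1 < d by rewrite ltrDl.
have d0 : 0 < d by lra.
have dc : d * d * d <= c by rewrite /d; nra.
have c0 : 0 < c by lra.
have h1 := r1 d d1; have h2 := r2 d d1; have h3 := near_binomial_ratio a01 d1.
have h4 := near_finite_free_mul_good a01 r1 r2.
have [N1 _ H1] := filterI h1 h2; have [N2 _ H2] := filterI h3 h4.
exists (maxn 1 (maxn N1 N2)) => // n /=; rewrite !geq_max => /and3P[n0 n1 n2].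
have [[p1 p1' u1 l1] [p2 p2' u2 l2]] := H1 n n1.
have [[lb ub] [Qc0 nQc]] := H2 n n2.
set k := Num.truncn _ in p1 p1' u1 l1 p2 p2' u2 l2 lb ub *.
have kn : (k < n)%N := truncn_mul_lt (ltW a0) a1 n0.
have [Q10 _ nQ1] := hQ1 n0; have [Q20 _ nQ2] := hQ2 n0.
set x1 := (pos_poly _)`_k in p1 u1 l1; set y1 := (pos_poly _)`_k.+1 in p1' u1 l1.
set x2 := (pos_poly _)`_k in p2 u2 l2; set y2 := (pos_poly _)`_k.+1 in p2' u2 l2.
pose K := `|lead_coef (Qc n)|; have K0 : 0 < K by rewrite normr_gt0 lead_coef_eq0.
pose L := `|lead_coef (Q1 n)| * `|lead_coef (Q2 n)|.
have L0 : 0 < L by rewrite mulr_gt0// normr_gt0 lead_coef_eq0.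
have E1 : K * (pos_poly (zc n))`_k = L * (x1 * x2 / 'C(n, k)%:R).
  by rewrite -norm_coef_nonneg_rooted// norm_coef_finite_free_mul// ltnW.
have E2 : K * (pos_poly (zc n))`_k.+1 = L * (y1 * y2 / 'C(n, k.+1)%:R).
  by rewrite -norm_coef_nonneg_rooted// norm_coef_finite_free_mul.
have B0 : 0 < 'C(n, k)%:R :> R by rewrite ltr0n bin_gt0 ltnW.
have B1 : 0 < 'C(n, k.+1)%:R :> R by rewrite ltr0n bin_gt0.
have BE : k.+1%:R * 'C(n, k.+1)%:R = (n - k)%:R * 'C(n, k)%:R :> R.
  by rewrite -!natrM mul_bin_left.
have k0 : 0 < k.+1%:R :> R by rewrite ltr0n.
move: E1 E2; set X := (pos_poly _)`_k; set Y := (pos_poly _)`_k.+1 => E1 E2.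
set w := (1 - a) / a in lb ub *.
have w0 : 0 < w by rewrite divr_gt0// subr_gt0.
have X0 : 0 < X.
  rewrite -(pmulr_rgt0 _ K0) E1; apply: (mulr_gt0 L0).
  by apply: mulr_gt0; [exact: mulr_gt0 | rewrite invr_gt0].
have Y0 : 0 < Y.
  rewrite -(pmulr_rgt0 _ K0) E2; apply: (mulr_gt0 L0).
  by apply: mulr_gt0; [exact: mulr_gt0 | rewrite invr_gt0].
have iB : 'C(n, k)%:R^-1 = (n - k)%:R / k.+1%:R * 'C(n, k.+1)%:R^-1 :> R.
  move: BE; move: ('C(n, k)%:R : R) ('C(n, k.+1)%:R : R) (k.+1%:R : R) ((n - k)%:R : R) B0 B1 k0.
  move=> b b' s m b0 b'0 s0 E; apply: (mulfI (lt0r_neq0 b0)); rewrite divff ?gt_eqF//.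
  have -> : b * (m / s * b'^-1) = m * b / s / b' by ring.
  by rewrite -E; field; rewrite (gt_eqF s0) (gt_eqF b'0).
have ub' : 'C(n, k)%:R^-1 <= d * w * 'C(n, k.+1)%:R^-1 :> R.
  rewrite iB; apply: ler_wpM2r; first by rewrite invr_ge0 ltW.
  by rewrite ler_pdivrMr.
have lb' : w / d * 'C(n, k.+1)%:R^-1 <= 'C(n, k)%:R^-1 :> R.
  rewrite iB; apply: ler_wpM2r; first by rewrite invr_ge0 ltW.
  by rewrite ler_pdivlMr.
have M0 : 0 < tau1 * tau2 * w * (y1 * y2 / 'C(n, k.+1)%:R).
  apply: mulr_gt0; first exact: mulr_gt0 (mulr_gt0 t1 t2) w0.
  by apply: mulr_gt0; [exact: mulr_gt0 | rewrite invr_gt0].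
split => //.
- rewrite -(ler_pM2l K0) E1 [leRHS]mulrCA E2 [leRHS]mulrCA ler_pM2l//.
  apply: (@le_trans _ _ ((d * tau1 * y1) * (d * tau2 * y2) * (d * w * 'C(n, k.+1)%:R^-1))).
    by rewrite ler_pM ?mulr_ge0 ?invr_ge0 ?(ltW B0) ?(ltW p1) ?(ltW p2)// ler_pM// ltW.
  rewrite (_ : _ * _ = (d * d * d) * (tau1 * tau2 * w * (y1 * y2 / 'C(n, k.+1)%:R))); last by ring.
  rewrite -(mulrA c); apply: ler_wpM2r => //.
  exact: ltW M0.
- rewrite -(ler_pM2l K0) E1 [leLHS]mulrCA E2 [leLHS]mulrCA ler_pM2l//.
  apply: (@le_trans _ _ ((tau1 / d * y1) * (tau2 / d * y2) * (w / d * 'C(n, k.+1)%:R^-1))).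
    rewrite (_ : _ * (w / d * _) =
        (d * d * d)^-1 * (tau1 * tau2 * w * (y1 * y2 / 'C(n, k.+1)%:R))); last first.
      by field; rewrite (gt_eqF B1) (gt_eqF d0).
    rewrite [leLHS](_ : _ = c^-1 * (tau1 * tau2 * w * (y1 * y2 / 'C(n, k.+1)%:R))); last by ring.
    by rewrite ler_pM2r// lef_pV2 ?posrE// !mulr_gt0.
  have P1 := mulr_gt0 (divr_gt0 t1 d0) p1'; have P2 := mulr_gt0 (divr_gt0 t2 d0) p2'.
  apply: ler_pM => //; first exact: ltW (mulr_gt0 P1 P2).
    by apply: ltW; apply: mulr_gt0; [exact: divr_gt0 | rewrite invr_gt0].
  by apply: ler_pM => //; exact: ltW.
Qed.

End ConvolutionRatio.

(** * The S-transform *)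

Section STransform.
Context {R : realType}.
Variable nu : probability (\bar R) R.
Hypothesis nuP : nu half_line = 1%E.
Hypothesis nu_oo : nu [set +oo%E] = 0%E.
Implicit Types (t s tau a : R).

Lemma half_lineE : (half_line : set (\bar R)) = `[0%E, +oo%E[%classic `|` [set +oo%E].
Proof.
apply/seteqP; split => [[x| |]|x] /=.
- by rewrite /half_line /= !in_itv /= => /andP[-> _]; left; rewrite ltry.
- by right.
- by rewrite /half_line /= in_itv.
- by case=> [|->]; rewrite /half_line /= !in_itv /= ?leey ?andbT// => /andP[->].
Qed.

Lemma half_line_finite : nu `[0%E, +oo%E[%classic = 1%E.
Proof.
rewrite -nuP half_lineE measureU.
- by rewrite [X in (_ + X)%E](_ : _ = 0%E) ?adde0//; exact: nu_oo.
- exact: emeasurable_itv.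
- exact: emeasurable_set1.
- by apply/seteqP; split => // x [/= + xE]; rewrite xE in_itv /= ltxx andbF.
Qed.

Lemma mass_infty0 : mass_infty nu = 0.
Proof. by rewrite /mass_infty nu_oo. Qed.

(** The two integrands differ by 1 at finite points, and +oo carries no mass. *)
Lemma psi_transform_pole t : 0 < t -> psi_transform nu (- t^-1) = pole_transform nu t - 1.
Proof.
move=> t0; have mD := @measurable_half_line R.
have nuD : (nu half_line < +oo)%E by rewrite nuP ltry.
have i1 := integrable_pole nuP t0.
have i2 : nu.-integrable half_line (EFin \o (fun=> 1 : R)).
  apply: (@bounded_integrable _ _ _ _ _ mD nuD _ 1) => //.
  by move=> x _; rewrite normr1.
have e1 : fine (nu half_line) = 1 by rewrite nuP.
have -> : pole_transform nu t - 1 =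
    \int[nu]_(x in half_line) (pole t (contract x) - 1).
  by rewrite RintegralB// Rintegral_cst//= [X in _ - 1 * X]e1 mulr1.
rewrite /psi_transform /Rintegral; congr fine.
rewrite [RHS](@negligible_integral _ _ _ nu half_line [set +oo%E])//; last first.
- by have := integrableB mD i1 i2; apply: eq_integrable.
have -> : half_line `\` [set +oo%E] = `[0%E, +oo%E[%classic :> set (\bar R).
  rewrite half_lineE; apply/seteqP; split => [x [[xI _ //|xE nx]]|x xI].
    by case: nx.
  split; first by left.
  by move=> /= xE; move: xI; rewrite xE /= in_itv /= ltxx andbF.
apply: eq_integral => -[x| |] /set_mem; rewrite /= in_itv /= ?ltxx ?andbF//.
move=> /andP[x0 _].
congr EFin; rewrite lee_fin in x0; rewrite /= ger0_norm// pole_contract//.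
have tx : 0 < t + x by rewrite ltr_pwDl.
by field; rewrite (gt_eqF t0) (gt_eqF tx).
Qed.

Hypothesis nu0 : mass_zero nu < 1.

Let gap : mass_zero nu < 1 - mass_infty nu.
Proof. by rewrite mass_infty0 subr0. Qed.

(** The strict monotonicity of the transform makes the preimage under psi unique. *)
Lemma psi_inverse_pole tau : 0 < tau ->
  psi_inverse nu (pole_transform nu tau - 1) = - tau^-1.
Proof.
move=> tau0; rewrite /psi_inverse; case: xgetP => [s _ [s0 ps]|/(_ (- tau^-1))]; last first.
  by case; split; [rewrite oppr_lt0 invr_gt0 | exact: psi_transform_pole].
pose u := - s^-1; have u0 : 0 < u by rewrite oppr_gt0 invr_lt0.
have su : s = - u^-1 by rewrite /u invrN invrK opprK.
move: ps; rewrite su psi_transform_pole// => /addIr E.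
congr (- _^-1); apply/eqP; rewrite eq_le !leNgt; apply/andP; split; apply/negP => lt.
  by have := pole_transform_mono nuP gap tau0 lt; rewrite E ltxx.
by have := pole_transform_mono nuP gap u0 lt; rewrite E ltxx.
Qed.

Lemma S_transform_pole tau a : 0 < tau -> pole_transform nu tau = a ->
  S_transform nu (a - 1) = a / (a - 1) * - tau^-1.
Proof. by move=> tau0 <-; rewrite /S_transform psi_inverse_pole// subrK. Qed.

End STransform.

(** * Conclusion *)

Section Assembly.
Context {R : realType}.
Implicit Types (nu : probability (\bar R) R) (a : R).

Lemma mass_zeroE nu : nu [set 0%E] = (mass_zero nu)%:E.
Proof. by rewrite /mass_zero fineK// fin_num_measure//; exact: emeasurable_set1. Qed.

Lemma mass_inftyE nu : nu [set +oo%E] = (mass_infty nu)%:E.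
Proof. by rewrite /mass_infty fineK// fin_num_measure//; exact: emeasurable_set1. Qed.

Lemma in_gapE nu a :
  (`]nu [set 0%E], (1 - nu [set +oo])%E[%classic : set (\bar R)) a%:E = in_gap nu a :> Prop.
Proof. by rewrite mass_zeroE mass_inftyE /= in_itv /= -EFinB !lte_fin. Qed.

Lemma nondegenerate_of_gap nu a : nu half_line = 1%E -> nu [set +oo%E] = 0%E ->
  in_gap nu a -> Defs.nondegenerate nu.
Proof.
move=> nuP nu_oo aI; split; first exact: half_line_finite.
rewrite mass_zeroE lte_fin; have /andP[_ a1] := in_gap_lt aI.
by case/andP: aI => + _; move/lt_trans; apply.
Qed.

Lemma S_domainE nu t : S_domain nu t = (mass_zero nu - 1 < t < 0) :> Prop.
Proof. by rewrite /S_domain /= in_itv. Qed.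

(** The values of the transform of nu lie in [nu {0}, 1 - nu {+oo}], and they contain
the common gap; this bounds nu {0} by the larger of the two given atoms
at 0 and excludes an atom at +oo. The equation between the S-transforms is
then the definition of [inverse_product]. *)
Lemma is_free_mul_inverse_product nu1 nu2 nu a0 :
  nu1 half_line = 1%E -> nu2 half_line = 1%E -> nu half_line = 1%E ->
  nu1 [set +oo%E] = 0%E -> nu2 [set +oo%E] = 0%E ->
  in_gap nu1 a0 -> in_gap nu2 a0 ->
  (forall a, in_gap nu1 a -> in_gap nu2 a ->
     pole_transform nu (inverse_product nu1 nu2 a) = a) ->
  is_free_mul nu1 nu2 nu.
Proof.
move=> nu1P nu2P nuP nu1y nu2y a01 a02 H.
have m1 := mass_infty0 nu1y; have m2 := mass_infty0 nu2y.
have gap1 a : mass_zero nu1 < a -> a < 1 -> in_gap nu1 a.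
  by move=> h1 h2; rewrite /in_gap h1 m1 subr0.
have gap2 a : mass_zero nu2 < a -> a < 1 -> in_gap nu2 a.
  by move=> h1 h2; rewrite /in_gap h1 m2 subr0.
have le_gap a : in_gap nu1 a -> in_gap nu2 a -> mass_zero nu <= a <= 1 - mass_infty nu.
  move=> a1 a2; have h0 := inverse_product_gt0 nu1P nu2P a1 a2.
  have := pole_transform_ge nuP h0; have := pole_transform_le nuP h0.
  by rewrite (H _ a1 a2) => -> ->.
have /andP[a0_gt0 a0_lt1] := in_gap_lt a01.
have l1 : mass_zero nu1 < a0 by case/andP: a01.
have l2 : mass_zero nu2 < a0 by case/andP: a02.
have nuy : nu [set +oo%E] = 0%E.
  rewrite mass_inftyE; congr EFin; apply/eqP; rewrite eq_le; apply/andP; split.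
    rewrite leNgt; apply/negP => m0.
    pose a := Num.max a0 (1 - mass_infty nu / 2).
    have h1 : a0 <= a by rewrite /a le_max lexx.
    have h2 : 1 - mass_infty nu / 2 <= a by rewrite /a le_max lexx orbT.
    have h3 : a < 1 by rewrite /a gt_max a0_lt1 /=; lra.
    have /andP[_] := le_gap a (gap1 a (lt_le_trans l1 h1) h3) (gap2 a (lt_le_trans l2 h1) h3).
    by lra.
  exact: fine_ge0.
have nu01 : mass_zero nu < 1.
  by have /andP[h _] := le_gap _ a01 a02; exact: le_lt_trans h a0_lt1.
split.
- exact: nondegenerate_of_gap a01.
- exact: nondegenerate_of_gap a02.
- split; first exact: half_line_finite.
  by rewrite mass_zeroE lte_fin.
- move=> t [] ; rewrite !S_domainE => /andP[t1 t0] /andP[t2 _].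
  rewrite t0 andbT; pose m := Num.max (mass_zero nu1) (mass_zero nu2).
  have mt : m < t + 1 by rewrite /m gt_max; apply/andP; split; lra.
  have m1' : mass_zero nu1 <= m by rewrite /m le_max lexx.
  have m2' : mass_zero nu2 <= m by rewrite /m le_max lexx orbT.
  pose a := (m + (t + 1)) / 2.
  have am : m < a by rewrite /a; lra.
  have at1 : a < t + 1 by rewrite /a; lra.
  have a1 : a < 1 by lra.
  have /andP[h _] := le_gap a (gap1 a (le_lt_trans m1' am) a1) (gap2 a (le_lt_trans m2' am) a1).
  by lra.
- move=> t []; rewrite !S_domainE => /andP[t1 t0] /andP[t2 _].
  have a1 : in_gap nu1 (t + 1) by apply: gap1; lra.
  have a2 : in_gap nu2 (t + 1) by apply: gap2; lra.
  have -> : t = t + 1 - 1 by rewrite addrK.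
  have [tau1 F1] := pole_inverseP nu1P a1; have [tau2 F2] := pole_inverseP nu2P a2.
  have h0 := inverse_product_gt0 nu1P nu2P a1 a2.
  have [p1 p2] : mass_zero nu1 < 1 /\ mass_zero nu2 < 1 by split; lra.
  rewrite (S_transform_pole nuP nuy nu01 h0 (H _ a1 a2)).
  rewrite (S_transform_pole nu1P nu1y p1 tau1 F1) (S_transform_pole nu2P nu2y p2 tau2 F2).
  have tn : t != 0 by rewrite lt_eqF.
  have t1n : t + 1 != 0 by have /andP[h _] := in_gap_lt a1; rewrite gt_eqF.
  rewrite /inverse_product; move: tau1 tau2.
  move: (pole_inverse nu1 _) (pole_inverse nu2 _) => x y x0 y0.
  have tn' : 1 - (t + 1) != 0 by rewrite opprD addrCA subrr addr0 oppr_eq0.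
  by field; rewrite tn' t1n addrK tn (gt_eqF x0) (gt_eqF y0).
Qed.

End Assembly.

Theorem theorem3p7 (R : realType) (Q1 Q2 : nat -> {poly R})
    (nu1 nu2 : probability (\bar R) R)
    (hQ1 : forall n, (0 < n)%N ->
       [/\ Q1 n != 0, (size (Q1 n) <= n.+1)%N & nonneg_rooted (Q1 n)])
    (hQ2 : forall n, (0 < n)%N ->
       [/\ Q2 n != 0, (size (Q2 n) <= n.+1)%N & nonneg_rooted (Q2 n)])
    (hnu1 : nu1 `[0%E, +oo%E]%classic = 1%E)
    (hnu2 : nu2 `[0%E, +oo%E]%classic = 1%E)
    (hcvg1 : weak_cvg (fun n => empirical_zeros n (Q1 n)) nu1)
    (hcvg2 : weak_cvg (fun n => empirical_zeros n (Q2 n)) nu2)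
    (hmeet : `]nu1 [set 0%E], (1 - nu1 [set +oo])%E[%classic `&`
             `]nu2 [set 0%E], (1 - nu2 [set +oo])%E[%classic !=set0) :
  exists nu : probability (\bar R) R,
    [/\ nu `[0%E, +oo%E]%classic = 1%E,
        \forall n \near \oo, finite_free_mul n (Q1 n) (Q2 n) != 0 /\
          nonneg_rooted (finite_free_mul n (Q1 n) (Q2 n)),
        weak_cvg
          (fun n => empirical_zeros n (finite_free_mul n (Q1 n) (Q2 n))) nu
      & nu1 [set +oo%E] = 0%E -> nu2 [set +oo%E] = 0%E ->
          is_free_mul nu1 nu2 nu].
Proof.
have [a0 [a01 a02]] : exists a, in_gap nu1 a /\ in_gap nu2 a.
  case: hmeet => -[a| |] []; rewrite ?in_gapE; first by exists a.
  - by rewrite mass_zeroE mass_inftyE /= in_itv /= andbF.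
  - by rewrite mass_zeroE mass_inftyE /= in_itv.
pose Qc n := finite_free_mul n (Q1 n) (Q2 n).
have ratio a : in_gap nu1 a -> in_gap nu2 a ->
    has_ratio (fun n => real_zeros (Qc n)) a (inverse_product nu1 nu2 a).
  move=> a1 a2; apply: (convolution_has_ratio hQ1 hQ2 (in_gap_lt a1)).
  - by have [] := pole_inverseP hnu1 a1.
  - by have [] := pole_inverseP hnu2 a2.
  - exact: empirical_has_ratio.
  - exact: empirical_has_ratio.
have good : \forall n \near \oo, Qc n != 0 /\ nonneg_rooted (Qc n).
  exact: (near_finite_free_mul_good hQ1 hQ2 (in_gap_lt a01)
    (empirical_has_ratio hQ1 hnu1 hcvg1 a01) (empirical_has_ratio hQ2 hnu2 hcvg2 a02)).
have sQc n : (size (Qc n) <= n.+1)%N by exact: size_poly.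
have zc : \forall n \near \oo, {in real_zeros (Qc n), forall a, 0 <= a}.
  by apply: filterS good => n [Q0 nQ]; have [_] := nonneg_rooted_factor Q0 nQ.
(* the finitely many degenerate n get dummy lists, so that all lists have size n *)
pose goodb n := `[< Qc n != 0 /\ nonneg_rooted (Qc n) >].
pose l n := if goodb n then contracted_zeros n (Qc n) else nseq n 0.
have size_l n : size (l n) = n.
  rewrite /l /goodb; case: asboolP => [[Q0 nQ]|_]; last exact: size_nseq.
  by have [_ _ s] := nonneg_rooted_factor Q0 nQ; rewrite size_contracted_zeros.
have l01 n : {in l n, forall v, 0 <= v <= 1}.
  rewrite /l /goodb; case: asboolP => [[Q0 nQ]|_ v].
    by have [_ z0 _] := nonneg_rooted_factor Q0 nQ; exact: contracted_zeros_itv.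
  by rewrite mem_nseq => /andP[_ /eqP ->]; rewrite lexx ler01.
have near_l : \forall n \near \oo, l n = contracted_zeros n (Qc n).
  by apply: filterS good => n gn; rewrite /l /goodb; case: asboolP.
have near_pole t : 0 < t -> \forall n \near \oo,
    average l n (pole t) = n%:R^-1 * pole_sum (real_zeros (Qc n)) t.
  move=> t0; apply: filterS2 near_l zc => n ln z0.
  by rewrite /average ln sum_pole_contracted_zeros.
have cvg_pole t : 0 < t -> cvgn ((average l) ^~ (pole t)).
  move=> t0; have /cvg_ex[x cx] := transform_is_cvg hnu1 hnu2 zc a01 a02 ratio t0.
  apply/cvg_ex; exists x; apply: cvg_trans cx; apply: near_eq_cvg.
  by apply: filterS (near_pole t t0) => n ->.
have [nu [nuP nu_cvg]] := weak_limit_exists size_l l01 cvg_pole.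
exists nu; split => //.
- move=> f cf; have mD := @measurable_half_line R.
  have nuD : (nu half_line < +oo)%E by rewrite nuP ltry.
  have fi := integrable_fin_num mD (integrable_within nuD cf).
  rewrite -(fineK fi); apply: cvg_EFin.
    apply: filterS zc => n z0; rewrite integral_empirical_expand//.
    exact: measurable_within.
  apply: cvg_trans (nu_cvg f cf); apply: near_eq_cvg.
  apply: filterS2 near_l zc => n ln z0 /=.
  rewrite integral_empirical_expand//; last exact: measurable_within.
  by rewrite /average ln.
- move=> nu1y nu2y.
  apply: (is_free_mul_inverse_product hnu1 hnu2 nuP nu1y nu2y a01 a02) => a a1 a2.
  have h0 := inverse_product_gt0 hnu1 hnu2 a1 a2.
  have cf := within_continuous_contract (within_continuous_pole h0).
  apply: (@cvg_unique _ _ _ _ _ _ (nu_cvg _ cf)) => //.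
  apply: cvg_trans (transform_cvg_at_inverse_product hnu1 hnu2 zc ratio a1 a2).
  apply: near_eq_cvg; apply: filterS (near_pole _ h0) => n <-.
    by apply: (eq_average l01) => v v01; rewrite /comp expand_contract_itv.
Qed.
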